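(* Let $\alpha\in(0,1)$ and $\lambda\in(0,\infty)$ be deterministic constants, and let $(X^{(1)}_k)_{k\in\mathbb Z_+}$ be a strictly stationary INAR(1) process with Poisson innovations (defined in the context). Put $S^{(1)}_k:=X^{(1)}_k-\mathbb E(X^{(1)}_k)$. Then $$\biggl(n^{-\frac12}\sum_{k=1}^{\lfloor nt\rfloor}S^{(1)}_k\biggr)_{t\in[0,\infty)}=\biggl(n^{-\frac12}\sum_{k=1}^{\lfloor nt\rfloor}(X^{(1)}_k-\mathbb E(X^{(1)}_k))\biggr)_{t\in[0,\infty)}\stackrel{\mathcal D}{\longrightarrow}\frac{\sqrt{\lambda(1+\alpha)}}{1-\alpha}\,B$$ as $n\to\infty$, where $B=(B_t)_{t\in[0,\infty)}$ is a standard Brownian motion.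
   Context: $\mathbb N=\{1,2,\dots\}$, $\mathbb Z_+=\{0,1,2,\dots\}$. Stationary INAR(1) process with Poisson innovations: let $X_0$, $\xi_{k,j}$, $\varepsilon_k$ ($k,j\in\mathbb N$) be independent random variables such that each $\xi_{k,j}$ is Bernoulli with $\mathbb P(\xi_{k,j}=1)=\alpha=1-\mathbb P(\xi_{k,j}=0)$, each $\varepsilon_k$ is Poisson with parameter $\lambda$, and $X_0$ is Poisson with parameter $\lambda/(1-\alpha)$. Define $X_k=\sum_{j=1}^{X_{k-1}}\xi_{k,j}+\varepsilon_k$, $k\in\mathbb N$ (with $\sum_{j=1}^0:=0$). $(X^{(1)}_k)_{k\in\mathbb Z_+}$ is a copy of $(X_k)_{k\in\mathbb Z_+}$; $\mathbb E(X^{(1)}_k)=\lambda/(1-\alpha)$. $\stackrel{\mathcal D}{\longrightarrow}$ denotes weak convergence of stochastic processes with sample paths in $D(\mathbb R_+,\mathbb R)$, the space of real-valued càdlàg functions on $\mathbb R_+=[0,\infty)$ (with the Skorokhod topology). *)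

(* Defs.v *)
From HB Require Import structures.
From mathcomp Require Import all_boot all_order all_algebra.
From mathcomp Require Import all_classical all_reals all_analysis.
From mathcomp Require Import lra.

Set Implicit Arguments.
Unset Strict Implicit.
Unset Printing Implicit Defensive.

Import Order.TTheory GRing.Theory Num.Theory.
Import numFieldTopology.Exports numFieldNormedType.Exports.

Local Open Scope classical_set_scope.
Local Open Scope ring_scope.

Definition cadlag (R : realType) (x : R -> R) : Prop :=
  (forall t, 0 <= t -> x s @[s --> t^'+] --> x t) /\
  (forall t, 0 < t -> cvg (x s @[s --> t^'-])).

(* The space D(R_+, R).  A path is stored as a function on all of R that is
   constant on the negative half-line, so that distinct elements are distinct
   functions on R_+. *)
Record skorokhod (R : realType) := Skorokhod {
  skorokhod_path :> R -> R;
  path_cadlag : cadlag skorokhod_path;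
  path_neg : forall t, t < 0 -> skorokhod_path t = skorokhod_path 0 }.

HB.instance Definition _ (R : realType) := gen_eqMixin (skorokhod R).
HB.instance Definition _ (R : realType) := gen_choiceMixin (skorokhod R).

Lemma cadlag_cst (R : realType) (c : R) : cadlag (fun=> c).
Proof. by split=> t _; [exact: cvg_cst|exact: is_cvg_cst]. Qed.

Definition skorokhod_cst (R : realType) (c : R) : skorokhod R :=
  @Skorokhod R (fun=> c) (cadlag_cst c) (fun _ _ => erefl).

HB.instance Definition _ (R : realType) :=
  isPointed.Build (skorokhod R) (skorokhod_cst 0).

(* Increasing bijections of R_+, which are automatically continuous. *)
Definition time_change (R : realType) (l : R -> R) : Prop :=
  set_bij `[0, +oo[ `[0, +oo[ l /\ {in `[0, +oo[ &, {homo l : s t / s < t}}.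

(* The y for which some time change l satisfies
     sup_(s >= 0) |l s - s| < e  and  sup_(0 <= s <= N) |y (l s) - x s| < e;
   the number r < e witnesses that the suprema, and not only the individual
   differences, are smaller than e, which is what makes these sets open. *)
Definition skorokhod_ball (R : realType) (x : skorokhod R) (N e : R) :
    set (skorokhod R) :=
  [set y | exists l r, [/\ time_change l, r < e,
    (forall s, 0 <= s -> `|l s - s| <= r) &
    (forall s, 0 <= s <= N -> `|y (l s) - x s| <= r)]].

Lemma time_change_id (R : realType) : time_change (@id R).
Proof.
by split; [split=> //= t t0; exists t|move=> s t _ _].
Qed.

Lemma time_change_ge0 (R : realType) (l : R -> R) s :
  time_change l -> 0 <= s -> 0 <= l s.
Proof.
move=> [[ml _ _] _] s0; have := ml s; rewrite /= !in_itv/= !andbT; exact.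
Qed.

Lemma time_change_comp (R : realType) (l m : R -> R) :
  time_change l -> time_change m -> time_change (m \o l).
Proof.
move=> tl tm; have [bl hl] := tl; have [bm hm] := tm; split.
  exact: set_bij_comp bl bm.
move=> s t; rewrite !in_itv/= !andbT => s0 t0 st.
by apply: hm; rewrite ?in_itv/= ?andbT ?(time_change_ge0 tl)//;
   apply: hl; rewrite ?in_itv/= ?andbT.
Qed.

Lemma skorokhod_ball_center (R : realType) (x : skorokhod R) (N e : R) :
  0 < e -> skorokhod_ball x N e x.
Proof.
move=> e0; exists id, 0; split=> //; first exact: time_change_id.
  by move=> s _; rewrite subrr normr0.
by move=> s _; rewrite subrr normr0.
Qed.

Lemma le_skorokhod_ball (R : realType) (x : skorokhod R) (N M e r : R) :
  N <= M -> r <= e -> skorokhod_ball x M r `<=` skorokhod_ball x N e.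
Proof.
move=> NM re y [l [q [tl qr hl hy]]]; exists l, q; split=> //.
  exact: lt_le_trans re.
by move=> s /andP[s0 sN]; apply: hy; rewrite s0 (le_trans sN).
Qed.

Lemma skorokhod_ball_open (R : realType) (x y : skorokhod R) (N e : R) :
  skorokhod_ball x N e y ->
  exists M r, 0 < r /\ skorokhod_ball y M r `<=` skorokhod_ball x N e.
Proof.
move=> [l [q [tl qe hl hy]]]; exists (N + q), (e - q).
rewrite subr_gt0; split=> // z [m [p [tm pe hm hz]]].
exists (m \o l), (p + q); split.
- exact: time_change_comp.
- lra.
- move=> s s0 /=; have := hl _ s0; have := hm _ (time_change_ge0 tl s0).
  by rewrite !ler_norml; lra.
- move=> s /andP[s0 sN] /=.
  have ls0 := time_change_ge0 tl s0.
  have hl' := hl _ s0.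
  have /hz : 0 <= l s <= N + q by move: hl'; rewrite ler_norml ls0/=; lra.
  have /hy : 0 <= s <= N by rewrite s0.
  by rewrite !ler_norml; lra.
Qed.

Lemma skorokhod_ball_cover (R : realType) :
  \bigcup_(i in [set: skorokhod R * R * R]) skorokhod_ball i.1.1 i.1.2 i.2 =
  setT.
Proof.
rewrite -subTset => x _; exists (x, 0, 1) => //=.
by apply: skorokhod_ball_center; exact: ltr01.
Qed.

Lemma skorokhod_ball_join (R : realType) (i j : skorokhod R * R * R) z :
  [set: skorokhod R * R * R] i -> [set: skorokhod R * R * R] j ->
  skorokhod_ball i.1.1 i.1.2 i.2 z -> skorokhod_ball j.1.1 j.1.2 j.2 z ->
  exists k : skorokhod R * R * R, [/\ [set: skorokhod R * R * R] k,
    skorokhod_ball k.1.1 k.1.2 k.2 z &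
    skorokhod_ball k.1.1 k.1.2 k.2 `<=`
    skorokhod_ball i.1.1 i.1.2 i.2 `&` skorokhod_ball j.1.1 j.1.2 j.2].
Proof.
move=> _ _ /skorokhod_ball_open[M [r [r0 hi]]].
move=> /skorokhod_ball_open[N [q [q0 hj]]].
exists (z, Num.max M N, Num.min r q); split=> //=.
  by apply: skorokhod_ball_center; rewrite lt_min r0.
move=> y zy; split.
  by apply/hi/(le_skorokhod_ball _ _ zy); rewrite ?le_max ?ge_min lexx ?orbT.
by apply/hj/(le_skorokhod_ball _ _ zy); rewrite ?le_max ?ge_min lexx ?orbT.
Qed.

(* The Skorokhod (J1) topology: the one with the sets [skorokhod_ball] as a
   base.  The lemmas below check that the balls around x form a neighbourhood
   base of x (so the topology is first countable) and that its convergent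
   sequences are those of Jacod and Shiryaev, Theorem VI.1.14. *)
HB.instance Definition _ (R : realType) :=
  @isBaseTopological.Build (skorokhod R) (skorokhod R * R * R)%type setT
    (fun i => skorokhod_ball i.1.1 i.1.2 i.2)
    (@skorokhod_ball_cover R) (@skorokhod_ball_join R).

Lemma open_skorokhod_ball (R : realType) (x : skorokhod R) (N e : R) :
  open (skorokhod_ball x N e).
Proof. by exists [set (x, N, e)] => //; rewrite bigcup_set1. Qed.

Lemma nbhs_skorokhodP (R : realType) (x : skorokhod R) (A : set (skorokhod R)) :
  nbhs x A <-> exists N e, 0 < e /\ skorokhod_ball x N e `<=` A.
Proof.
split=> [|[N [e [e0 NeA]]]].
  rewrite nbhsE => -[U [[D' _ <-] [[[y M] r] /= D'i xi]] UA].
  have [N [e [e0 h]]] := skorokhod_ball_open xi.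
  exists N, e; split=> // z /h zi; apply: UA.
  by exists (y, M, r).
rewrite nbhsE; exists (skorokhod_ball x N e) => //.
by split; [exact: open_skorokhod_ball|exact: skorokhod_ball_center].
Qed.

Lemma skorokhod_cvgP (R : realType) (x_ : nat -> skorokhod R)
    (x : skorokhod R) :
  x_ @ \oo --> x <->
  exists l_ : nat -> R -> R, [/\ forall n, time_change (l_ n),
    forall e : R, 0 < e -> \forall n \near \oo,
      forall s : R, 0 <= s -> `|l_ n s - s| <= e &
    forall N e : R, 0 < e -> \forall n \near \oo,
      forall s : R, 0 <= s <= N -> `|x_ n (l_ n s) - x s| <= e].
Proof.
split=> [xx|[l_ [tl hl hx]]]; last first.
  move=> A /nbhs_skorokhodP[N [e [e0 NeA]]].
  have e20 : 0 < e / 2 by rewrite divr_gt0.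
  suff : \forall n \near \oo, A (x_ n) by [].
  near=> n; apply: NeA; exists (l_ n), (e / 2); split=> //.
  - by rewrite ltr_pdivrMr// ltr_pMr// ltr1n.
  - by near: n; exact: hl.
  - by near: n; exact: hx.
pose b k := skorokhod_ball x k%:R k.+1%:R^-1.
pose good n k l := [/\ time_change l,
  forall s : R, 0 <= s -> `|l s - s| <= k.+1%:R^-1 &
  forall s, 0 <= s <= k%:R -> `|x_ n (l s) - x s| <= k.+1%:R^-1].
have H n m : exists l, time_change l /\
    forall k, (k <= m)%N -> b k (x_ n) -> good n k l.
  have bgood k : b k (x_ n) -> exists l, good n k l.
    move=> [l [r [tl /ltW rk h1 h2]]]; exists l; split=> // s hs.
      exact: (le_trans (h1 _ hs)).
    exact: (le_trans (h2 _ hs)).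
  elim: m => [|m [l [tl lm]]].
    have [/bgood[l gl]|nb] := pselect (b 0%N (x_ n)).
      exists l; split; first by case: gl.
      by move=> k; rewrite leqn0 => /eqP ->.
    exists id; split; first exact: time_change_id.
    by move=> k; rewrite leqn0 => /eqP -> /nb.
  have [/bgood[l' gl']|nb] := pselect (b m.+1 (x_ n)).
    have [tl' h1 h2] := gl'.
    exists l'; split=> // k km _; split=> // s hs.
      by rewrite (le_trans (h1 _ hs))// lef_pV2 ?posrE// ler_nat ltnS.
    case/andP: hs => s0 sk.
    rewrite (le_trans (h2 s _)) ?s0 ?(le_trans sk) ?ler_nat//.
    by rewrite lef_pV2 ?posrE// ler_nat ltnS.
  exists l; split=> // k; rewrite leq_eqVlt => /orP[/eqP -> /nb//|].
  by rewrite ltnS; exact: lm.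
pose l_ n := sval (cid (H n n)).
have l_P n : time_change (l_ n) /\
    forall k, (k <= n)%N -> b k (x_ n) -> good n k (l_ n).
  by rewrite /l_; case: cid.
have Hgood k : \forall n \near \oo, good n k (l_ n).
  near=> n; apply: (l_P n).2; near: n; first exact: nbhs_infty_ge.
  apply: xx; apply/nbhs_skorokhodP; exists k%:R, k.+1%:R^-1.
  by split.
have small (N e : R) : 0 < e ->
    exists k : nat, N <= k%:R /\ k.+1%:R^-1 <= e.
  move=> e0; exists (maxn (Num.truncn N).+1 (Num.truncn e^-1).+1); split.
    by rewrite (le_trans (ltW (truncnS_gt N)))// ler_nat leq_max leqnn.
  rewrite invf_ple ?posrE//; apply: (le_trans (ltW (truncnS_gt _))).
  by rewrite ler_nat ltnW// ltnS leq_max leqnn orbT.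
exists l_; split=> [n|e e0|N e e0].
- exact: (l_P n).1.
- have [k [_ ke]] := small 0 e e0.
  apply: filterS (Hgood k) => n [_ h _] s s0; exact: le_trans (h _ s0) ke.
- have [k [Nk ke]] := small N e e0.
  apply: filterS (Hgood k) => n [_ _ h] s /andP[s0 sN].
  by rewrite (le_trans _ ke)// h// s0 (le_trans sN).
Unshelve. all: by end_near. Qed.

Lemma cadlag_scale (R : realType) (c : R) (x : skorokhod R) :
  cadlag (fun t => c * x t).
Proof.
have [xr xl] := path_cadlag x; split=> t t0.
  by apply: cvgM; [exact: cvg_cst|exact: xr].
by apply: is_cvgM; [exact: is_cvg_cst|exact: xl].
Qed.

Lemma scale_neg (R : realType) (c : R) (x : skorokhod R) t :
  t < 0 -> c * x t = c * x 0.
Proof. by move=> t0; rewrite path_neg. Qed.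

Definition skorokhod_scale (R : realType) (c : R) (x : skorokhod R) :
    skorokhod R :=
  Skorokhod (cadlag_scale c x) (@scale_neg R c x).

Lemma cadlag_step (R : realType) (u : nat -> R) (n : nat) :
  cadlag (fun t => u (Num.truncn (n%:R * t))).
Proof.
have [->|n0] := posnP n.
  by under eq_fun do rewrite mul0r; exact: cadlag_cst.
have nR : 0 < n%:R :> R by rewrite ltr0n.
split=> t t0.
  apply: cvg_near_cst.
  have ht := truncn_itv (mulr_ge0 (ltW nR) t0).
  near=> s.
  have ts : t < s by near: s; exact: nbhs_right_gt.
  have sn : s < (Num.truncn (n%:R * t)).+1%:R / n%:R.
    near: s; apply: nbhs_right_lt.
    by rewrite ltr_pdivlMr// mulrC; case/andP: (ht).
  congr u; apply: truncn_def.
  move: sn; rewrite ltr_pdivlMr// mulrC => ->; rewrite andbT.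
  case/andP: (ht) => h _; apply: (le_trans h).
  by rewrite ler_pM2l// ltW.
have nt0 : 0 < n%:R * t by rewrite mulr_gt0.
have [m mP] : exists m : nat, m%:R < n%:R * t <= m.+1%:R.
  have /andP[h1 h2] := truncn_itv (ltW nt0).
  move: h1; rewrite le_eqVlt => /orP[/eqP E|h1]; last first.
    by exists (Num.truncn (n%:R * t)); rewrite h1 ltW.
  move: E; case: (Num.truncn _) => [|m] E.
    by move: nt0; rewrite -E ltxx.
  by exists m; rewrite -E lexx ltr_nat leqnn.
case/andP: mP => h1 h2.
apply: (@cvgP _ _ (u m)); apply: cvg_near_cst; near=> s.
have st : s < t by near: s; exact: nbhs_left_lt.
have sm : m%:R / n%:R < s.
  by near: s; apply: nbhs_left_gt; rewrite ltr_pdivrMr// mulrC.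
congr u; apply: truncn_def.
move: sm; rewrite ltr_pdivrMr// mulrC => /ltW -> /=.
by apply: lt_le_trans h2; rewrite ltr_pM2l.
Unshelve. all: by end_near. Qed.

Section partial_sums.
Variables (R : realType) (s : nat -> R) (n : nat).

Definition partial_sum_fun (t : R) : R :=
  (Num.sqrt n%:R)^-1 * \sum_(1 <= k < (Num.truncn (n%:R * t)).+1) s k.

Lemma cadlag_partial_sum : cadlag partial_sum_fun.
Proof.
exact: (@cadlag_step R (fun m => (Num.sqrt n%:R)^-1 * \sum_(1 <= k < m.+1) s k)).
Qed.

Lemma partial_sum_neg t : t < 0 -> partial_sum_fun t = partial_sum_fun 0.
Proof.
move=> t0; rewrite /partial_sum_fun mulr0 truncn0.
have -> // : Num.truncn (n%:R * t) = 0%N.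
apply/truncn0Pn; rewrite -ltNge (le_lt_trans _ ltr01)//.
by rewrite mulr_ge0_le0// ltW.
Qed.

Definition partial_sum_path : skorokhod R :=
  Skorokhod cadlag_partial_sum partial_sum_neg.

End partial_sums.

(* For random elements X n and Y of D(R_+, R), i.e. maps all of whose
   coordinates X n ^~ t and Y ^~ t are random variables, the f \o X n and f \o Y
   below are measurable: the Borel sigma-algebra of the Skorokhod topology is
   generated by the coordinates. *)
Definition weak_cvg (R : realType) (d d' : measure_display)
    (T : measurableType d) (P : probability T R) (X : nat -> T -> skorokhod R)
    (T' : measurableType d') (P' : probability T' R) (Y : T' -> skorokhod R) :
    Prop :=
  forall f : skorokhod R -> R, continuous f ->
    (exists M, forall x, `|f x| <= M) ->
    ('E_P[f \o X n] @[n --> \oo] --> 'E_P'[f \o Y])%E.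

Definition mutual_independence (R : realType) (d d' : measure_display)
    (T : measurableType d) (P : probability T R) (T' : measurableType d')
    (I : eqType) (X : I -> T -> T') : Prop :=
  forall (J : seq I) (A : I -> set T'), uniq J ->
    (forall i, measurable (A i)) ->
    P (\bigcap_(i in [set` J]) (X i @^-1` A i)) =
    (\prod_(i <- J) P (X i @^-1` A i))%E.

Definition standard_brownian_motion (R : realType) (d : measure_display)
    (T : measurableType d) (P : probability T R) (B : T -> skorokhod R) :
    Prop :=
  [/\ forall t, measurable_fun setT (fun w => B w t),
      {ae P, forall w, B w 0 = 0},
      forall t : nat -> R, 0 <= t 0 -> nondecreasing_seq t ->
        mutual_independence P (fun i w => B w (t i.+1) - B w (t i)),
      forall s t, 0 <= s < t -> forall A, measurable A ->
        P [set w | A (B w t - B w s)] = normal_prob 0 (Num.sqrt (t - s)) A &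
      forall w, continuous (B w)].

Definition poisson_law (R : realType) (d : measure_display)
    (T : measurableType d) (P : probability T R) (rate : R) (X : T -> nat) :
    Prop :=
  forall m, P (X @^-1` [set m]) = (poisson_pmf rate m)%:E.

Definition bernoulli_law (R : realType) (d : measure_display)
    (T : measurableType d) (P : probability T R) (p : R) (X : T -> nat) :
    Prop :=
  P (X @^-1` [set 1%N]) = p%:E /\ P (X @^-1` [set 0%N]) = (1 - p)%:E.

Section inar.
Variables (R : realType) (d : measure_display) (T : measurableType d).
Variable P : probability T R.
(* Indices start from 0: [xi k j] and [eps k] stand for the variables usually
   written with indices (k+1, j+1) and k+1. *)
Variables (X0 : {RV P >-> nat}) (xi : nat -> nat -> {RV P >-> nat}).
Variable eps : nat -> {RV P >-> nat}.

Definition inar_input (i : option (nat * nat + nat)) : T -> nat :=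
  match i with
  | None => X0
  | Some (inl kj) => xi kj.1 kj.2
  | Some (inr k) => eps k
  end.

Fixpoint inar (k : nat) (w : T) : nat :=
  if k is k'.+1 then (\sum_(j < inar k' w) xi k' j w + eps k' w)%N else X0 w.

Definition stationary_poisson_inar (alpha lambda : R) : Prop :=
  [/\ mutual_independence P inar_input,
      forall k j, bernoulli_law P alpha (xi k j),
      forall k, poisson_law P lambda (eps k) &
      poisson_law P (lambda / (1 - alpha)) X0].

End inar.

(* Main.v *)
Require Import Defs.
From mathcomp Require Import all_boot all_order all_algebra.
From mathcomp Require Import all_classical all_reals all_analysis.
From mathcomp Require Import measurable_realfun.
From mathcomp Require Import ring lra.

Set Implicit Arguments.
Unset Strict Implicit.
Unset Printing Implicit Defensive.

Import Order.TTheory GRing.Theory Num.Theory.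
Import numFieldTopology.Exports numFieldNormedType.Exports.

Local Open Scope classical_set_scope.
Local Open Scope ring_scope.

(** The partial sums of the centred process [S_k = X_k - mu], with
    [mu = lambda / (1 - alpha)], are a martingale up to a negligible boundary
    term.  Indeed [M_k = S_(k+1) - alpha S_k] is centred given
    [X_0, ..., X_k], and summing over [k] gives
    [(1 - alpha) (S_1 + ... + S_n) = M_0 + ... + M_(n-1) + alpha (S_0 - S_n)]
    ([inar_partial_sum]).  The conditional variance of [M_k] is
    [lambda (1 + alpha) + alpha (1 - alpha) S_k], with mean
    [lambda (1 + alpha)], whence the constant
    [sqrt (lambda (1 + alpha)) / (1 - alpha)].  Fourth moments of [S_k] and
    [M_k] are bounded because every [X_k] has the Poisson law with parameter
    [mu] ([inar_pgf], [inar_moments]).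

    Finite-dimensional distributions.  A linear combination of values of the
    scaled path is a weighted sum of the [M_k] with weights [b_k] of order
    [n^(-1/2)].  Lindeberg's telescoping applied to [E cos] ([lindeberg_cos])
    multiplies by [exp (- lambda (1 + alpha) b_k^2 / 2)] at each step, with an
    error [O(n^(-3/2))].  The random part [alpha (1 - alpha) S_k] of the
    conditional variance does no harm: along the autoregression its correlation
    with a cosine of the past weighted sum is contracted by [alpha] and
    disturbed by [O(n^(-1/2))] at each step, hence stays [O(n^(-1/2))]
    ([inar_centered_decorrelation]).  The same telescoping computes the
    characteristic functions of Brownian motion ([bm_cos]).

    From finite-dimensional to weak convergence ([weak_cvg_criterion]).  A bounded
    continuous functional [f] on the Skorokhod space is the increasing limit of
    functionals [lip_env f k] that are Lipschitz for uniform convergence on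
    [0, k].  Such a functional depends, up to a small error, only on the values
    of the path on a fine grid, as soon as the oscillation of the path between
    grid points is uniformly small with probability close to 1.  Expectations
    of Lipschitz functions of the grid values converge by approximation with
    trigonometric polynomials ([trig_approx], [lipschitz_mean_cvg]).  This bounds
    the lower limit of [E f(X_n)] from below by [E f(Y)], for [f] and for [- f].

    The oscillation between grid points is controlled by a maximal inequality
    for fourth moments, obtained by stopping the partial sums of the [M_k] when
    they reach a level ([stopped_moment4], [inar_path_tight]). *)

(** * Trigonometric approximation of Lipschitz functions *)

Section cosine_bounds.
Context {R : realType}.
Implicit Types x a : R.

(** The mean value inequality on the segment joining 0 to [x], whatever the
    sign of [x]. *)
Lemma norm_MVT0 (f df : R -> R) x (M : R) :
  (forall y : R, is_derive y 1 f (df y)) ->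
  (forall y : R, `|y| <= `|x| -> `|df y| <= M) -> `|f x - f 0| <= M * `|x|.
Proof.
move=> fdf dfM.
have fc y : {for y, continuous f}.
  by apply: differentiable_continuous; apply/derivable1_diffP; case: (fdf y).
have [x0|x0] := leP 0 x.
  have [c cx ->] := MVT_segment x0 (fun y _ => fdf y)
    (continuous_subspaceT fc).
  move: cx; rewrite in_itv/= => /andP[c0 cx].
  by rewrite subr0 normrM ler_wpM2r// dfM// !ger0_norm.
have [c cx] := MVT_segment (ltW x0) (fun y _ => fdf y) (continuous_subspaceT fc).
move: cx; rewrite in_itv/= => /andP[xc c0].
rewrite distrC sub0r => ->.
by rewrite normrM normrN ler_wpM2r// dfM// !ler0_norm ?lerN2// ltW.
Qed.

Lemma norm_sin_le x : `|sin x| <= `|x|.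
Proof.
have := @norm_MVT0 sin cos x 1 (@is_derive_sin R) (fun y _ => cos_max y).
by rewrite sin0 subr0 mul1r.
Qed.

Lemma norm_cosD_le a x : `|cos (a + x) - cos a| <= `|x|.
Proof.
have := @norm_MVT0 (fun y => cos (a + y)) (fun y => - sin (a + y)) x 1.
rewrite addr0 mul1r; apply=> [y|y _]; last by rewrite normrN sin_max.
have := is_derive1_comp (is_derive_cos (a + y))
  (@is_deriveD _ _ _ (cst a) id y 1 0 1 (is_derive_cst _ _ _) (is_derive_id _ _)).
by rewrite add0r mulr1.
Qed.

Lemma cos_le_sqr x : `|1 - cos x| <= x ^+ 2 / 2.
Proof.
have -> : x = x / 2 *+ 2 by rewrite -mulr_natr divfK.
set y := x / 2.
have -> : 1 - cos (y *+ 2) = 2 * sin y ^+ 2.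
  by rewrite cos_mulr2n cos2sin2; ring.
rewrite normrM normrX (@ger0_norm _ 2)//.
have -> : (y *+ 2) ^+ 2 / 2 = 2 * `|y| ^+ 2.
  by rewrite real_normK ?num_real// -mulr_natr; field.
by rewrite ler_pM2l// lerXn2r ?nnegrE// norm_sin_le.
Qed.

Lemma subr_sin_le3 x : `|x - sin x| <= `|x| ^+ 3 / 2.
Proof.
have := @norm_MVT0 (fun y => y - sin y) (fun y => 1 - cos y) x (`|x| ^+ 2 / 2).
rewrite sin0 !subr0 => h; rewrite (le_trans (h _ _))//.
- move=> y yx; rewrite (le_trans (cos_le_sqr _))// ler_pM2r ?invr_gt0//.
  by rewrite -(real_normK (num_real y)) lerXn2r ?nnegrE.
- by rewrite (exprSr _ 2) mulrAC.
Qed.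

Lemma subr_sin_le2 x : `|x - sin x| <= x ^+ 2.
Proof.
rewrite -(real_normK (num_real x)).
have [x2|x2] := leP `|x| 2.
  apply: (le_trans (subr_sin_le3 x)).
  have := normr_ge0 x; nra.
rewrite (le_trans (ler_normB _ _))//.
have := norm_sin_le x; have := normr_ge0 x; nra.
Qed.

Lemma cos_taylor2 x : `|cos x - 1 + x ^+ 2 / 2| <= x ^+ 4 / 2.
Proof.
have := @norm_MVT0 (fun y => cos y + y ^+ 2 / 2) (fun y => y - sin y) x
  (`|x| ^+ 3 / 2).
rewrite cos0 expr0n/= mul0r addr0.
have -> : cos x - 1 + x ^+ 2 / 2 = cos x + x ^+ 2 / 2 - 1 by ring.
move=> h; rewrite (le_trans (h _ _))//.
- move=> y; rewrite addrC.
  apply: is_deriveD.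
  have -> : y = 2^-1 * (2 * y) by field.
  have -> : (fun y0 : R => y0 ^+ 2 / 2) = 2^-1 *: (fun y0 : R => y0 ^+ 2).
    by apply/funext => z; rewrite /GRing.scale/= mulrC.
  apply: is_deriveZ; rewrite mulrA mulVf// mul1r.
  by apply: is_derive_eq; rewrite /GRing.scale/=; ring.
- move=> y yx; rewrite (le_trans (subr_sin_le3 _))// ler_pM2r ?invr_gt0//.
  by rewrite lerXn2r ?nnegrE.
- have -> : x ^+ 4 = `|x| ^+ 4 by rewrite -normrX ger0_norm// exprn_even_ge0.
  by rewrite [in leRHS](exprSr _ 3) mulrAC.
Qed.

(** The remainder is cubic in the increment although only a fourth moment will
    be available: the two error terms, of orders 3 and 4, are merged by
    [|m|^3 <= 1 + m^4]. *)
Lemma cosD_taylor2 a (b m : R) : `|b| <= 1 ->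
  `|cos (a + b * m) - (cos a * (1 - (b * m) ^+ 2 / 2) - sin a * (b * m))| <=
  `|b| ^+ 3 * (1 + m ^+ 4).
Proof.
move=> b1; rewrite cosD.
have -> : cos a * cos (b * m) - sin a * sin (b * m) -
   (cos a * (1 - (b * m) ^+ 2 / 2) - sin a * (b * m)) =
   cos a * (cos (b * m) - 1 + (b * m) ^+ 2 / 2) + sin a * (b * m - sin (b * m)).
  by ring.
rewrite (le_trans (ler_normD _ _))// !normrM.
have h1 : `|cos a| * `|cos (b * m) - 1 + (b * m) ^+ 2 / 2| <= (b * m) ^+ 4 / 2.
  by rewrite -[leRHS]mul1r ler_pM// ?cos_max// cos_taylor2.
have h2 : `|sin a| * `|b * m - sin (b * m)| <= `|b * m| ^+ 3 / 2.
  by rewrite -[leRHS]mul1r ler_pM// ?sin_max// subr_sin_le3.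
rewrite (le_trans (lerD h1 h2))//.
have e4 (x : R) : x ^+ 4 = `|x| ^+ 4.
  by rewrite -normrX ger0_norm// exprn_even_ge0.
rewrite (e4 (b * m)) (e4 m) normrM !exprMn.
have b0 := normr_ge0 b; have m0 := normr_ge0 m.
set B := `|b|; set m' := `|m|.
have hB : B ^+ 4 <= B ^+ 3 by rewrite ler_wiXn2l.
have hm : m' ^+ 3 <= 1 + m' ^+ 4.
  have [m1|m1] := leP m' 1.
    by rewrite (le_trans (exprn_ile1 3 m0 m1))// lerDl exprn_ge0.
  by rewrite (le_trans (ler_weXn2l (ltW m1) (leqnSn 3)))// lerDr.
have B3 : 0 <= B ^+ 3 by rewrite exprn_ge0.
have m4 : 0 <= m' ^+ 4 by rewrite exprn_ge0.
have h3 : B ^+ 4 * m' ^+ 4 <= B ^+ 3 * m' ^+ 4 by rewrite ler_wpM2r.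
have h4 : B ^+ 3 * m' ^+ 3 <= B ^+ 3 * (1 + m' ^+ 4) by rewrite ler_wpM2l.
nra.
Qed.

End cosine_bounds.

(** Real trigonometric polynomials in the first [K] coordinates of a sequence.
    Phases make the sines superfluous. *)
Inductive trig_poly (R : realType) (K : nat) : ((nat -> R) -> R) -> Prop :=
| trig_cos (th : nat -> R) (ph : R) :
    trig_poly K (fun v => cos (\sum_(i < K) th i * v i + ph))
| trig_add g h : trig_poly K g -> trig_poly K h ->
    trig_poly K (fun v => g v + h v)
| trig_scale c g : trig_poly K g -> trig_poly K (fun v => c * g v).

Section trig_poly_theory.
Context {R : realType}.
Implicit Types (K : nat) (g h : (nat -> R) -> R).

Lemma trig_cst K (c : R) : trig_poly K (fun=> c).
Proof.
have := trig_scale c (@trig_cos R K (fun=> 0) 0).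
congr trig_poly; apply/funext => v.
by rewrite big1 ?addr0 ?cos0 ?mulr1// => i _; rewrite mul0r.
Qed.

Lemma trig_mul K g h :
  trig_poly K g -> trig_poly K h -> trig_poly K (fun v => g v * h v).
Proof.
move=> tg th; elim: tg => [th1 ph1|g1 g2 _ ih1 _ ih2|c g1 _ ih1]; last 2 first.
- have := trig_add ih1 ih2; congr trig_poly.
  by apply/funext => v; rewrite mulrDl.
- by have := trig_scale c ih1; congr trig_poly; apply/funext => v; rewrite mulrA.
elim: th => [th2 ph2|h1 h2 _ ih1 _ ih2|c h1 _ ih1]; last 2 first.
- have := trig_add ih1 ih2; congr trig_poly.
  by apply/funext => v; rewrite mulrDr.
- by have := trig_scale c ih1; congr trig_poly; apply/funext => v; rewrite mulrCA.
have := trig_add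
  (trig_scale 2^-1 (@trig_cos R K (fun i => th1 i + th2 i) (ph1 + ph2)))
  (trig_scale 2^-1 (@trig_cos R K (fun i => th1 i - th2 i) (ph1 - ph2))).
congr trig_poly; apply/funext => v.
set a := \sum_(i < K) th1 i * v i + ph1.
set b := \sum_(i < K) th2 i * v i + ph2.
have -> : \sum_(i < K) (th1 i + th2 i) * v i + (ph1 + ph2) = a + b.
  by rewrite /a /b addrACA -big_split/=; congr (_ + _); apply: eq_bigr => i _;
     rewrite mulrDl.
have -> : \sum_(i < K) (th1 i - th2 i) * v i + (ph1 - ph2) = a - b.
  rewrite /a /b opprD addrACA -sumrB; congr (_ + _); apply: eq_bigr => i _.
  by rewrite mulrBl.
by rewrite cosD cosB; field.
Qed.

Lemma trig_exp K g n : trig_poly K g -> trig_poly K (fun v => g v ^+ n).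
Proof.
move=> tg; elim: n => [|n ih]; first exact: trig_cst.
by have := trig_mul tg ih; congr trig_poly; apply/funext => v; rewrite exprS.
Qed.

Lemma trig_sum K (I : Type) (s : seq I) (g : I -> (nat -> R) -> R) :
  (forall i, trig_poly K (g i)) -> trig_poly K (fun v => \sum_(i <- s) g i v).
Proof.
move=> tg; elim: s => [|i s ih].
  by have := trig_cst K 0; congr trig_poly; apply/funext => v; rewrite big_nil.
by have := trig_add (tg i) ih; congr trig_poly; apply/funext => v;
   rewrite big_cons.
Qed.

Lemma trig_widen K g : trig_poly K g -> trig_poly K.+1 g.
Proof.
elim=> [th ph|g1 g2 _ ih1 _ ih2|c g1 _ ih1]; last 2 first.
- exact: trig_add.
- exact: trig_scale.
have := @trig_cos R K.+1 (fun i => if i == K then 0 else th i) ph.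
congr trig_poly; apply/funext => v; rewrite big_ord_recr/= eqxx mul0r addr0.
by congr (cos (_ + _)); apply: eq_bigr => i _; rewrite ltn_eqF.
Qed.

Lemma trig_sin_coord K (i : nat) (A : R) :
  (i < K)%N -> trig_poly K (fun v => sin (v i / A)).
Proof.
move=> iK.
have := @trig_cos R K (fun j => if j == i then A^-1 else 0) (- (pi / 2)).
congr trig_poly; apply/funext => v; rewrite cosBpihalf; congr sin.
rewrite (bigD1 (Ordinal iK))//= eqxx big1 ?addr0; first exact: mulrC.
move=> j ji.
by rewrite ifF ?mul0r//; apply: contraNF ji => /eqP ji; apply/eqP/val_inj.
Qed.

End trig_poly_theory.

Section bernstein.
Context {R : realType}.
Implicit Types (s : R) (N : nat).

Definition bernstein N j s : R := 'C(N, j)%:R * (s ^+ j * (1 - s) ^+ (N - j)).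

Lemma bernstein_ge0 N j s : 0 <= s <= 1 -> 0 <= bernstein N j s.
Proof.
by move=> /andP[s0 s1]; rewrite !mulr_ge0 ?exprn_ge0 ?subr_ge0.
Qed.

Lemma bernstein_recurrence N (h : nat -> R) s :
  \sum_(j < N.+2) bernstein N.+1 j s * h j =
  s * (\sum_(j < N.+1) bernstein N j s * h j.+1) +
  (1 - s) * \sum_(j < N.+1) bernstein N j s * h j.
Proof.
have top : bernstein N N.+1 s = 0 by rewrite /bernstein bin_small// mul0r.
have -> : \sum_(j < N.+1) bernstein N j s * h j =
    \sum_(j < N.+2) bernstein N j s * h j.
  by rewrite [RHS]big_ord_recr/= top mul0r addr0.
rewrite big_ord_recl [X in _ = _ + _ * X]big_ord_recl/= mulrDr.
rewrite [RHS]addrCA; congr (_ + _).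
  by rewrite /bernstein !bin0 !expr0 !subn0 exprS; ring.
rewrite !mulr_sumr -big_split/=; apply: eq_bigr => j _.
rewrite /bump/= add1n /bernstein binS natrD subSS.
have [jN|] := ltnP j N; last first.
  rewrite leq_eqVlt => /orP[/eqP <-|/ltn_geF]; last by rewrite -ltnS ltn_ord.
  by rewrite bin_small// binn subnn !exprS; ring.
by rewrite -[(N - j)%N]prednK ?subn_gt0// -subnS !exprS; ring.
Qed.

Lemma bernstein_sum N s : \sum_(j < N.+1) bernstein N j s = 1.
Proof.
transitivity (\sum_(j < N.+1) bernstein N j s * (fun=> 1) (j : nat)).
  by apply: eq_bigr => j _; rewrite mulr1.
elim: N => [|N ih].
  by rewrite big_ord1 /bernstein bin0 subn0 !expr0 !mulr1.
by rewrite (@bernstein_recurrence N (fun=> 1)) ih; ring.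
Qed.

Lemma bernstein_moment2 N s :
  \sum_(j < N.+1) bernstein N j s * (j%:R - N%:R * s) ^+ 2 =
  N%:R * (s * (1 - s)).
Proof.
have E (c : R) : \sum_(j < N.+1) bernstein N j s * (j%:R - N%:R * s - c) ^+ 2 =
    N%:R * (s * (1 - s)) + c ^+ 2.
  elim: N c => [|N ih] c.
    by rewrite big_ord1 /bernstein bin0 subn0 !expr0/= !mul0r subr0 add0r; ring.
  rewrite (@bernstein_recurrence N (fun j => (j%:R - N.+1%:R * s - c) ^+ 2)).
  rewrite (eq_bigr (fun j : 'I_N.+1 => bernstein N j s *
    (j%:R - N%:R * s - (c + s - 1)) ^+ 2)); last first.
    by move=> j _; rewrite -!natr1; congr (_ * _ ^+ 2); ring.
  rewrite [X in _ + _ * X](eq_bigr (fun j : 'I_N.+1 => bernstein N j s *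
    (j%:R - N%:R * s - (c + s)) ^+ 2)); last first.
    by move=> j _; rewrite -natr1; congr (_ * _ ^+ 2); ring.
  by rewrite !ih -natr1; ring.
have := E 0; rewrite expr0n/= addr0 => <-.
by apply: eq_bigr => j _; rewrite subr0.
Qed.

(** The nodes [A (2j/N - 1)], weighted by the Bernstein basis at
    [s = (1 + sin (x/A)) / 2], are on average close to [x]: the weighted mean of
    the nodes is [A sin (x/A)], which differs from [x] by at most [x^2/A], and
    their spread is [O(A / sqrt N)]. *)
Lemma bernstein_nodes (A : R) N (x : R) : 0 < A -> A ^+ 4 <= N%:R ->
  let s := (1 + sin (x / A)) / 2 in
  \sum_(j < N.+1) bernstein N j s * `|x - A * (2 * (j%:R / N%:R) - 1)| <=
  (x ^+ 2 + 2) / A.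
Proof.
move=> A0 AN /=; set s := (1 + _) / 2.
have N0 : 0 < N%:R :> R by rewrite (lt_le_trans _ AN)// exprn_gt0.
have s01 : 0 <= s <= 1.
  by have := sin_geN1 (x / A); have := sin_le1 (x / A); rewrite /s; lra.
have bnd (j : 'I_N.+1) : `|x - A * (2 * (j%:R / N%:R) - 1)| <=
    (x ^+ 2 + 1) / A + (A ^+ 3 / N%:R ^+ 2) * (j%:R - N%:R * s) ^+ 2.
  have -> : x - A * (2 * (j%:R / N%:R) - 1) =
      (x - A * sin (x / A)) - 2 * A / N%:R * (j%:R - N%:R * s).
    by rewrite /s; field; rewrite gt_eqF.
  apply: (le_trans (ler_normB _ _)).
  have h1 : `|x - A * sin (x / A)| <= x ^+ 2 / A.
    have -> : x - A * sin (x / A) = A * (x / A - sin (x / A)).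
      by field; rewrite gt_eqF.
    rewrite normrM gtr0_norm//.
    apply: (@le_trans _ _ (A * (x / A) ^+ 2)).
      by rewrite ler_pM2l// subr_sin_le2.
    by rewrite le_eqVlt; apply/orP; left; apply/eqP; field; rewrite gt_eqF.
  (* Young's inequality 2 p q <= p^2 / A + A q^2 with p = 1 *)
  have h2 : `|2 * A / N%:R * (j%:R - N%:R * s)| <=
      A^-1 + (A ^+ 3 / N%:R ^+ 2) * (j%:R - N%:R * s) ^+ 2.
    set u := j%:R - N%:R * s.
    have -> : 2 * A / N%:R * u = A^-1 * (2 * (A ^+ 2 / N%:R * u)).
      by field; rewrite !gt_eqF.
    have -> : A^-1 + (A ^+ 3 / N%:R ^+ 2) * u ^+ 2 =
        A^-1 * (1 + (A ^+ 2 / N%:R * u) ^+ 2).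
      by field; rewrite !gt_eqF.
    rewrite normrM gtr0_norm ?invr_gt0// ler_pM2l ?invr_gt0//.
    move: (_ * u) => z; rewrite ler_norml.
    have := sqr_ge0 (z - 1); have := sqr_ge0 (z + 1).
    by move=> z1 z2; apply/andP; split; nra.
  apply: (le_trans (lerD h1 h2)).
  by rewrite addrA mulrDl mul1r.
apply: (@le_trans _ _ (\sum_(j < N.+1) (bernstein N j s * ((x ^+ 2 + 1) / A) +
   (A ^+ 3 / N%:R ^+ 2) * (bernstein N j s * (j%:R - N%:R * s) ^+ 2)))).
  apply: ler_sum => j _.
  by rewrite [in X in _ <= _ + X]mulrCA -mulrDr ler_wpM2l// bernstein_ge0.
rewrite big_split/= -mulr_suml bernstein_sum mul1r -mulr_sumr bernstein_moment2.
have -> : (x ^+ 2 + 2) / A = (x ^+ 2 + 1) / A + A^-1 by field; rewrite gt_eqF.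
rewrite lerD2l.
have -> : A ^+ 3 / N%:R ^+ 2 * (N%:R * (s * (1 - s))) =
   A^-1 * (A ^+ 4 / N%:R) * (s * (1 - s)) by field; rewrite !gt_eqF.
rewrite -mulrA ler_piMr ?invr_ge0 ?(ltW A0)//.
rewrite mulr_ile1 ?mulr_ge0 ?divr_ge0 ?exprn_ge0 ?(ltW A0) ?(ltW N0)//.
- by case/andP: s01; lra.
- by rewrite ler_pdivrMr// mul1r.
- by nra.
Qed.

End bernstein.

Definition lipschitz_coords (R : realType) K (L : R) (g : (nat -> R) -> R) :=
  forall v v' : nat -> R, `|g v - g v'| <= L * \sum_(i < K) `|v i - v' i|.

(** The coordinates are treated one at a time, through Bernstein polynomials in
    [(1 + sin (v_i / A)) / 2].  The error is not uniform but quadratic in [v],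
    which is harmless in the presence of second moments and spares any cut-off
    at infinity. *)
Lemma trig_approx (R : realType) K (L A : R) (g : (nat -> R) -> R) :
  0 <= L -> 0 < A -> lipschitz_coords K L g ->
  exists2 t, trig_poly K t &
    forall v, `|g v - t v| <= L * \sum_(i < K) ((v i ^+ 2 + 2) / A).
Proof.
move=> L0 A0; elim: K g => [|K ih] g gL.
  exists (fun=> g (fun=> 0)); first exact: trig_cst.
  by move=> v; rewrite (le_trans (gL _ _))// !big_ord0.
have [N AN] : exists N : nat, A ^+ 4 <= N%:R.
  by exists (Num.truncn (A ^+ 4)).+1; exact/ltW/truncnS_gt.
pose y (j : nat) : R := A * (2 * (j%:R / N%:R) - 1).
pose upd v (j : nat) : nat -> R := fun i => if i == K then y j else v i.
have gjL j : lipschitz_coords K L (fun v => g (upd v j)).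
  move=> v v'; rewrite (le_trans (gL _ _))// big_ord_recr/= /upd eqxx subrr.
  rewrite normr0 addr0 ler_wpM2l//; apply: ler_sum => i _.
  by rewrite ltn_eqF.
pose t_ j := sval (cid2 (ih _ (gjL j))).
have tt j : trig_poly K (t_ j) by rewrite /t_; case: cid2.
have tg j v : `|g (upd v j) - t_ j v| <= L * \sum_(i < K) ((v i ^+ 2 + 2) / A).
  by rewrite /t_; case: cid2 => ? ? /=.
pose s (v : nat -> R) : R := (1 + sin (v K / A)) / 2.
have ts : trig_poly K.+1 s.
  have := trig_scale 2^-1 (trig_add (trig_cst K.+1 1)
    (trig_sin_coord A (ltnSn K))).
  by congr trig_poly; apply/funext => v; rewrite /s mulrC.
exists (fun v => \sum_(j < N.+1) bernstein N j (s v) * t_ j v).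
  apply: trig_sum => j; apply: trig_mul; last exact: trig_widen.
  apply: trig_scale; apply: trig_mul; apply: trig_exp => //.
  have := trig_add (trig_cst K.+1 1) (trig_scale (-1) ts).
  by congr trig_poly; apply/funext => v; rewrite mulN1r.
move=> v.
have s01 : 0 <= s v <= 1.
  by have := sin_geN1 (v K / A); have := sin_le1 (v K / A); rewrite /s; lra.
have -> : g v = \sum_(j < N.+1) bernstein N j (s v) * g v.
  by rewrite -mulr_suml bernstein_sum mul1r.
rewrite -sumrB (le_trans (ler_norm_sum _ _ _))//.
apply: (@le_trans _ _ (\sum_(j < N.+1) (L * (bernstein N j (s v) * `|v K - y j|) +
   bernstein N j (s v) * (L * \sum_(i < K) ((v i ^+ 2 + 2) / A))))).
  apply: ler_sum => j _.
  rewrite -mulrBr normrM ger0_norm ?bernstein_ge0//.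
  rewrite [in X in _ <= X + _]mulrCA -mulrDr ler_wpM2l ?bernstein_ge0//.
  have -> : g v - t_ j v = (g v - g (upd v j)) + (g (upd v j) - t_ j v) by ring.
  rewrite (le_trans (ler_normD _ _))// lerD// (le_trans (gL _ _))//.
  rewrite big_ord_recr/= big1 ?add0r /upd ?eqxx// => i _.
  by rewrite ltn_eqF// subrr normr0.
rewrite big_split/= -mulr_sumr -mulr_suml bernstein_sum mul1r.
rewrite [in leRHS]big_ord_recr/= mulrDr addrC lerD2l ler_wpM2l//.
exact: bernstein_nodes.
Qed.

(** * Expectations and Gaussian moments *)

Section mean.
Context {d} {T : measurableType d} {R : realType}.
Variable P : probability T R.
Implicit Types (f g : T -> R) (c M : R).

Definition rintegrable f := P.-integrable [set: T] (EFin \o f).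

Definition mean f : R := \int[P]_w f w.

Lemma rintegrable_measurable f : rintegrable f -> measurable_fun setT f.
Proof. by move=> /integrableP[/measurable_EFinP]. Qed.

Lemma rintegrable_le f g : measurable_fun setT f ->
  (forall w, `|f w| <= g w) -> rintegrable g -> rintegrable f.
Proof.
move=> mf fg ig; apply: (le_integrable _ _ _ ig) => //.
  exact/measurable_EFinP.
by move=> w _; rewrite /= lee_fin (le_trans (fg w))// ler_norm.
Qed.

Lemma rintegrable_cst c : rintegrable (fun=> c).
Proof. exact: finite_measure_integrable_cst. Qed.

Lemma rintegrable_bounded M f : measurable_fun setT f ->
  (forall w, `|f w| <= M) -> rintegrable f.
Proof. by move=> mf fM; exact: (rintegrable_le mf fM (rintegrable_cst M)). Qed.

Lemma rintegrableD f g : rintegrable f -> rintegrable g ->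
  rintegrable (fun w => f w + g w).
Proof. by move=> fi gi; have := integrableD measurableT fi gi. Qed.

Lemma rintegrableB f g : rintegrable f -> rintegrable g ->
  rintegrable (fun w => f w - g w).
Proof. by move=> fi gi; have := integrableB measurableT fi gi. Qed.

Lemma rintegrableZ c f : rintegrable f -> rintegrable (fun w => c * f w).
Proof. by move=> fi; have := integrableZl measurableT c fi. Qed.

Lemma rintegrable_norm f : rintegrable f -> rintegrable (fun w => `|f w|).
Proof. exact: integrable_norm. Qed.

Lemma rintegrable_sum I (s : seq I) (f : I -> T -> R) :
  (forall i, rintegrable (f i)) -> rintegrable (fun w => \sum_(i <- s) f i w).
Proof.
move=> fi; elim: s => [|i s ih].
  by under [X in rintegrable X]eq_fun do rewrite big_nil; exact: rintegrable_cst.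
under [X in rintegrable X]eq_fun do rewrite big_cons.
exact: rintegrableD.
Qed.

Lemma meanD f g : rintegrable f -> rintegrable g ->
  mean (fun w => f w + g w) = mean f + mean g.
Proof. by move=> fi gi; exact: RintegralD. Qed.

Lemma meanB f g : rintegrable f -> rintegrable g ->
  mean (fun w => f w - g w) = mean f - mean g.
Proof. by move=> fi gi; exact: RintegralB. Qed.

Lemma meanZ c f : rintegrable f -> mean (fun w => c * f w) = c * mean f.
Proof. by move=> fi; exact: RintegralZl. Qed.

Lemma mean_cst c : mean (fun=> c) = c.
Proof.
by rewrite /mean Rintegral_cst// [X in fine X](@probability_setT _ _ _ P) mulr1.
Qed.

Lemma eq_mean f g : f =1 g -> mean f = mean g.
Proof. by move=> fg; congr mean; apply/funext. Qed.

Lemma ler_mean f g : rintegrable f -> rintegrable g ->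
  (forall w, f w <= g w) -> mean f <= mean g.
Proof. by move=> fi gi fg; exact: le_Rintegral. Qed.

Lemma mean_ge0 f : (forall w, 0 <= f w) -> 0 <= mean f.
Proof. by move=> f0; exact: Rintegral_ge0. Qed.

Lemma norm_mean_le f g : measurable_fun setT f -> rintegrable g ->
  (forall w, `|f w| <= g w) -> `|mean f| <= mean g.
Proof.
move=> mf ig fg; have fi := rintegrable_le mf fg ig.
apply: (le_trans (le_normr_Rintegral _ fi)) => //.
by apply: ler_mean => //; exact: rintegrable_norm.
Qed.

Lemma norm_mean_bounded M f : measurable_fun setT f ->
  (forall w, `|f w| <= M) -> `|mean f| <= M.
Proof.
by move=> mf fM; rewrite -[leRHS]mean_cst norm_mean_le//; exact: rintegrable_cst.
Qed.

Lemma EFin_mean f : rintegrable f -> (\int[P]_w (f w)%:E = (mean f)%:E)%E.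
Proof.
by move=> fi; rewrite /mean /Rintegral fineK//; exact: integrable_fin_num.
Qed.

Lemma ge0_rintegrable f c : measurable_fun setT f -> (forall w, 0 <= f w) ->
  (\int[P]_w (f w)%:E = c%:E)%E -> rintegrable f /\ mean f = c.
Proof.
move=> mf f0 fc; split; last by rewrite /mean /Rintegral fc.
apply/integrableP; split; first exact/measurable_EFinP.
by under eq_integral do rewrite /= ger0_norm//; rewrite fc ltry.
Qed.

Lemma rintegrable_indic A : measurable A -> rintegrable \1_A.
Proof. exact: integrable_indic. Qed.

Lemma mean_indic A : measurable A -> (mean \1_A)%:E = P A.
Proof.
move=> mA; rewrite -EFin_mean; last exact: rintegrable_indic.
by rewrite integral_indic// setIT.
Qed.

Lemma markov_mean f c : 0 < c -> rintegrable f -> (forall w, 0 <= f w) ->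
  (P [set w | (c <= f w)%R] <= (mean f / c)%:E)%E.
Proof.
move=> c0 fi f0.
have mA : measurable [set w | c <= f w].
  rewrite -[X in measurable X]setTI.
  rewrite (_ : [set w | _] = f @^-1` `[c, +oo[%classic); last first.
    by apply/seteqP; split=> w /=; rewrite in_itv/= andbT.
  exact: (rintegrable_measurable fi).
rewrite -mean_indic// lee_fin ler_pdivlMr// mulrC -meanZ; last first.
  exact: rintegrable_indic.
apply: ler_mean => //; first exact/rintegrableZ/rintegrable_indic.
move=> w; rewrite indicE; case: (boolP (_ \in _)) => [|_].
  by rewrite inE/= mulr1.
by rewrite mulr0.
Qed.

Lemma mean_dominated M (f_ : nat -> T -> R) f :
  (forall n, measurable_fun setT (f_ n)) ->
  (forall n w, `|f_ n w| <= M) -> (forall w, f_ ^~ w @ \oo --> f w) ->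
  measurable_fun setT f /\ mean (f_ n) @[n --> \oo] --> mean f.
Proof.
move=> mf_ fM f_f.
have mf : measurable_fun setT f by apply: measurable_fun_cvg => // w _; exact: f_f.
split=> //.
have fM' w : `|f w| <= M.
  have h : `|f_ n w| @[n --> \oo] --> `|f w| by exact: cvg_norm (f_f w).
  rewrite -(cvg_lim _ h)//; apply: limr_le; first exact: cvgP h.
  by near=> n; exact: fM.
have fP n : rintegrable (f_ n) by exact: rintegrable_bounded (fM n).
have [|||||_ _ h] := @dominated_convergence _ _ _ P setT measurableT
    (fun n => EFin \o f_ n) (EFin \o f) (EFin \o (fun=> M)).
- by move=> n; exact/measurable_EFinP.
- exact/measurable_EFinP.
- by apply: aeW => w _; apply/fine_cvgP; split => /=; [exact: nearW|exact: f_f].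
- exact: rintegrable_cst.
- by apply: aeW => w n _ /=; rewrite lee_fin.
apply: fine_cvg; rewrite fineK; first exact: h.
by apply: integrable_fin_num => //; exact: rintegrable_bounded fM'.
Unshelve. all: by end_near. Qed.

End mean.

Lemma mean_sum_le {d} {T : measurableType d} {R : realType} (P : probability T R)
    (N : nat) (f : nat -> T -> R) (C : nat -> R) :
  (forall i, rintegrable P (f i)) -> (forall i, mean P (f i) <= C i) ->
  mean P (fun w => \sum_(i < N) f i w) <= \sum_(i < N) C i.
Proof.
move=> fi fC; elim: N => [|N ih].
  rewrite big_ord0 (@eq_mean _ _ _ _ _ (fun=> 0)) ?mean_cst// => w.
  by rewrite big_ord0.
rewrite (@eq_mean _ _ _ _ _ (fun w => \sum_(i < N) f i w + f N w)); last first.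
  by move=> w; rewrite big_ord_recr.
rewrite meanD//; last exact: rintegrable_sum.
by rewrite big_ord_recr/= lerD.
Qed.

Lemma ge0_integral_law d d' (T : measurableType d) (T' : measurableType d')
    (R : realType) (P : probability T R) (V : T -> T')
    (nu : {measure set T' -> \bar R}) (h : T' -> \bar R) :
  measurable_fun setT V ->
  (forall A, measurable A -> P (V @^-1` A) = nu A) ->
  measurable_fun setT h -> (forall x, 0 <= h x)%E ->
  (\int[P]_w h (V w) = \int[nu]_x h x)%E.
Proof.
move=> mV lawV mh h0.
pose X : {RV P >-> T'} := mfun_Sub (mem_set mV).
rewrite -(@ge0_integral_distribution _ _ _ _ _ P X h)//.
by apply: eq_measure_integral => A mA _; rewrite -lawV.
Qed.

(** Dividing by [t] and letting it tend to 0 from both sides; this turns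
    exponential bounds on moments into identities. *)
Lemma linear_le_square (R : realType) (x e K : R) : 0 < e ->
  (forall t, `|t| <= e -> t * x <= K * t ^+ 2) -> x = 0.
Proof.
move=> e0 h; apply/eqP; rewrite -normr_le0; apply/ler_addgt0Pr => r r0.
rewrite add0r.
pose t := Num.min e (r / (`|K| + 1)).
have K1 : 0 < `|K| + 1 by rewrite ltr_wpDl.
have t0 : 0 < t by rewrite lt_min e0 divr_gt0.
have te : `|t| <= e by rewrite gtr0_norm// ge_min lexx.
have tK : K * t <= r.
  rewrite (@le_trans _ _ ((`|K| + 1) * t))//.
    by rewrite ler_pM2r// (le_trans (ler_norm K))// lerDl.
  by rewrite mulrC -ler_pdivlMr// ge_min lexx orbT.
have h1 := h _ te; have := h (- t); rewrite normrN sqrrN => /(_ te) h2.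
have h3 : K * t ^+ 2 <= t * r by rewrite expr2 mulrA mulrC ler_pM2l.
rewrite ler_norml -(@ler_pM2l _ t)// -[X in _ && X](@ler_pM2l _ t)//.
by apply/andP; split; lra.
Qed.

Section gaussian_moments.
Context {R : realType}.
Local Notation mu := (@lebesgue_measure R).
Implicit Types (m s t x : R).

(** A normal law is integrated through its density; this holds because the
    density is a version of the Radon-Nikodym derivative. *)
Lemma ge0_integral_normal_prob m s (h : R -> \bar R) :
  measurable_fun setT h -> (forall x, 0 <= h x)%E ->
  (\int[normal_prob m s]_x h x = \int[mu]_x (h x * (normal_pdf m s x)%:E))%E.
Proof.
move=> mh h0.
have dom := @normal_prob_dominates R m s.
rewrite -(Radon_Nikodym_SigmaFinite.change_of_variables dom)//.
have fi := Radon_Nikodym_SigmaFinite.f_integrable dom.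
have mpdf : measurable_fun setT (EFin \o normal_pdf m s).
  by apply/measurable_EFinP; exact: measurable_normal_pdf.
apply: ae_eq_integral => //.
- by apply: emeasurable_funM => //; exact: (measurable_int mu).
- exact: emeasurable_funM.
- apply: ae_eqe_mul2l; apply: integral_ae_eq => // E _ mE.
  by rewrite -Radon_Nikodym_SigmaFinite.f_integral.
Qed.

(** Completing the square: an exponential of a quadratic turns a centred normal
    density into a multiple of another normal density, so its expectation is the
    multiplicative constant. *)
Lemma normal_pdf_exp_linear s t x : 0 < s ->
  expR (t * x) * normal_pdf 0 s x =
  expR (t ^+ 2 * s ^+ 2 / 2) * normal_pdf (t * s ^+ 2) s x.
Proof.
move=> s0; have s1 : s != 0 by rewrite gt_eqF.
rewrite !normal_pdfE// /normal_fun !(mulrCA (expR _)) -!expRD.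
by congr (_ * expR _); rewrite -mulr_natr; field; rewrite s1.
Qed.

Lemma normal_pdf_exp_square s t x : 0 < s -> t < 1 ->
  expR (t / (s ^+ 2 *+ 2) * x ^+ 2) * normal_pdf 0 s x =
  (Num.sqrt (1 - t))^-1 * normal_pdf 0 (s / Num.sqrt (1 - t)) x.
Proof.
move=> s0 t1; have s1 : s != 0 by rewrite gt_eqF.
have q0 : 0 < 1 - t by rewrite subr_gt0.
have r0 : 0 < Num.sqrt (1 - t) by rewrite sqrtr_gt0.
have r1 : Num.sqrt (1 - t) != 0 by rewrite gt_eqF.
rewrite !normal_pdfE// ?mulf_neq0 ?invr_eq0// /normal_fun.
rewrite mulrCA -expRD mulrA; congr (_ * expR _).
  rewrite /normal_peak exprMn exprVn sqr_sqrtr ?(ltW q0)//.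
  have -> : s ^+ 2 / (1 - t) * pi *+ 2 = (1 - t)^-1 * (s ^+ 2 * pi *+ 2).
    by rewrite -!mulrnAr; ring.
  by rewrite sqrtrM ?invr_ge0 ?(ltW q0)// sqrtrV ?(ltW q0)// invfM invrK mulKf.
rewrite subr0 exprMn exprVn sqr_sqrtr ?(ltW q0)//.
rewrite -(mulr_natr (s ^+ 2)) -(mulr_natr (_ / _)).
by field; rewrite s1 gt_eqF.
Qed.

Section moments.
Context {d} {T : measurableType d}.
Variables (P : probability T R) (V : T -> R) (s : R).
Hypothesis mV : measurable_fun setT V.
Hypothesis s0 : 0 < s.
Hypothesis lawV : forall A, measurable A ->
  P [set w | A (V w)] = normal_prob 0 s A.

Let mean_normal (h : R -> R) c (m' s' : R) : measurable_fun setT h ->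
  (forall x, 0 <= h x) -> 0 <= c ->
  (forall x, h x * normal_pdf 0 s x = c * normal_pdf m' s' x) ->
  rintegrable P (h \o V) /\ mean P (h \o V) = c.
Proof.
move=> mh h0 c0 hc; apply: ge0_rintegrable => //.
- exact: measurableT_comp.
- by move=> w /=.
rewrite (@ge0_integral_law _ _ _ (measurableTypeR R) R P V (normal_prob 0 s)
  (EFin \o h))//; last exact/measurable_EFinP.
rewrite ge0_integral_normal_prob//=; last exact/measurable_EFinP.
under eq_integral do rewrite -EFinM hc EFinM.
rewrite ge0_integralZl_EFin//.
- by rewrite integral_normal_pdf mule1.
- by move=> x _; rewrite lee_fin normal_pdf_ge0.
- by apply/measurable_EFinP; exact: measurable_normal_pdf.
Qed.

Let mean_exp_linear t : rintegrable P (fun w => expR (t * V w)) /\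
  mean P (fun w => expR (t * V w)) = expR (t ^+ 2 * s ^+ 2 / 2).
Proof.
apply: (@mean_normal (fun x => expR (t * x)) _ (t * s ^+ 2) s).
- by apply: measurableT_comp => //; exact: measurable_funM.
- by move=> x; exact: expR_ge0.
- exact: expR_ge0.
- by move=> x; exact: normal_pdf_exp_linear.
Qed.

Let mean_exp_square t : t < 1 ->
  rintegrable P (fun w => expR (t / (s ^+ 2 *+ 2) * V w ^+ 2)) /\
  mean P (fun w => expR (t / (s ^+ 2 *+ 2) * V w ^+ 2)) = (Num.sqrt (1 - t))^-1.
Proof.
move=> t1.
apply: (@mean_normal (fun x => expR (t / (s ^+ 2 *+ 2) * x ^+ 2)) _
  0 (s / Num.sqrt (1 - t))).
- by apply: measurableT_comp => //; apply: measurable_funM => //;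
    exact: exprn_measurable.
- by move=> x; exact: expR_ge0.
- by rewrite invr_ge0 sqrtr_ge0.
- by move=> x; exact: normal_pdf_exp_square.
Qed.

(** [exp u >= 1 + u^2/4] for [u >= 0]; with [u = 3 V^2 / (8 s^2)] the
    exponential has mean 2. *)
Lemma normal_moment4 : rintegrable P (fun w => V w ^+ 4) /\
  mean P (fun w => V w ^+ 4) <= 64 * s ^+ 4.
Proof.
have [|i2 m2] := @mean_exp_square (3 / 4); first by lra.
have sq2 : (Num.sqrt (1 - 3 / 4 : R))^-1 = 2.
  have -> : 1 - 3 / 4 = (2^-1 : R) ^+ 2 by field.
  by rewrite sqrtr_sqr ger0_norm ?invr_ge0// invrK.
rewrite sq2 in m2.
have bnd w : `|V w ^+ 4| <=
    32 * s ^+ 4 * expR (3 / 4 / (s ^+ 2 *+ 2) * V w ^+ 2).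
  rewrite ger0_norm ?exprn_even_ge0//.
  set u := 3 / 4 / (s ^+ 2 *+ 2) * V w ^+ 2.
  have u0 : 0 <= u.
    by rewrite mulr_ge0 ?sqr_ge0// divr_ge0 ?mulrn_wge0 ?sqr_ge0//; lra.
  have hu : u ^+ 2 / 2 <= expR u.
    have := @expR_ge1Dxn _ u 1 u0; rewrite -[2`!]/2%N; lra.
  have -> : V w ^+ 4 = 64 / 9 * s ^+ 4 * u ^+ 2.
    by rewrite /u -mulr_natr; field; rewrite gt_eqF.
  have s40 : 0 <= s ^+ 4 by rewrite exprn_ge0// ltW.
  have h1 : s ^+ 4 * (u ^+ 2 / 2) <= s ^+ 4 * expR u by rewrite ler_wpM2l.
  have h2 : 0 <= s ^+ 4 * expR u by rewrite mulr_ge0// expR_ge0.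
  lra.
have i2' := rintegrableZ (32 * s ^+ 4) i2.
have i4 : rintegrable P (fun w => V w ^+ 4).
  apply: (rintegrable_le _ bnd i2').
  exact: (measurableT_comp (exprn_measurable 4) mV).
split=> //.
have := ler_mean i4 i2' (fun w => le_trans (ler_norm _) (bnd w)).
by rewrite meanZ// m2; lra.
Qed.

Lemma normal_mean : rintegrable P V /\ mean P V = 0.
Proof.
have [i4 _] := normal_moment4.
have i1 : rintegrable P V.
  apply: (rintegrable_le mV _ (rintegrableD (rintegrable_cst P 1) i4)) => w.
  have := sqr_ge0 (V w ^+ 2 - 1); have := sqr_ge0 (`|V w| - 1).
  rewrite !sqrrB !expr1n -!exprM real_normK ?num_real//=.
  by have := sqr_ge0 (V w ^+ 2); rewrite -exprM/=; lra.
split=> //.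
(* 1 + t V <= exp (t V) for every small t, of either sign *)
have bnd t : t ^+ 2 * s ^+ 2 <= 1 -> t * mean P V <= t ^+ 2 * s ^+ 2.
  move=> ts.
  have [ie me] := mean_exp_linear t.
  have := ler_mean (rintegrableD (rintegrable_cst P 1) (rintegrableZ t i1)) ie
    (fun w => expR_ge1Dx _).
  rewrite meanD ?mean_cst ?meanZ ?me//; last 2 first.
  - exact: rintegrable_cst.
  - exact: rintegrableZ.
  set a := t ^+ 2 * s ^+ 2.
  have a0 : 0 <= a by rewrite mulr_ge0 ?sqr_ge0.
  (* exp (a/2) <= 1 + a on [0, 1], since exp (-a/2) >= 1 - a/2 *)
  have h : expR (a / 2) * (1 - a / 2) <= 1.
    rewrite -[leRHS](expRxMexpNx_1 (a / 2)) ler_wpM2l ?expR_ge0//.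
    by have := expR_ge1Dx (- (a / 2)); lra.
  have h0 := expR_ge0 (a / 2).
  rewrite -/a in ts *; nra.
apply: (@linear_le_square _ _ s^-1 (s ^+ 2)); rewrite ?invr_gt0// => t ts.
rewrite [leRHS]mulrC bnd// -exprMn -real_normK ?num_real// exprn_ile1//.
by rewrite normrM (gtr0_norm s0) -ler_pdivlMr// div1r.
Qed.

(** [t u <= exp (t u) - 1] is applied with both signs of [t]; the bounds on
    [E exp (t V^2 / (2 s^2)) - 1 = (1 - t)^(-1/2) - 1] are [t/2 + O(t^2)]. *)
Lemma normal_moment2 : rintegrable P (fun w => V w ^+ 2) /\
  mean P (fun w => V w ^+ 2) = s ^+ 2.
Proof.
have [i4 _] := normal_moment4.
have i2 : rintegrable P (fun w => V w ^+ 2).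
  apply: (rintegrable_le _ _ (rintegrableD (rintegrable_cst P 1) i4)).
    exact: (measurableT_comp (exprn_measurable 2) mV).
  move=> w; rewrite ger0_norm ?sqr_ge0//.
  have := sqr_ge0 (V w ^+ 2 - 1).
  rewrite sqrrB expr1n -exprM/=.
  by have := sqr_ge0 (V w); lra.
split=> //.
set v := mean P _.
have s20 : 0 < s ^+ 2 by rewrite exprn_gt0.
pose q := v / s ^+ 2.
have bnd t : t <= 1 / 4 -> - (1 / 4) <= t -> t * q <= t + 4 * t ^+ 2.
  move=> t1 t2.
  have [|ie me] := @mean_exp_square t; first lra.
  have := ler_mean (rintegrableD (rintegrable_cst P 1)
    (rintegrableZ (t / (s ^+ 2 *+ 2)) i2)) ie (fun w => expR_ge1Dx _).
  rewrite meanD ?mean_cst ?meanZ ?me//; last 2 first.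
  - exact: rintegrable_cst.
  - exact: rintegrableZ.
  have -> : t / (s ^+ 2 *+ 2) * mean P (fun w => V w ^+ 2) = t * q / 2.
    by rewrite /q /v -mulr_natr; field; rewrite gt_eqF.
  set r := Num.sqrt (1 - t).
  have r0 : 0 < r by rewrite sqrtr_gt0; lra.
  have r2 : r ^+ 2 = 1 - t by rewrite sqr_sqrtr//; lra.
  have hr : r^-1 <= 1 + t / 2 + 2 * t ^+ 2.
    rewrite -(@ler_pM2l _ r)// mulfV ?gt_eqF//.
    set p := 1 + t / 2 + 2 * t ^+ 2.
    have p0 : 0 <= p by rewrite /p; nra.
    rewrite -(@ler_pXn2r _ 2) ?nnegrE ?mulr_ge0 ?(ltW r0)// expr1n exprMn r2.
    rewrite /p; nra.
  lra.
suff : q - 1 = 0 by move/subr0_eq => q1; rewrite -[LHS](divfK (lt0r_neq0 s20)) -/q q1 mul1r.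
apply: (@linear_le_square _ _ (1 / 4) 4) => [|t]; first by lra.
by rewrite ler_norml => /andP[t1 t2]; have := bnd t t2 t1; lra.
Qed.

End moments.
End gaussian_moments.

(** * Weighted sums and fourth moments of martingale differences *)

Section weighted_sums.
Context {d} {T : measurableType d} {R : realType}.
Variable P : probability T R.
Implicit Types (b : nat -> R) (M : nat -> T -> R).

Definition wsum b M n w : R := \sum_(k < n) b k * M k w.

Lemma wsumS b M n w : wsum b M n.+1 w = wsum b M n w + b n * M n w.
Proof. by rewrite /wsum big_ord_recr. Qed.

Lemma wsum0 b M w : wsum b M 0 w = 0.
Proof. by rewrite /wsum big_ord0. Qed.

Lemma measurable_wsum b M n : (forall k, measurable_fun setT (M k)) ->
  measurable_fun setT (wsum b M n).
Proof.
move=> mM; apply: measurable_sum => k.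
by apply: measurable_funM => //; exact: measurable_cst.
Qed.

Lemma measurable_cos (f : T -> R) :
  measurable_fun setT f -> measurable_fun setT (fun w => cos (f w)).
Proof.
move=> mf; apply: (measurableT_comp _ mf).
exact: (continuous_measurable_fun (@continuous_cos R)).
Qed.

Lemma measurable_cos_wsum b M n ph : (forall k, measurable_fun setT (M k)) ->
  measurable_fun setT (fun w => cos (wsum b M n w + ph)).
Proof.
move=> mM; apply: measurable_cos; apply: measurable_funD => //.
exact: measurable_wsum.
Qed.

Lemma rintegrable_cosM (f g : T -> R) : measurable_fun setT f ->
  rintegrable P g -> rintegrable P (fun w => cos (f w) * g w).
Proof.
move=> mf ig; apply: (rintegrable_le _ _ (rintegrable_norm ig)).
  apply: measurable_funM; first exact: measurable_cos.
  exact: rintegrable_measurable ig.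
by move=> w; rewrite normrM ler_piMl// cos_max.
Qed.

Lemma rintegrable_pow (f : T -> R) n : (n <= 4)%N -> measurable_fun setT f ->
  rintegrable P (fun w => f w ^+ 4) -> rintegrable P (fun w => `|f w| ^+ n).
Proof.
move=> n4 mf i4; apply: (rintegrable_le _ _ (rintegrableD (rintegrable_cst P 1) i4)).
  exact: (measurableT_comp (exprn_measurable n) (measurableT_comp (@normr_measurable _ setT) mf)).
move=> w; rewrite normrX normr_id.
have -> : f w ^+ 4 = `|f w| ^+ 4 by rewrite -normrX ger0_norm// exprn_even_ge0.
have [f1|f1] := leP `|f w| 1.
  by rewrite (le_trans (exprn_ile1 n (normr_ge0 _) f1))// lerDl exprn_ge0.
by rewrite (le_trans (ler_weXn2l (ltW f1) n4))// lerDr.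
Qed.

Section lindeberg.
Variables (M : nat -> T -> R) (b : nat -> R) (beta s2 C D : R).
Hypothesis mM : forall k, measurable_fun setT (M k).
Hypothesis iM4 : forall k, rintegrable P (fun w => M k w ^+ 4).
Hypothesis M4 : forall k, mean P (fun w => M k w ^+ 4) <= C.
Hypothesis s20 : 0 <= s2.
Hypothesis beta1 : beta <= 1.
Hypothesis bbeta : forall k, `|b k| <= beta.
Hypothesis centered : forall k ph,
  mean P (fun w => cos (wsum b M k w + ph) * M k w) = 0.
Hypothesis square : forall k ph,
  `|mean P (fun w => cos (wsum b M k w + ph) * (M k w ^+ 2 - s2))| <= D * beta.

Let cosm k ph := mean P (fun w => cos (wsum b M k w + ph)).

(** Second order expansion of the cosine: the linear term vanishes by
    [centered], and replacing [M_k^2] by [s2] costs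
    [D beta^3 / 2]. *)
Let lindeberg_step k ph :
  `|cosm k.+1 ph - (1 - s2 * b k ^+ 2 / 2) * cosm k ph| <=
  (D / 2 + 1 + C) * beta ^+ 3.
Proof.
have beta0 : 0 <= beta by rewrite (le_trans _ (bbeta 0))// normr_ge0.
pose f := fun w => wsum b M k w + ph.
have mf : measurable_fun setT f.
  by apply: measurable_funD => //; exact: measurable_wsum.
pose c := fun w => cos (f w).
(* the sine is a cosine with another phase, so [centered] applies to it *)
pose s := fun w => cos (wsum b M k w + (ph - pi / 2)).
have iM1 : rintegrable P (M k).
  apply: (rintegrable_le (mM k) _ (@rintegrable_pow _ 1 _ (mM k) (iM4 k))) => //.
have iM2 : rintegrable P (fun w => M k w ^+ 2).
  have := @rintegrable_pow _ 2 _ (mM k) (iM4 k).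
  by under eq_fun do rewrite real_normK ?num_real//; exact.
have ic : rintegrable P c.
  by apply: (@rintegrable_bounded _ _ _ _ 1) => [|w]; [exact: measurable_cos|
     exact: cos_max].
have icM : rintegrable P (fun w => c w * (M k w ^+ 2 - s2)).
  apply: rintegrable_cosM => //; apply: rintegrableB => //.
  exact: rintegrable_cst.
have isM : rintegrable P (fun w => s w * M k w).
  apply: rintegrable_cosM => //.
  by apply: measurable_funD => //; exact: measurable_wsum.
pose r := fun w => cos (wsum b M k.+1 w + ph) -
  ((1 - s2 * b k ^+ 2 / 2) * c w - b k ^+ 2 / 2 * (c w * (M k w ^+ 2 - s2)) -
   b k * (s w * M k w)).
have rbnd w : `|r w| <= beta ^+ 3 * (1 + M k w ^+ 4).
  rewrite /r wsumS addrAC.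
  have -> : (1 - s2 * b k ^+ 2 / 2) * c w -
      b k ^+ 2 / 2 * (c w * (M k w ^+ 2 - s2)) - b k * (s w * M k w) =
      cos (f w) * (1 - (b k * M k w) ^+ 2 / 2) - sin (f w) * (b k * M k w).
    by rewrite /s addrA cosBpihalf -/(f w) /c; ring.
  rewrite (le_trans (cosD_taylor2 _ _ (le_trans (bbeta k) beta1)))//.
  rewrite ler_wpM2r ?addr_ge0 ?exprn_even_ge0//.
  by rewrite lerXn2r ?nnegrE.
have i1 := rintegrableZ (1 - s2 * b k ^+ 2 / 2) ic.
have i2 := rintegrableZ (b k ^+ 2 / 2) icM.
have i3 := rintegrableZ (b k) isM.
have i12 := rintegrableB i1 i2.
have i123 := rintegrableB i12 i3.
have ick : rintegrable P (fun w => cos (wsum b M k.+1 w + ph)).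
  apply: (@rintegrable_bounded _ _ _ _ 1) => [|w]; last exact: cos_max.
  exact: measurable_cos_wsum.
have ir : rintegrable P r by exact: rintegrableB ick i123.
have Er : `|mean P r| <= beta ^+ 3 * (1 + C).
  have i14 := rintegrableD (rintegrable_cst P 1) (iM4 k).
  have := norm_mean_le (rintegrable_measurable ir)
    (rintegrableZ (beta ^+ 3) i14) rbnd.
  move/le_trans; apply; rewrite meanZ// meanD// ?mean_cst; last exact: rintegrable_cst.
  by rewrite ler_wpM2l ?exprn_ge0// lerD2l.
have := meanB ick i123; rewrite -/(r) => Er'.
have E1 : mean P (fun w => (1 - s2 * b k ^+ 2 / 2) * c w -
    b k ^+ 2 / 2 * (c w * (M k w ^+ 2 - s2)) - b k * (s w * M k w)) =
   (1 - s2 * b k ^+ 2 / 2) * cosm k ph -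
   b k ^+ 2 / 2 * mean P (fun w => c w * (M k w ^+ 2 - s2)).
  by rewrite meanB// meanB// !meanZ// centered mulr0 subr0.
have Er2 : mean P r = cosm k.+1 ph - ((1 - s2 * b k ^+ 2 / 2) * cosm k ph -
   b k ^+ 2 / 2 * mean P (fun w => c w * (M k w ^+ 2 - s2))).
  by rewrite -E1 -Er'.
set e := mean P (fun w => c w * _) in Er2.
have -> : cosm k.+1 ph - (1 - s2 * b k ^+ 2 / 2) * cosm k ph =
    mean P r - b k ^+ 2 / 2 * e by rewrite Er2; ring.
rewrite (le_trans (ler_normB _ _))//.
have he : `|b k ^+ 2 / 2 * e| <= beta ^+ 2 / 2 * (D * beta).
  rewrite normrM ler_pM ?square// ger0_norm ?divr_ge0 ?sqr_ge0//.
  rewrite ler_pM2r ?invr_gt0// -(real_normK (num_real (b k))).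
  by rewrite lerXn2r ?nnegrE.
rewrite (le_trans (lerD Er he))// le_eqVlt; apply/orP; left; apply/eqP.
by field.
Qed.

(** Lindeberg's telescoping for the test functions [cos]: passing from [k] to
    [k+1] summands multiplies the expectation by [1 - s2 b_k^2 / 2] up to an
    error of order [beta^3], and so does the multiplication by
    [exp (- s2 b_k^2 / 2)]. *)
Lemma lindeberg_cos n ph :
  `|mean P (fun w => cos (wsum b M n w + ph)) -
    expR (- (s2 / 2 * \sum_(k < n) b k ^+ 2)) * cos ph| <=
  n%:R * ((D / 2 + 1 + C + s2 ^+ 2) * beta ^+ 3).
Proof.
have beta0 : 0 <= beta by rewrite (le_trans _ (bbeta 0))// normr_ge0.
rewrite -/(cosm n ph); elim: n => [|n ih].
  rewrite big_ord0 mulr0 oppr0 expR0 mul1r mul0r normr_le0 subr_eq0.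
  by rewrite /cosm -[X in _ == X](mean_cst P) (@eq_mean _ _ _ _ _ (fun=> cos ph))//
     => w; rewrite wsum0 add0r.
set q := \sum_(k < n) _ in ih; rewrite big_ord_recr/= -/q.
set v := s2 * b n ^+ 2 / 2.
have v0 : 0 <= v by rewrite divr_ge0// mulr_ge0// sqr_ge0.
have -> : expR (- (s2 / 2 * (q + b n ^+ 2))) = expR (- v) * expR (- (s2 / 2 * q)).
  by rewrite -expRD; congr expR; rewrite /v; field.
have h1 := lindeberg_step n ph; rewrite -/v in h1.
have hv : `|1 - v - expR (- v)| <= s2 ^+ 2 * beta ^+ 3.
  have e1 : 1 - v <= expR (- v) by have := expR_ge1Dx (- v).
  have e2 : expR (- v) * (1 + v) <= 1.
    rewrite -[leRHS](expRxMexpNx_1 (- v)) opprK ler_wpM2l ?expR_ge0//.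
    exact: expR_ge1Dx.
  have e0 := expR_ge0 (- v).
  have h : `|1 - v - expR (- v)| <= v ^+ 2.
    rewrite distrC ger0_norm ?subr_ge0//.
    nra.
  rewrite (le_trans h)// /v.
  have -> : (s2 * b n ^+ 2 / 2) ^+ 2 = s2 ^+ 2 * (`|b n| ^+ 4 / 4).
    have -> : `|b n| ^+ 4 = b n ^+ 4 by rewrite -normrX ger0_norm// exprn_even_ge0.
    by field.
  rewrite ler_wpM2l ?sqr_ge0//.
  have b4 : `|b n| ^+ 4 <= beta ^+ 3.
    rewrite (@le_trans _ _ (beta ^+ 4)) ?lerXn2r ?nnegrE//.
    by rewrite ler_wiXn2l.
  have : 0 <= `|b n| ^+ 4 by rewrite exprn_ge0.
  lra.
have ha : `|cosm n ph| <= 1.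
  apply: norm_mean_bounded => [|w]; last exact: cos_max.
  exact: measurable_cos_wsum.
set a := cosm n ph in h1 ih ha *.
set e := expR (- (s2 / 2 * q)) * cos ph in ih *.
have -> : cosm n.+1 ph - expR (- v) * expR (- (s2 / 2 * q)) * cos ph =
    (cosm n.+1 ph - (1 - v) * a) + (1 - v - expR (- v)) * a +
    expR (- v) * (a - e) by rewrite /e; ring.
rewrite (le_trans (ler_normD _ _))// (le_trans (lerD (ler_normD _ _) (lexx _)))//.
have h2 : `|(1 - v - expR (- v)) * a| <= s2 ^+ 2 * beta ^+ 3.
  by rewrite normrM -[leRHS]mulr1 ler_pM.
have h3 : `|expR (- v) * (a - e)| <= n%:R * ((D / 2 + 1 + C + s2 ^+ 2) * beta ^+ 3).
  rewrite normrM ger0_norm ?expR_ge0// (le_trans _ ih)// ler_piMl//.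
  by rewrite -expR0 ler_expR oppr_le0.
rewrite (le_trans (lerD (lerD h1 h2) h3))// -natr1 le_eqVlt.
by apply/orP; left; apply/eqP; ring.
Qed.

End lindeberg.

Section fourth_moment.
Variables (D : nat -> T -> R) (C : R).
Hypothesis mD : forall k, measurable_fun setT (D k).
Hypothesis iD4 : forall k, rintegrable P (fun w => D k w ^+ 4).
Hypothesis D4 : forall k, mean P (fun w => D k w ^+ 4) <= C.

Definition psum n w : R := \sum_(k < n) D k w.

Lemma psumS n w : psum n.+1 w = psum n w + D n w.
Proof. by rewrite /psum big_ord_recr. Qed.

Lemma measurable_psum n : measurable_fun setT (psum n).
Proof. exact: measurable_sum. Qed.

Lemma rintegrable_psum4 n : rintegrable P (fun w => psum n w ^+ 4).
Proof.
elim: n => [|n ih].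
  rewrite (_ : (fun w => _) = (fun=> 0 ^+ 4)); first exact: rintegrable_cst.
  by apply/funext => w; rewrite /psum big_ord0.
apply: (rintegrable_le _ _ (rintegrableZ 8 (rintegrableD ih (iD4 n)))).
  exact: (measurableT_comp (exprn_measurable 4) (measurable_psum _)).
move=> w; rewrite psumS ger0_norm ?exprn_even_ge0//.
set x := psum n w; set y := D n w.
have h1 : (x + y) ^+ 2 <= 2 * (x ^+ 2 + y ^+ 2).
  by have := sqr_ge0 (x - y); rewrite !expr2; lra.
have h2 : ((x + y) ^+ 2) ^+ 2 <= (2 * (x ^+ 2 + y ^+ 2)) ^+ 2.
  by rewrite lerXn2r ?nnegrE ?sqr_ge0// mulr_ge0// addr_ge0 ?sqr_ge0.
have h3 := sqr_ge0 (x ^+ 2 - y ^+ 2).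
have -> : (x + y) ^+ 4 = ((x + y) ^+ 2) ^+ 2 by rewrite -exprM.
apply: (le_trans h2).
have -> : (2 * (x ^+ 2 + y ^+ 2)) ^+ 2 =
  8 * (x ^+ 4 + y ^+ 4) - 4 * (x ^+ 2 - y ^+ 2) ^+ 2 by ring.
by rewrite lerBlDr lerDl mulr_ge0.
Qed.

Lemma rintegrable_cubeM (f g : T -> R) :
  measurable_fun setT f -> measurable_fun setT g ->
  rintegrable P (fun w => f w ^+ 4) -> rintegrable P (fun w => g w ^+ 4) ->
  rintegrable P (fun w => f w ^+ 3 * g w).
Proof.
move=> mf mg i4 j4; apply: (rintegrable_le _ _ (rintegrableD i4 j4)).
  by apply: measurable_funM => //; exact: (measurableT_comp (exprn_measurable 3) mf).
move=> w; rewrite normrM normrX.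
have e4 (x : R) : x ^+ 4 = `|x| ^+ 4.
  by rewrite -normrX ger0_norm// exprn_even_ge0.
rewrite (e4 (f w)) (e4 (g w)).
have := normr_ge0 (f w); have := normr_ge0 (g w).
set y := `|g w|; set x := `|f w| => y0 x0.
have [xy|xy] := leP x y.
  rewrite (@le_trans _ _ (y ^+ 3 * y))//.
    by rewrite ler_wpM2r// lerXn2r ?nnegrE.
  by rewrite -exprSr lerDr exprn_ge0.
rewrite (@le_trans _ _ (x ^+ 3 * x))//.
  by rewrite ler_wpM2l ?exprn_ge0// ltW.
by rewrite -exprSr lerDl exprn_ge0.
Qed.

(** Orthogonality of [D_n] to the cube of the partial sum [W_n] removes the
    term [4 W_n^3 D_n] of [(W_n + D_n)^4]; Young's inequality with a weight
    proportional to [n+1] on the term [6 W_n^2 D_n^2] then yields quadratic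
    growth. *)
Lemma psum_moment4 n :
  (forall k, mean P (fun w => psum k w ^+ 3 * D k w) = 0) ->
  mean P (fun w => psum n w ^+ 4) <= 19 * C * n%:R ^+ 2.
Proof.
move=> ortho; elim: n => [|n ih].
  rewrite expr0n/= mulr0 (@eq_mean _ _ _ _ _ (fun=> 0)) ?mean_cst// => w.
  by rewrite /psum big_ord0 expr0n.
have C0 : 0 <= C.
  by rewrite (le_trans _ (D4 0))// mean_ge0// => w; rewrite exprn_even_ge0.
pose p : R := n.+1%:R.
have p0 : 0 < p by rewrite ltr0n.
have i3 := rintegrable_cubeM (measurable_psum n) (mD n) (rintegrable_psum4 n) (iD4 n).
have i1 := rintegrableZ (1 + p^-1) (rintegrable_psum4 n).
have i2 := rintegrableZ (16 * p + 3) (iD4 n).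
have i4 := rintegrableZ 4 i3.
have bnd w : psum n.+1 w ^+ 4 <=
    (1 + p^-1) * psum n w ^+ 4 + 4 * (psum n w ^+ 3 * D n w) +
    (16 * p + 3) * D n w ^+ 4.
  rewrite psumS; set x := psum n w; set y := D n w.
  have h1 : 0 <= p^-1 * (x ^+ 2 - 4 * p * y ^+ 2) ^+ 2.
    by rewrite mulr_ge0 ?sqr_ge0// invr_ge0 ltW.
  have h2 := sqr_ge0 (x * y - y ^+ 2).
  rewrite -subr_ge0.
  have -> : (1 + p^-1) * x ^+ 4 + 4 * (x ^+ 3 * y) + (16 * p + 3) * y ^+ 4 -
     (x + y) ^+ 4 = p^-1 * (x ^+ 2 - 4 * p * y ^+ 2) ^+ 2 +
       2 * (x * y - y ^+ 2) ^+ 2.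
    by field; rewrite gt_eqF.
  by rewrite addr_ge0// mulr_ge0.
have i12 := rintegrableD (rintegrableD i1 i4) i2.
have := ler_mean (rintegrable_psum4 n.+1) i12 bnd.
rewrite meanD//; last exact: rintegrableD.
rewrite meanD// !meanZ// ?ortho ?mulr0 ?addr0//; last exact: rintegrable_psum4.
move/le_trans; apply.
have h1 : (1 + p^-1) * mean P (fun w => psum n w ^+ 4) <=
   (1 + p^-1) * (19 * C * n%:R ^+ 2).
  by rewrite ler_wpM2l// addr_ge0// invr_ge0 ltW.
have h2 : (16 * p + 3) * mean P (fun w => D n w ^+ 4) <= (16 * p + 3) * C.
  by rewrite ler_wpM2l// addr_ge0// mulr_ge0// ltW.
apply: (le_trans (lerD h1 h2)).
have pn : p = n%:R + 1 by rewrite /p natr1.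
have n0 : 0 <= n%:R :> R by [].
have h3 : p^-1 * n%:R <= 1.
  by rewrite mulrC ler_pdivrMr// mul1r pn lerDl.
have h4 : 19 * C * (n%:R * (p^-1 * n%:R)) <= 19 * C * (n%:R * 1).
  by rewrite ler_wpM2l ?mulr_ge0// ler_wpM2l.
have h5 : 0 <= C * n%:R by rewrite mulr_ge0.
rewrite -/p pn in h4 *; lra.
Qed.

End fourth_moment.

Lemma psumD (D : nat -> T -> R) a l w :
  psum D (a + l) w = psum D a w + psum (fun j => D (a + j)%N) l w.
Proof. by rewrite /psum big_split_ord. Qed.

Section maximal.
Variables (D : nat -> T -> R) (c : R).

(** Doob's maximal inequality is obtained by stopping: the partial sums of the
    [D_i], frozen when they first reach level [c] in absolute value, are again
    sums of increments orthogonal to the past, and their last value exceeds [c]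
    as soon as one of the original partial sums does. *)
Fixpoint stopped n w : R :=
  if n is m.+1 then
    stopped m w + (if `|stopped m w| < c then D m w else 0)
  else 0.

Definition stopped_incr n w : R := if `|stopped n w| < c then D n w else 0.

Lemma stopped_psum n w : stopped n w = psum stopped_incr n w.
Proof.
elim: n => [|n ih]; first by rewrite /psum big_ord0.
by rewrite psumS -ih.
Qed.

Lemma stopped_reaches n w :
  (exists2 k, (k <= n)%N & c <= `|psum D k w|) -> c <= `|stopped n w|.
Proof.
suff : (forall k, (k <= n)%N -> `|psum D k w| < c) /\
    stopped n w = psum D n w \/ c <= `|stopped n w|.
  by move=> [[h _]|//] [k /h]; rewrite ltNge => /negP.
elim: n => [|n [[h e]|ih]].
- have [c0|c0] := ltP 0 c; [left|right].
    split; last by rewrite /psum big_ord0.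
    by move=> k; rewrite leqn0 => /eqP ->; rewrite /psum big_ord0 normr0.
  by rewrite (le_trans c0).
- have [cl|cl] := ltP `|psum D n.+1 w| c; [left|right].
    split=> [k|/=].
      by rewrite leq_eqVlt => /orP[/eqP -> //|]; rewrite ltnS; exact: h.
    by rewrite e h// psumS.
  by rewrite /= e h//= -psumS.
- by right => /=; rewrite ltNge ih/= addr0.
Qed.

Hypothesis mD : forall k, measurable_fun setT (D k).

Lemma measurable_stopped n : measurable_fun setT (stopped n).
Proof.
elim: n => [|n ih]; first exact: measurable_cst.
apply: measurable_funD => //; apply: measurable_fun_ifT => //.
apply: measurable_fun_ltr => //.
exact: (measurableT_comp (@normr_measurable _ setT) ih).
Qed.

Lemma measurable_stopped_incr n : measurable_fun setT (stopped_incr n).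
Proof.
apply: measurable_fun_ifT => //; apply: measurable_fun_ltr => //.
exact: (measurableT_comp (@normr_measurable _ setT) (measurable_stopped n)).
Qed.

Let stopped_incr_le k w : stopped_incr k w ^+ 4 <= D k w ^+ 4.
Proof.
by rewrite /stopped_incr; case: ifP => // _; rewrite expr0n/= exprn_even_ge0.
Qed.

Let rintegrable_stopped_incr4 :
  (forall k, rintegrable P (fun w => D k w ^+ 4)) ->
  forall k, rintegrable P (fun w => stopped_incr k w ^+ 4).
Proof.
move=> iD4 k; apply: (rintegrable_le _ _ (iD4 k)).
  exact: (measurableT_comp (exprn_measurable 4) (measurable_stopped_incr k)).
by move=> w; rewrite ger0_norm ?exprn_even_ge0.
Qed.

Lemma rintegrable_stopped4 n :
  (forall k, rintegrable P (fun w => D k w ^+ 4)) ->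
  rintegrable P (fun w => stopped n w ^+ 4).
Proof.
move=> iD4.
have -> : stopped n = psum stopped_incr n.
  by apply/funext => w; exact: stopped_psum.
exact: rintegrable_psum4 measurable_stopped_incr (rintegrable_stopped_incr4 iD4) n.
Qed.

Lemma stopped_moment4 (C : R) n :
  (forall k, rintegrable P (fun w => D k w ^+ 4)) ->
  (forall k, mean P (fun w => D k w ^+ 4) <= C) ->
  (forall k, mean P (fun w => stopped k w ^+ 3 * stopped_incr k w) = 0) ->
  mean P (fun w => stopped n w ^+ 4) <= 19 * C * n%:R ^+ 2.
Proof.
move=> iD4 D4 ortho.
have i4 := rintegrable_stopped_incr4 iD4.
have m4 k : mean P (fun w => stopped_incr k w ^+ 4) <= C.
  by rewrite (le_trans _ (D4 k))// ler_mean.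
have -> : stopped n = psum stopped_incr n.
  by apply/funext => w; exact: stopped_psum.
apply: psum_moment4 => //; first exact: measurable_stopped_incr.
move=> k; rewrite -[RHS](ortho k); apply: eq_mean => w.
by rewrite stopped_psum.
Qed.

End maximal.

End weighted_sums.

(** * Independence of sigma-algebras *)

Section independence.
Context {d} {T : measurableType d} {R : realType}.
Variable P : probability T R.

Definition independent2 d1 d2 (T1 : measurableType d1) (T2 : measurableType d2)
    (U : T -> T1) (V : T -> T2) :=
  forall A B, measurable A -> measurable B ->
    P (U @^-1` A `&` V @^-1` B) = (P (U @^-1` A) * P (V @^-1` B))%E.

Lemma independent2_comp d1 d2 d3 d4 (T1 : measurableType d1)
    (T2 : measurableType d2) (T3 : measurableType d3) (T4 : measurableType d4)
    (U : T -> T1) (V : T -> T2) (f : T1 -> T3) (g : T2 -> T4) :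
  measurable_fun setT f -> measurable_fun setT g ->
  independent2 U V -> independent2 (f \o U) (g \o V).
Proof.
move=> mf mg UV A B mA mB; apply: (UV (f @^-1` A) (g @^-1` B)).
- by rewrite -[X in measurable X]setTI; exact: mf.
- by rewrite -[X in measurable X]setTI; exact: mg.
Qed.

(** The joint law of independent variables is a product measure, so this is
    Tonelli's theorem. *)
Lemma independent2_integralM (U V : T -> R) :
  measurable_fun setT U -> measurable_fun setT V ->
  (forall w, 0 <= U w) -> (forall w, 0 <= V w) -> independent2 U V ->
  (\int[P]_w (U w * V w)%:E = \int[P]_w (U w)%:E * \int[P]_w (V w)%:E)%E.
Proof.
move=> mU mV U0 V0 UV.
pose X : {RV P >-> R} := mfun_Sub (mem_set mU).
pose Y : {RV P >-> R} := mfun_Sub (mem_set mV).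
have mXY : measurable_fun setT (fun w => (U w, V w)) by exact: measurable_fun_pair.
pose XY : {RV P >-> (R * R)%type} := mfun_Sub (mem_set mXY).
have mnorm : measurable_fun setT (fun x : R => `|x|%:E).
  by apply/measurable_EFinP; exact: normr_measurable.
pose h (x : R * R) : \bar R := (`|x.1| * `|x.2|)%:E.
have mh : measurable_fun setT h.
  apply/measurable_EFinP; apply: measurable_funM.
    by apply: (measurableT_comp (@normr_measurable _ setT)); exact: measurable_fst.
  by apply: (measurableT_comp (@normr_measurable _ setT)); exact: measurable_snd.
have h0 x : (0 <= h x)%E by rewrite lee_fin.
transitivity (\int[P]_w (h \o XY) w)%E.
  by apply: eq_integral => w _; rewrite /h/= !ger0_norm.
rewrite -ge0_integral_distribution//.
pose mu1 := distribution P X; pose mu2 := distribution P Y.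
rewrite (eq_measure_integral (mu1 \x mu2)%E); last first.
  by move=> A mA _; apply/esym; apply: product_measure_unique => // A1 A2 mA1 mA2;
    exact: (UV A1 A2 mA1 mA2).
rewrite fubini_tonelli1//.
have EU : (\int[P]_w (U w)%:E = \int[mu1]_x `|x|%:E)%E.
  rewrite ge0_integral_distribution//; apply: eq_integral => w _ /=.
  by rewrite ger0_norm.
have EV : (\int[P]_w (V w)%:E = \int[mu2]_x `|x|%:E)%E.
  rewrite ge0_integral_distribution//; apply: eq_integral => w _ /=.
  by rewrite ger0_norm.
rewrite EU EV -ge0_integralZr//; last exact: integral_ge0.
apply: eq_integral => x _; rewrite /fubini_F/= /h/=.
under eq_integral do rewrite EFinM.
by rewrite ge0_integralZl_EFin.
Qed.

Let independent2_meanM_ge0 (U V : T -> R) :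
  rintegrable P U -> rintegrable P V -> (forall w, 0 <= U w) ->
  (forall w, 0 <= V w) -> independent2 U V ->
  rintegrable P (fun w => U w * V w) /\
  mean P (fun w => U w * V w) = mean P U * mean P V.
Proof.
move=> iU iV U0 V0 UV.
have mU := rintegrable_measurable iU; have mV := rintegrable_measurable iV.
apply: ge0_rintegrable => //.
- exact: measurable_funM.
- by move=> w; rewrite mulr_ge0.
by rewrite independent2_integralM// !EFin_mean.
Qed.

Lemma independent2_meanM (U V : T -> R) :
  rintegrable P U -> rintegrable P V -> independent2 U V ->
  rintegrable P (fun w => U w * V w) /\
  mean P (fun w => U w * V w) = mean P U * mean P V.
Proof.
move=> iU iV UV.
pose p (x : R) := Num.max x 0; pose n (x : R) := Num.max (- x) 0.
have mp : measurable_fun setT p by apply: measurable_maxr => //; exact: measurable_cst.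
have mn : measurable_fun setT n.
  by apply: measurable_maxr; [exact: oppr_measurable|exact: measurable_cst].
have p0 x : 0 <= p x by rewrite le_max lexx orbT.
have n0 x : 0 <= n x by rewrite le_max lexx orbT.
have pn x : x = p x - n x.
  rewrite /p /n; have [x0|x0] := leP 0 x.
    by rewrite max_r ?subr0// oppr_le0.
  by rewrite max_l ?sub0r ?opprK// oppr_ge0 ltW.
have pl x : `|p x| <= `|x|.
  by rewrite ger0_norm// /p ge_max ler_norm normr_ge0.
have nl x : `|n x| <= `|x|.
  by rewrite ger0_norm// /n ge_max -normrN ler_norm normr_ge0.
have ip W : rintegrable P W -> rintegrable P (p \o W).
  move=> iW; apply: (rintegrable_le _ _ (rintegrable_norm iW)) => [|w]; last exact: pl.
  exact: (measurableT_comp mp (rintegrable_measurable iW)).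
have iN W : rintegrable P W -> rintegrable P (n \o W).
  move=> iW; apply: (rintegrable_le _ _ (rintegrable_norm iW)) => [|w]; last exact: nl.
  exact: (measurableT_comp mn (rintegrable_measurable iW)).
have [i1 m1] := independent2_meanM_ge0 (ip _ iU) (ip _ iV) (fun=> p0 _) (fun=> p0 _)
  (independent2_comp mp mp UV).
have [i2 m2] := independent2_meanM_ge0 (ip _ iU) (iN _ iV) (fun=> p0 _) (fun=> n0 _)
  (independent2_comp mp mn UV).
have [i3 m3] := independent2_meanM_ge0 (iN _ iU) (ip _ iV) (fun=> n0 _) (fun=> p0 _)
  (independent2_comp mn mp UV).
have [i4 m4] := independent2_meanM_ge0 (iN _ iU) (iN _ iV) (fun=> n0 _) (fun=> n0 _)
  (independent2_comp mn mn UV).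
have e : (fun w => U w * V w) = (fun w => ((p \o U) w * (p \o V) w -
    (p \o U) w * (n \o V) w) - ((n \o U) w * (p \o V) w - (n \o U) w * (n \o V) w)).
  by apply/funext => w /=; rewrite {1}(pn (U w)) {1}(pn (V w)); ring.
have mE W : rintegrable P W -> mean P W = mean P (p \o W) - mean P (n \o W).
  move=> iW; rewrite -meanB//; [|exact: ip|exact: iN].
  by apply: eq_mean => w; exact: pn.
rewrite e; split; first by apply: rintegrableB; exact: rintegrableB.
rewrite !meanB//; [|exact: rintegrableB|exact: rintegrableB].
by rewrite (mE _ iU) (mE _ iV) m1 m2 m3 m4; ring.
Qed.

Section families.
Context {d'} {T' : measurableType d'} {I : choiceType}.
Variable Z : I -> T -> T'.
Hypothesis mZ : forall i, measurable_fun setT (Z i).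
Implicit Types J : set I.

(** Events depending on finitely many [Z i], [i] in [J], through a product set.
    They form a pi-system. *)
Definition cylinders J : set (set T) :=
  [set A | exists (s : seq I) (B : I -> set T'), [/\ uniq s,
    forall i, i \in s -> J i, forall i, measurable (B i) &
    A = \bigcap_(i in [set` s]) (Z i @^-1` B i)]].

Lemma cylinders_measurable J A : cylinders J A -> measurable A.
Proof.
move=> [s [B [_ _ mB ->]]]; apply: fin_bigcap_measurable; first exact: finite_seq.
by move=> i _; rewrite -[X in measurable X]setTI; exact: mZ.
Qed.

Lemma cylinders_setI J : setI_closed (cylinders J).
Proof.
move=> _ _ [s1 [B1 [u1 J1 m1 ->]]] [s2 [B2 [u2 J2 m2 ->]]].
exists (undup (s1 ++ s2)), (fun i =>
  (if i \in s1 then B1 i else setT) `&` (if i \in s2 then B2 i else setT)).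
split.
- exact: undup_uniq.
- by move=> i; rewrite mem_undup mem_cat => /orP[/J1|/J2].
- by move=> i; apply: measurableI; case: ifP.
apply/seteqP; split=> w.
  move=> [h1 h2] i /=; rewrite mem_undup => _; split.
    by case: ifP => // i1; exact: h1.
  by case: ifP => // i2; exact: h2.
move=> h; split=> i /= iS.
  by have [] := h i; rewrite /= ?mem_undup ?mem_cat ?iS//.
by have [] := h i; rewrite /= ?mem_undup ?mem_cat ?iS ?orbT//.
Qed.

Lemma cylinders_coord J i A : J i -> measurable A ->
  cylinders J (Z i @^-1` A).
Proof.
move=> Ji mA; exists [:: i], (fun=> A); split=> //.
  by move=> j; rewrite inE => /eqP ->.
apply/seteqP; split=> w /=.
  by move=> Aw j /=; rewrite inE => /eqP ->.
by apply; rewrite /= inE.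
Qed.

(** The space [T] with the sigma-algebra generated by the [Z i], [i] in [J]. *)
Definition sigma_events J := g_sigma_algebraType (cylinders J).

Lemma sigma_events_measurable J A : <<s cylinders J >> A -> measurable A.
Proof.
apply: smallest_sub; last exact: cylinders_measurable.
exact: sigma_algebra_measurable.
Qed.

(** Dynkin's argument: two finite measures that agree on a pi-system agree on
    the sigma-algebra that it generates. *)
Let indep_extend J (E : set T) : measurable E ->
  (forall A, cylinders J A -> P (A `&` E) = (P A * P E)%E) ->
  forall A, <<s cylinders J >> A -> P (A `&` E) = (P A * P E)%E.
Proof.
move=> mE h A.
apply: (@dynkin_induction _ (sigma_events J) (cylinders J)
  (fun A => P (A `&` E) = (P A * P E)%E)) => //.
- exact: cylinders_setI.
- by rewrite setTI [X in (X * _)%E](@probability_setT _ _ _ P) mul1e.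
- move=> S /sigma_events_measurable mS hS.
  rewrite setIC -setDE measureD//; last by rewrite ltey_eq fin_num_measure.
  rewrite (setIC E) [X in (_ - X)%E](_ : _ = P (S : set T) * P E)%E//.
  have : P (~` S) = (1 - P S)%E by exact: probability_setC.
  by move=> ->; rewrite muleBl ?fin_num_measure ?mul1e.
- move=> F mF tF hF.
  have mF' k : measurable (F k : set T) by exact: (sigma_events_measurable (mF k)).
  rewrite setI_bigcupl measure_bigcup//; last 2 first.
  + by move=> k _; exact: measurableI.
  + exact: trivIset_setIr.
  rewrite measure_bigcup//.
  have Ee : P E = (fine (P E))%:E by rewrite fineK ?fin_num_measure.
  rewrite [in RHS]Ee muleC -nneseriesZl//; apply: eq_eseriesr => k _.
  by rewrite -Ee muleC; exact: hF.
Qed.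

(** The extension from cylinders is applied once in each argument; for two
    cylinders with disjoint index sets, independence is the product rule over
    the union of the indices. *)
Lemma independent_sigma_events J1 J2 A E : mutual_independence P Z ->
  (forall i, J1 i -> ~ J2 i) ->
  <<s cylinders J1 >> A -> <<s cylinders J2 >> E ->
  P (A `&` E) = (P A * P E)%E.
Proof.
move=> indZ J12 sA sE.
have mA := sigma_events_measurable sA; have mE := sigma_events_measurable sE.
apply: (indep_extend mE _ sA) => {}A cA {mA sA}.
rewrite setIC muleC; apply: (indep_extend (cylinders_measurable cA) _ sE).
move=> {mE sE}E cE.
case: cA => s1 [B1 [u1 Js1 m1 ->]]; case: cE => s2 [B2 [u2 Js2 m2 ->]].
pose B i := if i \in s1 then B1 i else B2 i.
have disj i : i \in s2 -> i \in s1 = false.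
  by move=> i2; apply/negP => i1; exact: (J12 i (Js1 _ i1) (Js2 _ i2)).
have e1 : \bigcap_(i in [set` s1]) (Z i @^-1` B1 i) =
    \bigcap_(i in [set` s1]) (Z i @^-1` B i).
  by apply: eq_bigcapr => i /= i1; rewrite /B i1.
have e2 : \bigcap_(i in [set` s2]) (Z i @^-1` B2 i) =
    \bigcap_(i in [set` s2]) (Z i @^-1` B i).
  by apply: eq_bigcapr => i /= i2; rewrite /B disj.
have mB i : measurable (B i) by rewrite /B; case: ifP.
rewrite e1 e2 !indZ//.
have -> : \bigcap_(i in [set` s2]) (Z i @^-1` B i) `&`
    \bigcap_(i in [set` s1]) (Z i @^-1` B i) =
    \bigcap_(i in [set` s2 ++ s1]) (Z i @^-1` B i).
  apply/seteqP; split=> w.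
    by move=> [h2 h1] i /=; rewrite mem_cat => /orP[]; [exact: h2|exact: h1].
  by move=> h; split=> i /= iS; apply: h; rewrite /= mem_cat iS ?orbT.
rewrite indZ ?big_cat// cat_uniq u1 u2 andbT/=.
by apply/hasPn => i i1; apply/negP => /disj; rewrite i1.
Qed.

Lemma sigma_events_coord J i : J i ->
  measurable_fun setT (Z i : sigma_events J -> T').
Proof.
by move=> Ji _ A mA; rewrite setTI; apply: sub_gen_smallest; exact: cylinders_coord.
Qed.

Lemma sigma_events_measurable_fun J d2 (T2 : measurableType d2) (U : T -> T2) :
  measurable_fun setT (U : sigma_events J -> T2) -> measurable_fun setT U.
Proof.
move=> mU _ B mB; apply: (@sigma_events_measurable J).
exact: (mU measurableT B mB).
Qed.

Lemma independent2_sigma_events J1 J2 d1 d2 (T1 : measurableType d1)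
    (T2 : measurableType d2) (U : T -> T1) (V : T -> T2) :
  mutual_independence P Z -> (forall i, J1 i -> ~ J2 i) ->
  measurable_fun setT (U : sigma_events J1 -> T1) ->
  measurable_fun setT (V : sigma_events J2 -> T2) -> independent2 U V.
Proof.
move=> indZ J12 mU mV A B mA mB; apply: (independent_sigma_events indZ J12).
- by have := mU measurableT _ mA; rewrite setTI.
- by have := mV measurableT _ mB; rewrite setTI.
Qed.

End families.
End independence.

(** * Integer-valued random variables and the Poisson law *)

(** A preimage is the countable union, over the values of the random integer,
    of preimages under the single cases. *)
Lemma measurable_nat_case d d2 (S : measurableType d) (T2 : measurableType d2)
    (U : S -> nat) (G : nat -> S -> T2) :
  measurable_fun setT U -> (forall x, measurable_fun setT (G x)) ->
  measurable_fun setT (fun w => G (U w) w).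
Proof.
move=> mU mG _ B mB; rewrite setTI.
rewrite (_ : _ @^-1` B = \bigcup_x (U @^-1` [set x] `&` G x @^-1` B)).
  apply: bigcup_measurable => x _; apply: measurableI.
    by rewrite -[X in measurable X]setTI; exact: mU.
  by rewrite -[X in measurable X]setTI; exact: mG.
apply/seteqP; split=> w /=; first by move=> BG; exists (U w).
by move=> [x _ [/= <-]].
Qed.

Lemma measurable_nat_comp d d2 (S : measurableType d) (T2 : measurableType d2)
    (U : S -> nat) (G : nat -> T2) :
  measurable_fun setT U -> measurable_fun setT (fun w => G (U w)).
Proof.
move=> mU; exact: (@measurable_nat_case _ _ _ _ U (fun x _ => G x)).
Qed.

Lemma measurable_nat_comp2 d d2 (S : measurableType d) (T2 : measurableType d2)
    (U V : S -> nat) (G : nat -> nat -> T2) :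
  measurable_fun setT U -> measurable_fun setT V ->
  measurable_fun setT (fun w => G (U w) (V w)).
Proof.
move=> mU mV; apply: (@measurable_nat_case _ _ _ _ U (fun x w => G x (V w))) => // x.
exact: measurable_nat_comp.
Qed.

Lemma measurable_nat_sum d (S : measurableType d) (f : nat -> S -> nat) n :
  (forall j, (j < n)%N -> measurable_fun setT (f j)) ->
  measurable_fun setT (fun w => \sum_(j < n) f j w)%N.
Proof.
elim: n => [|n ih] mf.
  by under eq_fun do rewrite big_ord0; exact: measurable_cst.
under eq_fun do rewrite big_ord_recr/=.
apply: (@measurable_nat_comp2 _ _ _ _ _ (f n) addn); last exact: mf.
by apply: ih => j jn; apply: mf; rewrite ltnS ltnW.
Qed.

Section nat_laws.
Context {d} {T : measurableType d} {R : realType}.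
Variable P : probability T R.
Implicit Types (U : T -> nat) (f : nat -> R).

Lemma nat_preimage_measurable U A : measurable_fun setT U ->
  measurable (U @^-1` A).
Proof. by move=> mU; rewrite -[X in measurable X]setTI; exact: mU. Qed.

Lemma ge0_integral_nat_split U (h : T -> \bar R) : measurable_fun setT U ->
  measurable_fun setT h -> (forall w, 0 <= h w)%E ->
  (\int[P]_w h w = \sum_(0 <= x <oo) \int[P]_w (h w * (\1_(U @^-1` [set x]) w)%:E))%E.
Proof.
move=> mU mh h0.
rewrite -integral_nneseries//; last 2 first.
- move=> x; apply: emeasurable_funM => //; apply/measurable_EFinP.
  exact/measurable_indic/nat_preimage_measurable.
- by move=> x w _; rewrite mule_ge0.
apply: eq_integral => w _.
rewrite (@nneseriesD1 _ _ (U w))//; last first.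
  by move=> x _; rewrite mule_ge0.
rewrite indicE mem_set//= mule1 eseries0 ?adde0// => x _ /= xU.
rewrite indicE memNset ?mule0//= => Ux.
by rewrite Ux eqxx in xU.
Qed.

Lemma ge0_integral_nat_law U f : measurable_fun setT U -> (forall x, 0 <= f x) ->
  (\int[P]_w (f (U w))%:E = \sum_(0 <= x <oo) ((f x)%:E * P (U @^-1` [set x])))%E.
Proof.
move=> mU f0; rewrite (@ge0_integral_nat_split U)//; last 2 first.
- by apply/measurable_EFinP; exact: measurable_nat_comp.
- by move=> w; rewrite lee_fin.
apply: eq_eseriesr => x _.
transitivity (\int[P]_w ((f x)%:E * (\1_(U @^-1` [set x]) w)%:E))%E.
  apply: eq_integral => w _; rewrite indicE.
  by case: (boolP (w \in _)) => [/set_mem/= ->//|_]; rewrite !mule0.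
rewrite ge0_integralZl_EFin//.
- by rewrite integral_indic ?setIT//; exact: nat_preimage_measurable.
- apply/measurable_EFinP; exact/measurable_indic/nat_preimage_measurable.
Qed.

Lemma bernoulli_integral (p : R) U f : measurable_fun setT U ->
  bernoulli_law P p U -> (forall x, 0 <= f x) ->
  (\int[P]_w (f (U w))%:E = (p * f 1 + (1 - p) * f 0)%:E)%E.
Proof.
move=> mU [U1 U0] f0.
have Ux x : P (U @^-1` [set x.+2]) = 0.
  have : (P (U @^-1` [set x.+2]) + P (U @^-1` [set 0%N; 1%N]) <= 1)%E.
    rewrite -measureU; last 3 first.
    - exact: nat_preimage_measurable.
    - exact: nat_preimage_measurable.
    - by apply/seteqP; split=> // w /= [-> []].
    by apply: probability_le1; apply: measurableU; exact: nat_preimage_measurable.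
  have -> : P (U @^-1` [set 0%N; 1%N]) = 1%E.
    rewrite preimage_setU measureU; last 3 first.
    - exact: nat_preimage_measurable.
    - exact: nat_preimage_measurable.
    - by apply/seteqP; split=> // w /= [->].
    by rewrite [X in (X + _)%E]U0 [X in (_ + X)%E]U1 -EFinD subrK.
  rewrite -leeBrDr// subee//.
  by move=> h; apply/eqP; rewrite eq_le h measure_ge0.
rewrite ge0_integral_nat_law// (nneseries_split 0 2)/=; last first.
  by move=> x _; rewrite mule_ge0// lee_fin.
rewrite eseries0 ?adde0; last first.
  by move=> [|[|x]]// _ _; rewrite Ux mule0.
rewrite add0n big_mkord !big_ord_recr big_ord0/= add0e U1 U0.
by rewrite -!EFinM -EFinD addrC mulrC [X in _ + X]mulrC.
Qed.

Section poisson.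
Variables (lam : R) (U : T -> nat).
Hypothesis mU : measurable_fun setT U.
Hypothesis lam0 : 0 < lam.
Hypothesis lawU : poisson_law P lam U.

Let poisson_integral f : (forall x, 0 <= f x) ->
  (\int[P]_w (f (U w))%:E = \sum_(0 <= x <oo) (f x * poisson_pmf lam x)%:E)%E.
Proof.
by move=> f0; rewrite ge0_integral_nat_law//; apply: eq_eseriesr => x _; rewrite lawU.
Qed.

Lemma poisson_pgf z : 0 <= z ->
  (\int[P]_w (z ^+ U w)%:E = (expR (lam * (z - 1)))%:E)%E.
Proof.
move=> z0; rewrite (@poisson_integral (fun x => z ^+ x)); last first.
  by move=> x; rewrite exprn_ge0.
transitivity (\sum_(0 <= x <oo) ((expR (- lam))%:E * ((lam * z) ^+ x / x`!%:R)%:E))%E.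
  apply: eq_eseriesr => x _; rewrite /poisson_pmf lam0 -EFinM exprMn.
  by congr EFin; ring.
rewrite nneseriesZl; last first.
  by move=> x _; rewrite lee_fin divr_ge0// exprn_ge0// mulr_ge0// ltW.
have -> : lam * (z - 1) = - lam + lam * z by ring.
rewrite expRD EFinM; congr (_ * _)%E.
rewrite expRE -EFin_lim; last first.
  rewrite /pseries/=; under eq_fun do rewrite mulrC.
  exact: is_cvg_series_exp_coeff.
apply/congr_lim/funext => n/=; rewrite /pseries/= /series/= -sumEFin//.
by under eq_bigr do rewrite mulrC.
Qed.

(** The Stein-Chen identity [E (U f(U)) = lam E f(U+1)], from
    [m pmf(m) = lam pmf(m-1)]. *)
Lemma poisson_stein f : (forall x, 0 <= f x) ->
  (\int[P]_w ((U w)%:R * f (U w))%:E = lam%:E * \int[P]_w (f (U w).+1)%:E)%E.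
Proof.
move=> f0.
rewrite (@poisson_integral (fun x => x%:R * f x)); last by move=> x; rewrite mulr_ge0.
rewrite (@poisson_integral (fun x => f x.+1))// -nneseriesZl; last first.
  by move=> x _; rewrite lee_fin mulr_ge0// poisson_pmf_ge0.
rewrite nneseries_recl//; last first.
  by move=> x _; rewrite lee_fin !mulr_ge0// poisson_pmf_ge0.
rewrite mul0r mul0r add0e -nneseries_addn; last first.
  by move=> x; rewrite lee_fin !mulr_ge0// poisson_pmf_ge0.
apply: eq_eseriesr => x _; rewrite addn1 -EFinM; congr EFin.
rewrite /poisson_pmf lam0 factS natrM exprS.
have a0 : x.+1%:R != 0 :> R by rewrite pnatr_eq0.
have b0 : x`!%:R != 0 :> R by rewrite pnatr_eq0 -lt0n fact_gt0.
move: (x.+1%:R : R) (x`!%:R : R) a0 b0 => a b a0 b0.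
by field; rewrite a0 b0.
Qed.

Lemma poisson_mean : rintegrable P (fun w => (U w)%:R) /\
  mean P (fun w => (U w)%:R) = lam.
Proof.
apply: ge0_rintegrable => //; first exact: measurable_nat_comp.
have := @poisson_stein (fun=> 1) (fun=> ler01).
rewrite integral_cst// [X in (1%:E * X)%E](@probability_setT _ _ _ P) !mule1 => <-.
by apply: eq_integral => w _; rewrite mulr1.
Qed.

Lemma poisson_moment2 : rintegrable P (fun w => (U w)%:R ^+ 2) /\
  mean P (fun w => (U w)%:R ^+ 2) = lam ^+ 2 + lam.
Proof.
apply: ge0_rintegrable.
- exact: (@measurable_nat_comp _ _ _ _ _ (fun x => x%:R ^+ 2 : R)).
- by move=> w; rewrite sqr_ge0.
have := @poisson_stein (fun x => x%:R) (fun=> ler0n _ _).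
have [i1 m1] := poisson_mean.
have -> : (\int[P]_w ((U w).+1%:R)%:E = (lam + 1)%:E)%E.
  have := EFin_mean (rintegrableD i1 (rintegrable_cst P 1)).
  rewrite meanD ?m1 ?mean_cst//; last exact: rintegrable_cst.
  by move=> <-; apply: eq_integral => w _; rewrite natr1.
have -> : lam ^+ 2 + lam = lam * (lam + 1) by ring.
by rewrite EFinM => <-.
Qed.

End poisson.
End nat_laws.

(** * The INAR process: Markov property, moments and martingale differences *)

Section inar_theory.
Context {d} {T : measurableType d} {R : realType}.
Variables (P : probability T R) (X0 : {RV P >-> nat}).
Variables (xi : nat -> nat -> {RV P >-> nat}) (eps : nat -> {RV P >-> nat}).
Variables (alpha lambda : R).
Hypothesis alpha01 : 0 < alpha < 1.
Hypothesis lambda0 : 0 < lambda.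
Hypothesis statX : stationary_poisson_inar X0 xi eps alpha lambda.

Local Notation X := (inar X0 xi eps).
Local Notation Z := (inar_input X0 xi eps).
Local Notation index := (option (nat * nat + nat)%type).

Let alpha0 : 0 < alpha. Proof. by case/andP: alpha01. Qed.
Let alpha1 : 0 < 1 - alpha. Proof. by case/andP: alpha01; rewrite subr_gt0. Qed.
Let alpha1_neq0 : 1 - alpha != 0. Proof. by rewrite gt_eqF. Qed.

Let mZ i : measurable_fun setT (Z i).
Proof. by case: i => [[kj|k]|] /=; exact: measurable_funP. Qed.

Let indZ : mutual_independence P Z. Proof. by case: statX. Qed.
Let xi_law k j : bernoulli_law P alpha (xi k j). Proof. by case: statX. Qed.
Let eps_law k : poisson_law P lambda (eps k). Proof. by case: statX. Qed.
Let X0_law : poisson_law P (lambda / (1 - alpha)) X0. Proof. by case: statX. Qed.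

(** The inputs that determine [X_0, ..., X_k]. *)
Definition inar_past (k : nat) : set index :=
  [set i | match i with
    | None => true | Some (inl lj) => lj.1 < k | Some (inr l) => l < k end]%N.

(** The inputs of the step from time [k] to time [k+1]. *)
Definition inar_now (k : nat) : set index :=
  [set i | match i with
    | None => false | Some (inl lj) => lj.1 == k | Some (inr l) => l == k end].

Local Notation past k := (sigma_events Z (inar_past k)).
Local Notation now k := (sigma_events Z (inar_now k)).

Let past_now k i : inar_past k i -> ~ inar_now k i.
Proof.
by case: i => [[lj|l]|]//= lk; apply/negP; rewrite neq_ltn lk.
Qed.

Lemma past_measurable k l : (l <= k)%N -> measurable_fun setT (X l : past k -> nat).
Proof.
elim: l => [_|l ih lk].
  exact: (@sigma_events_coord _ _ _ _ _ Z (inar_past k) None).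
have mX := ih (ltnW lk).
apply: (@measurable_nat_comp2 _ _ (past k) _ _ (eps l) addn); last first.
  exact: (@sigma_events_coord _ _ _ _ _ Z (inar_past k) (Some (inr l))).
apply: (@measurable_nat_case _ _ (past k) _ (X l)
  (fun x w => \sum_(j < x) xi l j w)%N) => // x.
apply: (@measurable_nat_sum _ (past k) (fun j => xi l j : T -> nat)) => j _.
exact: (@sigma_events_coord _ _ _ _ _ Z (inar_past k) (Some (inl (l, j)))).
Qed.

Lemma inar_measurable k : measurable_fun setT (X k).
Proof. exact: (sigma_events_measurable_fun mZ (past_measurable (leqnn k))). Qed.

(** The random variables that are functions of [X_0, ..., X_k].  Measurability
    with respect to the past is automatic because the trajectory up to time [k]
    takes countably many values. *)
Definition adapted k (g : T -> R) :=
  forall w w', (forall l, (l <= k)%N -> X l w = X l w') -> g w = g w'.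

(** The trajectory up to time [k], encoded as one integer. *)
Let history := fix history k w : nat :=
  if k is k'.+1 then pickle (history k' w, X k w) else X 0 w.

Let history_measurable k : measurable_fun setT (history k : past k -> nat).
Proof.
suff h l : (l <= k)%N -> measurable_fun setT (history l : past k -> nat) by exact: h.
elim: l => [_|l ih lk]; first exact: past_measurable.
apply: (@measurable_nat_comp2 _ _ (past k) _ (history l) (X l.+1)
  (fun x y => pickle (x, y))); [exact: (ih (ltnW lk))|exact: past_measurable].
Qed.

Let history_inj k w w' : history k w = history k w' ->
  forall l, (l <= k)%N -> X l w = X l w'.
Proof.
elim: k => [|k ih] /=; first by move=> h l; rewrite leqn0 => /eqP ->.
move=> /(pcan_inj pickleK)[/ih h e] l; rewrite leq_eqVlt => /orP[/eqP -> //|].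
by rewrite ltnS; exact: h.
Qed.

Lemma adapted_past_measurable k g :
  adapted k g -> measurable_fun setT (g : past k -> R).
Proof.
move=> ag.
pose G x : R := if pselect (exists w, history k w = x) is left h
  then g (sval (cid h)) else 0.
rewrite (_ : g = (fun w => G (history k w))); last first.
  apply/funext => w; rewrite /G; case: pselect => [h|]; last by case; exists w.
  by case: cid => w' /= hw'; apply/ag/history_inj.
exact: (@measurable_nat_comp _ _ (past k) _ (history k) G).
Qed.

Lemma adapted_measurable k g : adapted k g -> measurable_fun setT g.
Proof.
by move=> /adapted_past_measurable; exact: sigma_events_measurable_fun.
Qed.

(** The value of [X_(k+1)] when [X_k = x].  Unlike [X_(k+1)] it depends on the
    inputs of step [k] alone, hence is independent of the past. *)
Definition inar_step k (x : nat) w : nat := (\sum_(j < x) xi k j w + eps k w)%N.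

Let inar_step_now k x : measurable_fun setT (inar_step k x : now k -> nat).
Proof.
apply: (@measurable_nat_comp2 _ _ (now k) _ _ (eps k) addn); last first.
  by apply: (@sigma_events_coord _ _ _ _ _ Z (inar_now k) (Some (inr k))) => /=.
apply: (@measurable_nat_sum _ (now k) (fun j => xi k j : T -> nat)) => j _.
by apply: (@sigma_events_coord _ _ _ _ _ Z (inar_now k) (Some (inl (k, j)))) => /=.
Qed.

Let mstep k x : measurable_fun setT (inar_step k x).
Proof. exact: (sigma_events_measurable_fun mZ (@inar_step_now k x)). Qed.

(** The Markov property in integrated form, where [m x] is the mean of
    [F x X_(k+1)] given [X_k = x]: on each event [X_k = x] the next state is
    [inar_step k x], which is independent of [G]. *)
Lemma markov_property_ge0 k (G : T -> R) (F : nat -> nat -> R) (m : nat -> R) :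
  adapted k G -> (forall w, 0 <= G w) -> (forall x y, 0 <= F x y) ->
  (forall x, \int[P]_w (F x (inar_step k x w))%:E = (m x)%:E)%E ->
  (\int[P]_w (G w * F (X k w) (X k.+1 w))%:E = \int[P]_w (G w * m (X k w))%:E)%E.
Proof.
move=> aG G0 F0 hm.
have mX := inar_measurable k; have mG := adapted_measurable aG.
have m0 x : 0 <= m x.
  by rewrite -lee_fin -hm; apply: integral_ge0 => w _; rewrite lee_fin.
rewrite (@ge0_integral_nat_split _ _ _ P (X k))//; last 2 first.
- apply/measurable_EFinP/measurable_funM => //.
  exact: (@measurable_nat_comp2 _ _ _ _ (X k) (X k.+1) F mX (inar_measurable _)).
- by move=> w; rewrite lee_fin mulr_ge0.
rewrite [RHS](@ge0_integral_nat_split _ _ _ P (X k))//; last 2 first.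
- apply/measurable_EFinP/measurable_funM => //.
  exact: (@measurable_nat_comp _ _ _ _ (X k) m).
- by move=> w; rewrite lee_fin mulr_ge0.
apply: eq_eseriesr => x _.
pose G' w := G w * (X k w == x)%:R.
have aG' : adapted k G'.
  by move=> w w' h; rewrite /G' (aG w w' h) (h k).
have G'0 w : 0 <= G' w by rewrite mulr_ge0.
have mF : measurable_fun setT (fun w => F x (inar_step k x w)).
  exact: (@measurable_nat_comp _ _ _ _ (inar_step k x) (F x)).
transitivity (\int[P]_w (G' w * F x (inar_step k x w))%:E)%E.
  apply: eq_integral => w _; rewrite indicE -EFinM /G'.
  have [Xx|Xx] := eqVneq (X k w) x.
    by rewrite mem_set//= !mulr1 Xx /inar_step -[X in F X]Xx/= Xx.
  by rewrite memNset ?mulr0 ?mul0r//=; exact/eqP.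
rewrite independent2_integralM//; last 2 first.
- exact: adapted_measurable aG'.
- apply: (independent2_sigma_events mZ indZ (@past_now k)).
    exact: adapted_past_measurable.
  exact: (@measurable_nat_comp _ _ (now k) _ (inar_step k x) (F x)).
rewrite hm muleC -ge0_integralZl_EFin//; last 2 first.
- by move=> w _; rewrite lee_fin.
- exact/measurable_EFinP/(adapted_measurable aG').
apply: eq_integral => w _; rewrite indicE -!EFinM /G'; congr EFin.
have [Xx|Xx] := eqVneq (X k w) x.
  by rewrite mem_set//= !mulr1 Xx mulrC.
by rewrite memNset ?mulr0//=; exact/eqP.
Qed.

Lemma markov_property k (G : T -> R) (F : nat -> nat -> R) (m : nat -> R) :
  adapted k G -> (forall x y, 0 <= F x y) ->
  (forall x, \int[P]_w (F x (inar_step k x w))%:E = (m x)%:E)%E ->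
  rintegrable P (fun w => G w * F (X k w) (X k.+1 w)) ->
  rintegrable P (fun w => G w * m (X k w)) /\
  mean P (fun w => G w * F (X k w) (X k.+1 w)) = mean P (fun w => G w * m (X k w)).
Proof.
move=> aG F0 hm iGF.
have m0 x : 0 <= m x.
  by rewrite -lee_fin -hm; apply: integral_ge0 => w _; rewrite lee_fin.
pose half (s : R) w := (`|G w| + s * G w) / 2.
have main s : `|s| = 1 ->
  [/\ rintegrable P (fun w => half s w * F (X k w) (X k.+1 w)),
      rintegrable P (fun w => half s w * m (X k w)) &
      mean P (fun w => half s w * F (X k w) (X k.+1 w)) =
      mean P (fun w => half s w * m (X k w))].
  move=> s1.
  have ah : adapted k (half s) by move=> w w' h; rewrite /half (aG w w' h).
  have h0 w : 0 <= half s w.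
    rewrite /half divr_ge0//.
    by have := ler_norm (- (s * G w)); rewrite normrN normrM s1 mul1r; lra.
  have ihF : rintegrable P (fun w => half s w * F (X k w) (X k.+1 w)).
    have := rintegrableZ 2^-1 (rintegrableD (rintegrable_norm iGF) (rintegrableZ s iGF)).
    congr rintegrable; apply/funext => w.
    by rewrite normrM (ger0_norm (F0 _ _)) /half; field.
  have := markov_property_ge0 ah h0 F0 hm.
  rewrite EFin_mean// => /esym e.
  have [||i' m'] := ge0_rintegrable _ _ e; last by split.
  - apply: measurable_funM; first exact: adapted_measurable ah.
    exact: (@measurable_nat_comp _ _ _ _ (X k) m (inar_measurable k)).
  - by move=> w; rewrite mulr_ge0.
have [i1 j1 e1] := main 1 (normr1 _).
have [|i2 j2 e2] := main (-1); first by rewrite normrN1.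
have dec (h : T -> R) : (fun w => G w * h w) =
    (fun w => half 1 w * h w - half (-1) w * h w).
  by apply/funext => w; rewrite /half; field.
rewrite !dec; split; first exact: rintegrableB.
by rewrite !meanB// e1 e2.
Qed.


Section transition_moments.
Variable k : nat.

Let thinning x w : nat := (\sum_(j < x) xi k j w)%N.

Let thinning_sigma x (J : set index) : (forall j, (j < x)%N -> J (Some (inl (k, j)))) ->
  measurable_fun setT (thinning x : sigma_events Z J -> nat).
Proof.
move=> hJ.
apply: (@measurable_nat_sum _ (sigma_events Z J) (fun j => xi k j : T -> nat)) => j jx.
exact: (@sigma_events_coord _ _ _ _ _ Z J (Some (inl (k, j))) (hJ j jx)).
Qed.

Let mthinning x : measurable_fun setT (thinning x).
Proof. by apply: (@measurable_nat_sum _ _ (fun j => xi k j : T -> nat)). Qed.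

Let thinning_indep x : independent2 P (thinning x) (xi k x).
Proof.
pose J1 : set index := [set i | exists2 j, (j < x)%N & i = Some (inl (k, j))].
apply: (@independent2_sigma_events _ _ _ P _ _ _ _ mZ J1 [set Some (inl (k, x))]) => //.
- by move=> i [j jx ->] /= [] e; rewrite e ltnn in jx.
- by apply: thinning_sigma => j jx; exists j.
- exact: (@sigma_events_coord _ _ _ _ _ Z _ (Some (inl (k, x)))).
Qed.

Let thinning_eps_indep x : independent2 P (thinning x) (eps k).
Proof.
pose J1 : set index := [set i | exists j, i = Some (inl (k, j))].
apply: (@independent2_sigma_events _ _ _ P _ _ _ _ mZ J1 [set Some (inr k)]) => //.
- by move=> i [j ->].
- by apply: thinning_sigma => j jx; exists j.
- exact: (@sigma_events_coord _ _ _ _ _ Z _ (Some (inr k))).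
Qed.

Let meps : measurable_fun setT (eps k). Proof. exact: (mZ (Some (inr k))). Qed.

Let integralM_nat (U V : T -> nat) (f g : nat -> R) :
  measurable_fun setT U -> measurable_fun setT V -> independent2 P U V ->
  (forall x, 0 <= f x) -> (forall x, 0 <= g x) ->
  (\int[P]_w (f (U w) * g (V w))%:E =
   \int[P]_w (f (U w))%:E * \int[P]_w (g (V w))%:E)%E.
Proof.
move=> mU mV UV f0 g0; apply: independent2_integralM => //.
- exact: measurable_nat_comp.
- exact: measurable_nat_comp.
- exact: (independent2_comp (f := f) (g := g)).
Qed.

Let thinning_pgf x z : 0 <= z ->
  (\int[P]_w (z ^+ thinning x w)%:E = ((1 - alpha + alpha * z) ^+ x)%:E)%E.
Proof.
move=> z0; elim: x => [|x ih].
  transitivity (\int[P]_w 1%:E)%E.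
    by apply: eq_integral => w _; rewrite /thinning big_ord0.
  by rewrite integral_cst// [X in (_ * X)%E](@probability_setT _ _ _ P) mule1.
transitivity (\int[P]_w (z ^+ thinning x w * z ^+ xi k x w)%:E)%E.
  by apply: eq_integral => w _; rewrite /thinning big_ord_recr/= exprD.
rewrite (@integralM_nat _ _ (fun n => z ^+ n) (fun n => z ^+ n))//; last 2 first.
- by move=> n; rewrite exprn_ge0.
- by move=> n; rewrite exprn_ge0.
rewrite ih (@bernoulli_integral _ _ _ P alpha _ (fun n => z ^+ n))//; last first.
  by move=> n; rewrite exprn_ge0.
by rewrite expr1 expr0 mulr1 -EFinM exprSr; congr (_ * _)%:E; ring.
Qed.

Lemma inar_step_pgf x z : 0 <= z ->
  (\int[P]_w (z ^+ inar_step k x w)%:E =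
   ((1 - alpha + alpha * z) ^+ x * expR (lambda * (z - 1)))%:E)%E.
Proof.
move=> z0.
transitivity (\int[P]_w (z ^+ thinning x w * z ^+ eps k w)%:E)%E.
  by apply: eq_integral => w _; rewrite exprD.
rewrite (@integralM_nat _ _ (fun n => z ^+ n) (fun n => z ^+ n))//; last 2 first.
- by move=> n; rewrite exprn_ge0.
- by move=> n; rewrite exprn_ge0.
by rewrite thinning_pgf// (poisson_pgf meps lambda0 (eps_law k)).
Qed.

Let xi_moments x : [/\ rintegrable P (fun w => (xi k x w)%:R : R),
  mean P (fun w => (xi k x w)%:R) = alpha,
  rintegrable P (fun w => (xi k x w)%:R ^+ 2 : R) &
  mean P (fun w => (xi k x w)%:R ^+ 2) = alpha].
Proof.
have [|||i1 m1] := @ge0_rintegrable _ _ _ P (fun w => (xi k x w)%:R : R) alpha.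
- exact: measurable_nat_comp.
- by [].
- rewrite (@bernoulli_integral _ _ _ P alpha _ (fun n => n%:R))//.
  by congr EFin; ring.
have [|||i2 m2] := @ge0_rintegrable _ _ _ P (fun w => (xi k x w)%:R ^+ 2 : R) alpha.
- exact: (@measurable_nat_comp _ _ _ _ _ (fun n => n%:R ^+ 2 : R)).
- by move=> w; rewrite sqr_ge0.
- rewrite (@bernoulli_integral _ _ _ P alpha _ (fun n => n%:R ^+ 2))//.
  by congr EFin; ring.
by [].
Qed.

Let sum_moments (U V : T -> nat) (m1 m2 n1 n2 : R) :
  independent2 P U V ->
  rintegrable P (fun w => (U w)%:R : R) -> mean P (fun w => (U w)%:R) = m1 ->
  rintegrable P (fun w => (U w)%:R ^+ 2 : R) -> mean P (fun w => (U w)%:R ^+ 2) = m2 ->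
  rintegrable P (fun w => (V w)%:R : R) -> mean P (fun w => (V w)%:R) = n1 ->
  rintegrable P (fun w => (V w)%:R ^+ 2 : R) -> mean P (fun w => (V w)%:R ^+ 2) = n2 ->
  [/\ rintegrable P (fun w => (U w + V w)%N%:R : R),
      mean P (fun w => (U w + V w)%N%:R) = m1 + n1,
      rintegrable P (fun w => (U w + V w)%N%:R ^+ 2 : R) &
      mean P (fun w => (U w + V w)%N%:R ^+ 2) = m2 + 2 * (m1 * n1) + n2].
Proof.
move=> UV iU eU iU2 eU2 iV eV iV2 eV2.
have [iUV eUV] := independent2_meanM iU iV
  (independent2_comp (f := fun n => n%:R : R) (g := fun n => n%:R : R)
     (fun _ _ _ => I) (fun _ _ _ => I) UV).
have e1 : (fun w => (U w + V w)%N%:R) = (fun w => (U w)%:R + (V w)%:R : R).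
  by apply/funext => w; rewrite natrD.
have e2 : (fun w => (U w + V w)%N%:R ^+ 2) =
    (fun w => ((U w)%:R ^+ 2 + 2 * ((U w)%:R * (V w)%:R)) + (V w)%:R ^+ 2 : R).
  by apply/funext => w; rewrite natrD; ring.
have iUV2 := rintegrableZ 2 iUV.
have i12 := rintegrableD iU2 iUV2.
rewrite e1 e2; split.
- exact: rintegrableD.
- by rewrite meanD// eU eV.
- exact: rintegrableD.
- by rewrite !meanD// meanZ// eUV eU eV eU2 eV2.
Qed.

Let thinning_moments x : [/\ rintegrable P (fun w => (thinning x w)%:R : R),
  mean P (fun w => (thinning x w)%:R) = x%:R * alpha,
  rintegrable P (fun w => (thinning x w)%:R ^+ 2 : R) &
  mean P (fun w => (thinning x w)%:R ^+ 2) =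
    x%:R ^+ 2 * alpha ^+ 2 + x%:R * alpha * (1 - alpha)].
Proof.
elim: x => [|x [i1 m1 i2 m2]].
  have e : thinning 0 = (fun=> 0%N) by apply/funext => w; rewrite /thinning big_ord0.
  rewrite e !mean_cst; split; [exact: rintegrable_cst|ring|exact: rintegrable_cst|ring].
have [j1 n1 j2 n2] := xi_moments x.
have e : thinning x.+1 = (fun w => (thinning x w + xi k x w)%N).
  by apply/funext => w; rewrite /thinning big_ord_recr.
have [k1 o1 k2 o2] := sum_moments (thinning_indep x) i1 m1 i2 m2 j1 n1 j2 n2.
by rewrite e; split=> //; rewrite ?o1 ?o2 -natr1; ring.
Qed.

Lemma inar_step_moments x : [/\ rintegrable P (fun w => (inar_step k x w)%:R : R),
  mean P (fun w => (inar_step k x w)%:R) = alpha * x%:R + lambda,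
  rintegrable P (fun w => (inar_step k x w)%:R ^+ 2 : R) &
  mean P (fun w => (inar_step k x w)%:R ^+ 2) =
    (alpha * x%:R + lambda) ^+ 2 + alpha * (1 - alpha) * x%:R + lambda].
Proof.
have [i1 m1 i2 m2] := thinning_moments x.
have [j1 n1] := poisson_mean meps lambda0 (eps_law k).
have [j2 n2] := poisson_moment2 meps lambda0 (eps_law k).
have [k1 o1 k2 o2] := sum_moments (thinning_eps_indep x) i1 m1 i2 m2 j1 n1 j2 n2.
by split=> //; rewrite ?o1 ?o2; ring.
Qed.

End transition_moments.

Local Notation mu := (lambda / (1 - alpha)).

Let mu0 : 0 < mu. Proof. by rewrite divr_gt0. Qed.

(** Thinning turns the parameter [mu] of a Poisson law into [alpha mu], and
    adding the innovation gives [alpha mu + lambda = mu]: the law of [X_0] is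
    invariant. *)
Lemma inar_pgf k z : 0 <= z ->
  (\int[P]_w (z ^+ X k w)%:E = (expR (mu * (z - 1)))%:E)%E.
Proof.
elim: k z => [|k ih] z z0.
  exact: (poisson_pgf (inar_measurable 0) mu0 X0_law).
pose m x := (1 - alpha + alpha * z) ^+ x * expR (lambda * (z - 1)).
have z1 : 0 <= 1 - alpha + alpha * z.
  by rewrite addr_ge0 ?(ltW alpha1)// mulr_ge0// ltW.
transitivity (\int[P]_w (1 * z ^+ X k.+1 w)%:E)%E.
  by apply: eq_integral => w _; rewrite mul1r.
rewrite (@markov_property_ge0 k (fun=> 1) (fun _ y => z ^+ y) m)//; last 2 first.
- by move=> _ y; rewrite exprn_ge0.
- by move=> x; exact: inar_step_pgf.
transitivity (\int[P]_w ((expR (lambda * (z - 1)))%:E *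
    ((1 - alpha + alpha * z) ^+ X k w)%:E))%E.
  by apply: eq_integral => w _; rewrite mul1r /m mulrC EFinM.
rewrite ge0_integralZl_EFin ?expR_ge0//; last 2 first.
- by move=> w _; rewrite lee_fin exprn_ge0.
- apply/measurable_EFinP.
  exact: (@measurable_nat_comp _ _ _ _ _ (fun n => (1 - alpha + alpha * z) ^+ n)
    (inar_measurable k)).
by rewrite ih// -EFinM -expRD; congr (expR _)%:E; field.
Qed.

(** The generating function at [e] gives the exponential moment [E exp X_k],
    which does not depend on [k], and [y^4 <= 256 exp y] for [y >= 0]. *)
Lemma inar_moment4 : exists C, forall k,
  rintegrable P (fun w => (X k w)%:R ^+ 4 : R) /\
  mean P (fun w => (X k w)%:R ^+ 4) <= C.
Proof.
exists (256 * expR (mu * (expR 1 - 1))) => k.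
have mX n : measurable_fun setT (fun w => (X k w)%:R ^+ n : R).
  exact: (@measurable_nat_comp _ _ _ _ _ (fun x => x%:R ^+ n : R) (inar_measurable k)).
have [||ie me] := ge0_rintegrable _ _ (inar_pgf k (expR_ge0 1)).
- exact: (@measurable_nat_comp _ _ _ _ _ (fun x => expR 1 ^+ x : R) (inar_measurable k)).
- by move=> w; rewrite exprn_ge0// expR_ge0.
have bnd w : (X k w)%:R ^+ 4 <= 256 * expR 1 ^+ X k w :> R.
  have h : 1 + (X k w)%:R / 4 <= expR ((X k w)%:R / 4) :> R by exact: expR_ge1Dx.
  have -> : expR 1 ^+ X k w = expR ((X k w)%:R / 4 : R) ^+ 4.
    by rewrite -!expRM_natl; congr expR; field.
  have h1 : ((X k w)%:R / 4) ^+ 4 <= expR ((X k w)%:R / 4 : R) ^+ 4.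
    rewrite lerXn2r ?nnegrE ?expR_ge0 ?divr_ge0//.
    by rewrite (le_trans _ h)// lerDr.
  have -> : (X k w)%:R ^+ 4 = 256 * ((X k w)%:R / 4) ^+ 4 :> R by field.
  by apply: ler_wpM2l; [exact: ler0n|exact: h1].
have i4 : rintegrable P (fun w => (X k w)%:R ^+ 4 : R).
  apply: (rintegrable_le (mX 4) _ (rintegrableZ 256 ie)) => w.
  by rewrite ger0_norm ?exprn_ge0.
split=> //; have := ler_mean i4 (rintegrableZ 256 ie) bnd.
by rewrite meanZ// me.
Qed.

Let iX k : rintegrable P (fun w => (X k w)%:R : R).
Proof.
have [C hC] := inar_moment4; have [i4 _] := hC k.
have mX : measurable_fun setT (fun w => (X k w)%:R : R).
  exact: (@measurable_nat_comp _ _ _ _ _ (fun x => x%:R : R) (inar_measurable k)).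
by apply: (rintegrable_le mX _ (rintegrable_pow (n := 1) _ mX i4)).
Qed.

Lemma inar_mean k : mean P (fun w => (X k w)%:R : R) = mu.
Proof.
elim: k => [|k ih].
  by have [_] := poisson_mean (inar_measurable 0) mu0 X0_law.
have hm x : (\int[P]_w ((inar_step k x w)%:R)%:E = (alpha * x%:R + lambda)%:E)%E.
  by have [i1 m1 _ _] := inar_step_moments k x; rewrite EFin_mean// m1.
have ca : adapted k (fun=> 1) by [].
have [|_ e] := @markov_property k (fun=> 1) (fun _ y => y%:R)
  (fun x => alpha * x%:R + lambda) ca (fun _ _ => ler0n _ _) hm.
  by under eq_fun do rewrite mul1r; exact: iX.
have -> : mean P (fun w => (X k.+1 w)%:R) = mean P (fun w => 1 * (X k.+1 w)%:R).
  by apply: eq_mean => w; rewrite mul1r.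
rewrite e (@eq_mean _ _ _ _ _ (fun w => alpha * (X k w)%:R + lambda)); last first.
  by move=> w; rewrite mul1r.
rewrite meanD ?mean_cst ?meanZ ?ih//; last 2 first.
- exact: rintegrableZ.
- exact: rintegrable_cst.
by field.
Qed.

Definition inar_centered k w : R := (X k w)%:R - mu.
Definition inar_diff k w : R := (X k.+1 w)%:R - alpha * (X k w)%:R - lambda.

Local Notation S := inar_centered.
Local Notation M := inar_diff.

(** As [lambda = (1 - alpha) mu], the martingale differences of [X] are the
    innovations of an autoregression for the centred process; summing it
    expresses the partial sums of [S] through those of [M], up to a bounded
    number of terms. *)
Lemma inar_centeredS k w : S k.+1 w = alpha * S k w + M k w.
Proof. by rewrite /S /M; field. Qed.

Lemma inar_partial_sum n w :
  \sum_(1 <= k < n.+1) S k w =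
  (\sum_(k < n) M k w + alpha * (S 0 w - S n w)) / (1 - alpha).
Proof.
apply: (mulIf alpha1_neq0); rewrite divfK//.
elim: n => [|n ih]; first by rewrite big_geq// big_ord0; ring.
rewrite big_nat_recr//= mulrDl ih big_ord_recr/= inar_centeredS.
by ring.
Qed.

Lemma adapted_centered k l : (l <= k)%N -> adapted k (S l).
Proof. by move=> lk w w' h; rewrite /S h. Qed.

Lemma adapted_diff k l : (l < k)%N -> adapted k (M l).
Proof. by move=> lk w w' h; rewrite /M !h// ltnW. Qed.

Let mS k : measurable_fun setT (S k).
Proof. exact: adapted_measurable (adapted_centered (leqnn k)). Qed.

Let mM k : measurable_fun setT (M k).
Proof. exact: adapted_measurable (adapted_diff (ltnSn k)). Qed.

Let pow4D3 (a b c : R) : (a + b + c) ^+ 4 <= 27 * (a ^+ 4 + b ^+ 4 + c ^+ 4).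
Proof.
have h (x y z : R) : (x + y + z) ^+ 2 <= 3 * (x ^+ 2 + y ^+ 2 + z ^+ 2).
  have := sqr_ge0 (x - y); have := sqr_ge0 (x - z); have := sqr_ge0 (y - z).
  by rewrite !expr2; lra.
have h1 := h a b c; have h2 := h (a ^+ 2) (b ^+ 2) (c ^+ 2).
have -> : (a + b + c) ^+ 4 = ((a + b + c) ^+ 2) ^+ 2 by rewrite -exprM.
have h3 : ((a + b + c) ^+ 2) ^+ 2 <= (3 * (a ^+ 2 + b ^+ 2 + c ^+ 2)) ^+ 2.
  by rewrite lerXn2r ?nnegrE ?sqr_ge0// mulr_ge0// !addr_ge0 ?sqr_ge0.
rewrite -!exprM in h2; rewrite exprMn in h3; lra.
Qed.

Let moment4_sum3 (f g h : T -> R) C : measurable_fun setT f ->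
  measurable_fun setT g -> measurable_fun setT h ->
  (rintegrable P (fun w => f w ^+ 4) /\ mean P (fun w => f w ^+ 4) <= C) ->
  (rintegrable P (fun w => g w ^+ 4) /\ mean P (fun w => g w ^+ 4) <= C) ->
  (rintegrable P (fun w => h w ^+ 4) /\ mean P (fun w => h w ^+ 4) <= C) ->
  rintegrable P (fun w => (f w + g w + h w) ^+ 4) /\
  mean P (fun w => (f w + g w + h w) ^+ 4) <= 27 * (3 * C).
Proof.
move=> mf mg mh [i1 m1] [i2 m2] [i3 m3].
have i12 := rintegrableD i1 i2.
have i := rintegrableZ 27 (rintegrableD i12 i3).
have i4 : rintegrable P (fun w => (f w + g w + h w) ^+ 4).
  apply: (rintegrable_le _ _ i) => [|w].
    apply: (measurableT_comp (exprn_measurable 4)).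
    by apply: measurable_funD => //; exact: measurable_funD.
  by rewrite ger0_norm ?exprn_even_ge0// pow4D3.
split=> //; apply: (le_trans (ler_mean i4 i (fun w => pow4D3 _ _ _))).
by rewrite meanZ ?meanD//; [lra|exact: rintegrableD].
Qed.

Lemma inar_moments : exists2 C, 0 < C & forall k,
  [/\ rintegrable P (fun w => S k w ^+ 4), mean P (fun w => S k w ^+ 4) <= C,
      rintegrable P (fun w => M k w ^+ 4) & mean P (fun w => M k w ^+ 4) <= C].
Proof.
have [C hC] := inar_moment4.
have C0 : 0 <= C.
  by have [_] := hC 0; apply: le_trans; apply: mean_ge0 => w; rewrite exprn_ge0.
pose C' := C + mu ^+ 4 + lambda ^+ 4.
have mu4 : 0 <= mu ^+ 4 by rewrite exprn_ge0// ltW.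
have la4 : 0 <= lambda ^+ 4 by rewrite exprn_ge0// ltW.
have X4 k : rintegrable P (fun w => (X k w)%:R ^+ 4 : R) /\
    mean P (fun w => (X k w)%:R ^+ 4) <= C'.
  by have [i m] := hC k; split=> //; rewrite (le_trans m)// /C'; lra.
have cst4 (c : R) : c ^+ 4 <= C' -> rintegrable P (fun=> c ^+ 4) /\
    mean P (fun=> c ^+ 4) <= C'.
  by move=> cC; rewrite mean_cst; split=> //; exact: rintegrable_cst.
have mX k : measurable_fun setT (fun w => (X k w)%:R : R).
  exact: (@measurable_nat_comp _ _ _ _ _ (fun x => x%:R : R) (inar_measurable k)).
exists (27 * (3 * C') + 1); first by rewrite /C'; lra.
move=> k.
have [i1 m1] : rintegrable P (fun w => S k w ^+ 4) /\
    mean P (fun w => S k w ^+ 4) <= 27 * (3 * C').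
  have := @moment4_sum3 _ (fun=> - mu) (fun=> 0) C' (mX k)
    (measurable_cst _) (measurable_cst _) (X4 k).
  have -> : (fun w => ((X k w)%:R - mu + 0) ^+ 4) = (fun w => S k w ^+ 4).
    by apply/funext => w; rewrite addr0.
  apply; apply: cst4.
    by rewrite exprNn -signr_odd/= mul1r /C'; lra.
  by rewrite expr0n/= /C'; lra.
have [i2 m2] : rintegrable P (fun w => M k w ^+ 4) /\
    mean P (fun w => M k w ^+ 4) <= 27 * (3 * C').
  have mN : measurable_fun setT (fun w => - (alpha * (X k w)%:R) : R).
    by apply: measurableT_comp => //; exact: measurable_funM.
  apply: (@moment4_sum3 _ (fun w => - (alpha * (X k w)%:R)) (fun=> - lambda) C') => //.
    have [i m] := X4 k.
    have e : (fun w => (- (alpha * (X k w)%:R)) ^+ 4) =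
        (fun w => alpha ^+ 4 * (X k w)%:R ^+ 4 : R).
      by apply/funext => w; rewrite exprNn -signr_odd/= mul1r exprMn.
    rewrite e; split; first exact: rintegrableZ.
    rewrite meanZ// (le_trans _ m)// ler_piMl//.
      by apply: mean_ge0 => w; rewrite exprn_ge0.
    apply: exprn_ile1; first exact: ltW alpha0.
    by rewrite -subr_ge0; exact: ltW alpha1.
  by apply: cst4; rewrite exprNn -signr_odd/= mul1r /C'; lra.
by split=> //; lra.
Qed.

Let iS4 k : rintegrable P (fun w => S k w ^+ 4).
Proof. by have [C _ hC] := inar_moments; case: (hC k). Qed.
Let iM4 k : rintegrable P (fun w => M k w ^+ 4).
Proof. by have [C _ hC] := inar_moments; case: (hC k). Qed.

Let iM k : rintegrable P (M k).
Proof.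
by apply: (rintegrable_le (mM k) _ (rintegrable_pow (n := 1) _ (mM k) (iM4 k))).
Qed.

Let iS k : rintegrable P (S k).
Proof.
by apply: (rintegrable_le (mS k) _ (rintegrable_pow (n := 1) _ (mS k) (iS4 k))).
Qed.

Let iM2 k : rintegrable P (fun w => M k w ^+ 2).
Proof.
have := @rintegrable_pow _ _ _ P _ 2 _ (mM k) (iM4 k).
by under eq_fun do rewrite real_normK ?num_real//; exact.
Qed.

Lemma inar_martingale k (G : T -> R) : adapted k G ->
  rintegrable P (fun w => G w * (X k.+1 w)%:R) ->
  rintegrable P (fun w => G w * M k w) /\ mean P (fun w => G w * M k w) = 0.
Proof.
move=> aG iGX.
have hm x : (\int[P]_w ((inar_step k x w)%:R)%:E = (alpha * x%:R + lambda)%:E)%E.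
  by have [i1 m1 _ _] := inar_step_moments k x; rewrite EFin_mean// m1.
have [iGm e] := @markov_property k G (fun _ y => y%:R)
  (fun x => alpha * x%:R + lambda) aG (fun _ _ => ler0n _ _) hm iGX.
have -> : (fun w => G w * M k w) = (fun w => G w * (X k.+1 w)%:R -
    G w * (alpha * (X k w)%:R + lambda)).
  by apply/funext => w; rewrite /M; ring.
by split; [exact: rintegrableB|rewrite meanB// e subrr].
Qed.

Lemma inar_diff_centered k (f : T -> R) : adapted k f ->
  mean P (fun w => cos (f w) * M k w) = 0.
Proof.
move=> af.
have [||//] := @inar_martingale k (fun w => cos (f w)).
  by move=> w w' h; rewrite (af w w' h).
by apply: rintegrable_cosM; [exact: adapted_measurable af|exact: iX].
Qed.

(** The orthogonality that the fourth moment inequalities need; the factor [g]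
    is 1 for the partial sums, and for the stopped sums it is the indicator that
    the level has not been reached. *)
Lemma inar_diff_ortho k (f g : T -> R) :
  adapted k f -> adapted k g -> (forall w, `|g w| <= 1) ->
  rintegrable P (fun w => f w ^+ 4) ->
  mean P (fun w => f w ^+ 3 * (g w * M k w)) = 0.
Proof.
move=> af ag g1 i4.
have mf := adapted_measurable af; have mg := adapted_measurable ag.
have mX : measurable_fun setT (fun w => (X k.+1 w)%:R : R).
  exact: (@measurable_nat_comp _ _ _ _ _ (fun x => x%:R : R) (inar_measurable _)).
have [C hC] := inar_moment4; have [iX4 _] := hC k.+1.
have [||_ <-] := @inar_martingale k (fun w => f w ^+ 3 * g w).
- by move=> w w' h; rewrite (af w w' h) (ag w w' h).
- have i := rintegrable_norm (rintegrable_cubeM mf mX i4 iX4).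
  apply: (rintegrable_le _ _ i) => [|w].
    apply: measurable_funM => //; apply: measurable_funM => //.
    exact: (measurableT_comp (exprn_measurable 3) mf).
  by rewrite mulrAC normrM ler_piMr.
by apply: eq_mean => w; rewrite mulrA.
Qed.

(** Given [X_k = x], the variance of [M_k] is [alpha (1 - alpha) x + lambda],
    which is [lambda (1 + alpha) + alpha (1 - alpha) (x - mu)]. *)
Lemma inar_diff_square k (f : T -> R) : adapted k f ->
  mean P (fun w => cos (f w) * (M k w ^+ 2 - lambda * (1 + alpha))) =
  alpha * (1 - alpha) * mean P (fun w => cos (f w) * S k w).
Proof.
move=> af; have mf := adapted_measurable af.
pose v (x : nat) : R := alpha * (1 - alpha) * x%:R + lambda.
have hm x : (\int[P]_w (((inar_step k x w)%:R - alpha * x%:R - lambda) ^+ 2)%:E =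
    (v x)%:E)%E.
  have [i1 m1 i2 m2] := inar_step_moments k x.
  set c := alpha * x%:R + lambda in m1 m2.
  have i3 := rintegrableZ (2 * c) i1.
  have i4 := rintegrableB i2 i3.
  have i5 := rintegrableD i4 (rintegrable_cst P (c ^+ 2)).
  transitivity (mean P (fun w => (inar_step k x w)%:R ^+ 2 -
      2 * c * (inar_step k x w)%:R + c ^+ 2))%:E.
    rewrite -EFin_mean//; apply: eq_integral => w _; congr EFin.
    by rewrite /c; ring.
  rewrite meanD// ?mean_cst ?meanB ?meanZ ?m1 ?m2//; last exact: rintegrable_cst.
  by congr EFin; rewrite /v; ring.
have icM : rintegrable P (fun w => cos (f w) * M k w ^+ 2).
  exact: rintegrable_cosM.
have ac : adapted k (fun w => cos (f w)) by move=> w w' h; rewrite (af w w' h).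
have [icv e] := @markov_property k (fun w => cos (f w))
  (fun x y => (y%:R - alpha * x%:R - lambda) ^+ 2) v ac (fun _ _ => sqr_ge0 _) hm icM.
have ic : rintegrable P (fun w => cos (f w)).
  by apply: (@rintegrable_bounded _ _ _ _ 1) => [|w]; [exact: measurable_cos|exact: cos_max].
have icS : rintegrable P (fun w => cos (f w) * S k w) by exact: rintegrable_cosM.
have -> : (fun w => cos (f w) * (M k w ^+ 2 - lambda * (1 + alpha))) =
    (fun w => cos (f w) * M k w ^+ 2 - lambda * (1 + alpha) * cos (f w)).
  by apply/funext => w; ring.
have ic2 := rintegrableZ (lambda * (1 + alpha)) ic.
rewrite meanB// [X in X - _]e meanZ//.
have -> : (fun w => cos (f w) * v (X k w)) = (fun w =>
    alpha * (1 - alpha) * (cos (f w) * S k w) + lambda * (1 + alpha) * cos (f w)).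
  by apply/funext => w; rewrite /v /S; field.
by rewrite meanD// ?meanZ//; [ring|exact: rintegrableZ].
Qed.

Lemma adapted_wsum b k l : (l <= k)%N -> adapted k (wsum b M l).
Proof.
move=> lk w w' h; rewrite /wsum; apply: eq_bigr => i _.
by rewrite (adapted_diff (leq_trans (ltn_ord i) lk) h).
Qed.

(** The autoregression [S_(k+1) = alpha S_k + M_k] contracts the correlation of
    [S_k] with a function of the past, while each step perturbs the weighted
    sum by [O(beta)]. *)
Lemma inar_centered_decorrelation : exists2 D, 0 <= D & forall b beta,
  (forall k, `|b k| <= beta) -> forall k ph,
  `|mean P (fun w => cos (wsum b M k w + ph) * S k w)| <= D * beta.
Proof.
have [C C0 hC] := inar_moments.
pose C' := 2 + 2 * C.
have C'0 : 0 <= C' by rewrite /C'; lra.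
exists (C' / (1 - alpha)); first by rewrite divr_ge0// ltW.
move=> b beta bbeta k ph.
have beta0 : 0 <= beta by rewrite (le_trans _ (bbeta 0))// normr_ge0.
have mU k' : measurable_fun setT (fun w => wsum b M k' w + ph).
  by apply: measurable_funD => //; exact: measurable_wsum.
elim: k => [|k ih].
  rewrite (@eq_mean _ _ _ _ _ (fun w => cos ph * S 0 w)); last first.
    by move=> w; rewrite wsum0 add0r.
  rewrite meanZ// /S meanB ?mean_cst ?inar_mean ?subrr ?mulr0 ?normr0//.
    by rewrite mulr_ge0// divr_ge0// ltW.
  exact: rintegrable_cst.
pose c w := cos (wsum b M k w + ph).
have icS' : rintegrable P (fun w => c w * S k.+1 w) by exact: rintegrable_cosM.
have icS1 : rintegrable P (fun w => cos (wsum b M k.+1 w + ph) * S k.+1 w).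
  exact: rintegrable_cosM.
have main : mean P (fun w => c w * S k.+1 w) = alpha * mean P (fun w => c w * S k w).
  have icS : rintegrable P (fun w => c w * S k w) by exact: rintegrable_cosM.
  have icM : rintegrable P (fun w => c w * M k w) by exact: rintegrable_cosM.
  rewrite (@eq_mean _ _ _ _ _ (fun w => alpha * (c w * S k w) + c w * M k w)).
    rewrite meanD ?meanZ//; last exact: rintegrableZ.
    rewrite (@inar_diff_centered k (fun w => wsum b M k w + ph)) ?addr0//.
    by move=> w w' h; rewrite (adapted_wsum b (leqnn k) h).
  by move=> w; rewrite inar_centeredS; ring.
have [_ mS4 _ _] := hC k.+1; have [_ _ _ mM4] := hC k.
have i4 := rintegrableD (iS4 k.+1) (iM4 k).
have i24 := rintegrableD (rintegrable_cst P 2) i4.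
have diff : `|mean P (fun w => cos (wsum b M k.+1 w + ph) * S k.+1 w) -
    mean P (fun w => c w * S k.+1 w)| <= C' * beta.
  rewrite -meanB//.
  apply: (@le_trans _ _ (mean P (fun w => beta * (2 + (S k.+1 w ^+ 4 + M k w ^+ 4))))).
    apply: norm_mean_le.
    - exact: (rintegrable_measurable (rintegrableB icS1 icS')).
    - exact: rintegrableZ.
    move=> w; rewrite -mulrBl normrM.
    have h1 : `|cos (wsum b M k.+1 w + ph) - c w| <= beta * `|M k w|.
      rewrite wsumS addrAC (le_trans (norm_cosD_le _ _))// normrM.
      by rewrite ler_wpM2r.
    rewrite (le_trans (ler_wpM2r (normr_ge0 _) h1))// -mulrA ler_wpM2l//.
    have e4 (x : R) : x ^+ 4 = `|x| ^+ 2 ^+ 2.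
      by rewrite -exprM -normrX ger0_norm// exprn_even_ge0.
    rewrite !e4; set x := `|M k w|; set y := `|S k.+1 w|.
    have := sqr_ge0 (x ^+ 2 - 1); have := sqr_ge0 (y ^+ 2 - 1).
    have := sqr_ge0 (x - y); have := sqr_ge0 (x ^+ 2); have := sqr_ge0 (y ^+ 2).
    by rewrite !sqrrB; lra.
  rewrite meanZ// meanD// ?mean_cst ?meanD//; last exact: rintegrable_cst.
  by rewrite mulrC ler_wpM2r// /C'; lra.
set a := mean P (fun w => cos _ * _) in diff *.
rewrite main in diff.
have -> : a = (a - alpha * mean P (fun w => c w * S k w)) +
  alpha * mean P (fun w => c w * S k w) by rewrite subrK.
rewrite (le_trans (ler_normD _ _))//.
have h2 : `|alpha * mean P (fun w => c w * S k w)| <= alpha * (C' / (1 - alpha) * beta).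
  by rewrite normrM (gtr0_norm alpha0) ler_pM2l.
rewrite (le_trans (lerD diff h2))// le_eqVlt; apply/orP; left; apply/eqP.
by field.
Qed.
End inar_theory.

(** * Finite-dimensional distributions of Brownian motion *)

Section grid_sums.
Context {R : realType}.
Variables (K : nat) (th : nat -> R) (a : nat -> nat).

(** The weights with which the summands enter a linear combination of partial
    sums. *)
Definition grid_weight k : R := \sum_(i < K) (if (k < a i)%N then th i else 0).

Lemma grid_weight_le k : `|grid_weight k| <= \sum_(i < K) `|th i|.
Proof.
rewrite (le_trans (ler_norm_sum _ _ _))//; apply: ler_sum => i _.
by case: ifP => // _; rewrite normr0.
Qed.

Lemma sum_if_ltn L p (x : R) : (p <= L)%N ->
  \sum_(k < L) (if (k < p)%N then x else 0) = x * p%:R.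
Proof.
move=> pL; rewrite -(big_mkord xpredT (fun k => if (k < p)%N then x else 0)).
rewrite (big_cat_nat (n := p))//= [X in _ + X]big1_seq ?addr0; last first.
  by move=> k /=; rewrite mem_index_iota => /andP[pk _]; rewrite ltnNge pk.
rewrite (eq_big_nat _ _ (F2 := fun=> x)); last by move=> k /andP[_ ->].
by rewrite big_const_nat subn0 iter_addr_0 mulr_natr.
Qed.

Lemma wsum_grid d (T : measurableType d) (M : nat -> T -> R) L w :
  (forall i, (i < K)%N -> a i <= L)%N ->
  \sum_(i < K) th i * psum M (a i) w = wsum grid_weight M L w.
Proof.
move=> aL; rewrite /wsum.
under [RHS]eq_bigr do rewrite mulr_suml.
rewrite exchange_big/=; apply: eq_bigr => i _.
rewrite /psum mulr_sumr.
rewrite -(big_mkord xpredT (fun k => th i * M k w)).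
rewrite -(big_mkord xpredT (fun k => (if (k < a i)%N then th i else 0) * M k w)).
rewrite [RHS](big_cat_nat (n := a i))//=; last exact: aL.
rewrite [X in _ + X]big1_seq ?addr0; last first.
  by move=> k /=; rewrite mem_index_iota => /andP[ak _]; rewrite ltnNge ak mul0r.
by apply: eq_big_nat => k /andP[_ ->].
Qed.

Lemma grid_weight_sqr L : (forall i, (i < K)%N -> a i <= L)%N ->
  \sum_(k < L) grid_weight k ^+ 2 =
  \sum_(i < K) \sum_(j < K) th i * th j * (minn (a i) (a j))%:R.
Proof.
move=> aL.
transitivity (\sum_(k < L) \sum_(i < K) \sum_(j < K)
    (if (k < minn (a i) (a j))%N then th i * th j else 0)).
  apply: eq_bigr => k _; rewrite expr2 mulr_suml; apply: eq_bigr => i _.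
  rewrite mulr_sumr; apply: eq_bigr => j _; rewrite leq_min.
  by do 2 case: ltnP => _; rewrite ?mulr0 ?mul0r.
rewrite exchange_big/=; apply: eq_bigr => i _.
rewrite exchange_big/=; apply: eq_bigr => j _.
by rewrite sum_if_ltn// geq_min aL.
Qed.

End grid_sums.

Section brownian.
Context {d} {T : measurableType d} {R : realType}.
Variables (P : probability T R) (B : T -> skorokhod R).
Hypothesis bmB : standard_brownian_motion P B.

Let mB t : measurable_fun setT (fun w => B w t). Proof. by case: bmB. Qed.

Section mesh.
Variable n : nat.
Hypothesis n0 : (0 < n)%N.

Let r : R := Num.sqrt n%:R.
Let nR0 : 0 < n%:R :> R. Proof. by rewrite ltr0n. Qed.
Let r0 : 0 < r. Proof. by rewrite sqrtr_gt0. Qed.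
Let r2 : r ^+ 2 = n%:R. Proof. by rewrite sqr_sqrtr// ltW. Qed.

Definition bm_time (k : nat) : R := k%:R / n%:R.
(** Increments over the mesh [1/n], rescaled to be standard normal. *)
Definition bm_diff k w : R := r * (B w (bm_time k.+1) - B w (bm_time k)).

Let incr k w : R := B w (bm_time k.+1) - B w (bm_time k).

Let mincr k : measurable_fun setT (incr k).
Proof. exact: measurable_funB. Qed.

Let mdiff k : measurable_fun setT (bm_diff k).
Proof. by apply: measurable_funM; [exact: measurable_cst|exact: mincr]. Qed.

Let bm_time_ge0 k : 0 <= bm_time k. Proof. by rewrite divr_ge0. Qed.

Let bm_time_lt k : bm_time k < bm_time k.+1.
Proof. by rewrite ltr_pM2r ?invr_gt0// ltr_nat. Qed.

Lemma bm_diff_psum k w : psum bm_diff k w = r * (B w (bm_time k) - B w 0).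
Proof.
rewrite /psum -mulr_sumr; congr (_ * _).
rewrite -(big_mkord xpredT (fun k => B w (bm_time k.+1) - B w (bm_time k))).
by rewrite (@telescope_sumr _ 0 k (fun k => B w (bm_time k)))// /bm_time mul0r.
Qed.

Let indep_incr : mutual_independence P incr.
Proof.
case: bmB => _ _ h _ _; apply: h => //.
by apply/nondecreasing_seqP => k; rewrite ltW.
Qed.

Let law_incr k A : measurable A ->
  P [set w | A (incr k w)] = normal_prob 0 r^-1 A.
Proof.
case: bmB => _ _ _ h _ mA.
have -> : r^-1 = Num.sqrt (bm_time k.+1 - bm_time k).
  rewrite /bm_time -mulrBl -natr1 [k%:R + 1]addrC addrK mul1r.
  by rewrite sqrtrV// ltW.
by apply: h => //; rewrite bm_time_ge0 bm_time_lt.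
Qed.

Let rV0 : 0 < r^-1. Proof. by rewrite invr_gt0. Qed.

Lemma bm_diff_moments k :
  [/\ rintegrable P (bm_diff k), mean P (bm_diff k) = 0,
      rintegrable P (fun w => bm_diff k w ^+ 2) &
      mean P (fun w => bm_diff k w ^+ 2) = 1] /\
  rintegrable P (fun w => bm_diff k w ^+ 4) /\
  mean P (fun w => bm_diff k w ^+ 4) <= 64.
Proof.
have [i1 m1] := normal_mean (mincr k) rV0 (@law_incr k).
have [i2 m2] := normal_moment2 (mincr k) rV0 (@law_incr k).
have [i4 m4] := normal_moment4 (mincr k) rV0 (@law_incr k).
have r40 : 0 < r ^+ 4 by rewrite exprn_gt0.
have e p : (fun w => bm_diff k w ^+ p) = (fun w => r ^+ p * incr k w ^+ p).
  by apply/funext => w; rewrite /bm_diff exprMn.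
split; [split|split].
- exact: rintegrableZ.
- by rewrite meanZ// m1 mulr0.
- by rewrite e; exact: rintegrableZ.
- by rewrite e meanZ// m2 exprVn mulfV// gt_eqF// exprn_gt0.
- by rewrite e; exact: rintegrableZ.
- rewrite e meanZ//.
  rewrite (@le_trans _ _ (r ^+ 4 * (64 * r^-1 ^+ 4)))//; first by rewrite ler_pM2l.
  by rewrite exprVn mulrCA mulfV ?mulr1// gt_eqF.
Qed.

Let bm_diff_indep b k (g : R -> R) : measurable_fun setT g ->
  independent2 P (wsum b bm_diff k) (g \o bm_diff k).
Proof.
move=> mg.
pose J1 : set nat := [set l | (l < k)%N]; pose J2 : set nat := [set k].
apply: (@independent2_sigma_events _ _ _ P _ _ _ incr mincr J1 J2) => //.
- by move=> l lk /= e; rewrite /J1/= e ltnn in lk.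
- apply: (@measurable_sum _ (sigma_events incr J1) _ setT _ (index_enum 'I_k)
    (fun (l : 'I_k) w => b l * bm_diff l w)) => l.
  apply: measurable_funM; first exact: measurable_cst.
  apply: measurable_funM; first exact: measurable_cst.
  exact: (@sigma_events_coord _ _ _ _ _ incr J1 l (ltn_ord l)).
- apply: (@measurableT_comp _ _ _ (sigma_events incr J2) _ _ g) => //.
  apply: measurable_funM; first exact: measurable_cst.
  exact: (@sigma_events_coord _ _ _ _ _ incr J2 k erefl).
Qed.

Let mcosD ph : measurable_fun setT (fun x : R => cos (x + ph)).
Proof. by apply: measurable_cos; exact: measurable_funD. Qed.

Let icos b k ph : rintegrable P (fun w => cos (wsum b bm_diff k w + ph)).
Proof.
apply: (@rintegrable_bounded _ _ _ _ 1) => [|w]; last exact: cos_max.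
exact: measurable_cos_wsum.
Qed.

Lemma bm_lindeberg (b : nat -> R) (beta : R) : beta <= 1 ->
  (forall k, `|b k| <= beta) -> forall p ph,
  `|mean P (fun w => cos (wsum b bm_diff p w + ph)) -
    expR (- (1 / 2 * \sum_(k < p) b k ^+ 2)) * cos ph| <=
  p%:R * (66 * beta ^+ 3).
Proof.
move=> beta1 bbeta p ph.
have -> : 66 = 0 / 2 + 1 + 64 + 1 ^+ 2 :> R by field.
apply: lindeberg_cos => //.
- by move=> k; have [_ []] := bm_diff_moments k.
- by move=> k; have [_ []] := bm_diff_moments k.
- move=> k ph'; have [[i1 m1 _ _] _] := bm_diff_moments k.
  have UV := independent2_comp (mcosD ph') (@measurable_id _ _ setT)
    (bm_diff_indep b k (@measurable_id _ _ setT)).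
  by have [_ ->] := independent2_meanM (icos b k ph') i1 UV; rewrite m1 mulr0.
- move=> k ph'; have [[_ _ i2 m2] _] := bm_diff_moments k.
  have mg : measurable_fun setT (fun x : R => x ^+ 2 - 1).
    by apply: measurable_funB => //; exact: exprn_measurable.
  have UV := independent2_comp (mcosD ph') (@measurable_id _ _ setT)
    (bm_diff_indep b k mg).
  have iV := rintegrableB i2 (rintegrable_cst P 1).
  have [_ ->] := independent2_meanM (icos b k ph') iV UV.
  rewrite mul0r meanB ?mean_cst ?m2 ?subrr ?mulr0 ?normr0//.
  exact: rintegrable_cst.
Qed.

End mesh.

(** The joint characteristic function of a Brownian motion is computed by the
    same telescoping as for the process of the theorem, on finer and finer
    meshes. *)
Lemma bm_cos (m K : nat) (th : nat -> R) (ph : R) : (0 < m)%N ->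
  mean P (fun w => cos (\sum_(i < K) th i * B w (i%:R / m%:R) + ph)) =
  expR (- (1 / 2 * \sum_(i < K) \sum_(j < K) th i * th j * ((minn i j)%:R / m%:R))) *
  cos ph.
Proof.
move=> m0; apply/eqP; rewrite -subr_eq0 -normr_le0; apply/ler_addgt0Pr => e e0.
rewrite add0r.
pose Th := \sum_(i < K) `|th i|.
have Th0 : 0 <= Th by rewrite sumr_ge0.
(* [A <= sqrt n] makes the weights [Th / sqrt n] at most 1 and the error of the
   telescoping at most [e] *)
pose A := Th + K%:R * (66 * Th ^+ 3) / e.
have A0 : 0 <= A by rewrite addr_ge0// divr_ge0 ?(ltW e0)// !mulr_ge0// exprn_ge0.
pose N := (Num.truncn (A ^+ 2)).+1.
pose n := (m * N)%N.
have n0 : (0 < n)%N by rewrite muln_gt0 m0.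
pose r : R := Num.sqrt n%:R.
have r0 : 0 < r by rewrite sqrtr_gt0 ltr0n.
have r2 : r ^+ 2 = n%:R by rewrite sqr_sqrtr.
have Ar : A <= r.
  rewrite -(@ler_pXn2r _ 2) ?nnegrE ?(ltW r0)// r2.
  rewrite (le_trans (ltW (truncnS_gt _)))// ler_nat -/N /n.
  by rewrite leq_pmull.
pose a i := (N * i)%N.
pose th' i := th i / r.
have time i : bm_time n (a i) = i%:R / m%:R.
  rewrite /bm_time /a /n !natrM; field.
  by rewrite !pnatr_eq0 -!lt0n m0.
have aL i : (i < K)%N -> (a i <= N * K)%N by move=> iK; rewrite leq_mul2l ltnW ?orbT.
have e1 : mean P (fun w => cos (\sum_(i < K) th i * B w (i%:R / m%:R) + ph)) =
    mean P (fun w => cos (wsum (grid_weight K th' a) (bm_diff n) (N * K) w + ph)).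
  rewrite /mean /Rintegral; congr fine; apply: ae_eq_integral => //.
  - apply/measurable_EFinP/measurable_cos/measurable_funD => //.
    by apply: measurable_sum => i; apply: measurable_funM.
  - apply/measurable_EFinP/measurable_cos_wsum => k.
    by apply: measurable_funM => //; exact: measurable_funB.
  case: bmB => _ B0 _ _ _; apply: filterS B0 => w B0w _ /=.
  rewrite -wsum_grid//; congr (cos (_ + _))%:E; apply: eq_bigr => i _.
  by rewrite bm_diff_psum time B0w subr0 /th' -/r mulrA divfK// gt_eqF.
rewrite e1.
have bb k : `|grid_weight K th' a k| <= Th / r.
  rewrite (le_trans (grid_weight_le _ _ _ _))// /Th mulr_suml; apply: ler_sum => i _.
  by rewrite /th' normrM normfV (gtr0_norm r0).
have ThA : Th <= A by rewrite lerDl divr_ge0 ?(ltW e0)// !mulr_ge0// exprn_ge0.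
have b1 : Th / r <= 1 by rewrite ler_pdivrMr// mul1r (le_trans ThA).
have := bm_lindeberg n0 b1 bb (N * K) ph.
rewrite grid_weight_sqr//.
have -> : \sum_(i < K) \sum_(j < K) th' i * th' j * (minn (a i) (a j))%:R =
  \sum_(i < K) \sum_(j < K) th i * th j * ((minn i j)%:R / m%:R).
  apply: eq_bigr => i _; apply: eq_bigr => j _.
  rewrite /a -minnMr natrM /th'.
  have -> : th i / r * (th j / r) = th i * th j / n%:R.
    by rewrite -r2; field; rewrite gt_eqF.
  by rewrite /n natrM; field; rewrite !pnatr_eq0 -!lt0n m0.
move/le_trans; apply.
have -> : (N * K)%:R * (66 * (Th / r) ^+ 3) =
    N%:R / r ^+ 2 * (K%:R * (66 * Th ^+ 3)) / r.
  by rewrite natrM; field; rewrite gt_eqF.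
rewrite ler_pdivrMr//.
have c0 : 0 <= K%:R * (66 * Th ^+ 3) by rewrite !mulr_ge0// exprn_ge0.
rewrite (@le_trans _ _ (K%:R * (66 * Th ^+ 3)))//.
  rewrite ler_piMl// r2 ler_pdivrMr ?ltr0n// mul1r ler_nat /n.
  by rewrite leq_pmull.
by rewrite [leRHS]mulrC -ler_pdivrMr// (le_trans _ Ar)// /A lerDr.
Qed.

Lemma bm_moment2 t : 0 <= t -> rintegrable P (fun w => B w t ^+ 2).
Proof.
move=> t0.
have i1 : rintegrable P (fun w => (B w t - B w 0) ^+ 2).
  move: t0; rewrite le_eqVlt => /orP[/eqP <-|t0].
    under eq_fun do rewrite subrr; exact: rintegrable_cst.
  have s0 : 0 < Num.sqrt (t - 0) by rewrite sqrtr_gt0 subr0.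
  have lawB A : measurable A -> P [set w | A (B w t - B w 0)] =
      normal_prob 0 (Num.sqrt (t - 0)) A.
    by case: bmB => _ _ _ h _; apply: h; rewrite lexx.
  by have [] := normal_moment2 (measurable_funB (mB t) (mB 0)) s0 lawB.
have mB2 : measurable_fun setT (fun w => B w t ^+ 2).
  exact: (measurableT_comp (exprn_measurable 2) (mB t)).
have mB2' : measurable_fun setT (fun w => (B w t - B w 0) ^+ 2).
  exact: rintegrable_measurable i1.
have e : (\int[P]_w (B w t ^+ 2)%:E = (mean P (fun w => (B w t - B w 0) ^+ 2))%:E)%E.
  rewrite -EFin_mean//; apply: ae_eq_integral => //.
  - exact/measurable_EFinP.
  - exact/measurable_EFinP.
  case: bmB => _ B0 _ _ _; apply: filterS B0 => w B0w _ /=.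
  by rewrite B0w subr0.
by have [] := ge0_rintegrable mB2 (fun=> sqr_ge0 _) e.
Qed.

End brownian.

(** * A criterion for weak convergence in the Skorokhod space *)

Section lipschitz_functionals.
Context {d} {T : measurableType d} {R : realType}.
Variable P : probability T R.
Variables (K : nat).
Implicit Types (Z : T -> nat -> R) (g : (nat -> R) -> R).

Lemma trig_poly_measurable Z t : (forall i, measurable_fun setT (Z ^~ i)) ->
  trig_poly K t -> measurable_fun setT (fun w => t (Z w)).
Proof.
move=> mZ; elim=> [th ph|g h _ mg _ mh|c g _ mg].
- apply/measurable_cos/measurable_funD => //.
  by apply: measurable_sum => i; apply: measurable_funM.
- exact: measurable_funD.
- exact: measurable_funM.
Qed.

Lemma trig_poly_bounded t : @trig_poly R K t -> exists M, forall v, `|t v| <= M.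
Proof.
elim=> [th ph|g h _ [M1 h1] _ [M2 h2]|c g _ [M h]].
- by exists 1 => v; exact: cos_max.
- by exists (M1 + M2) => v; rewrite (le_trans (ler_normD _ _))// lerD.
- by exists (`|c| * M) => v; rewrite normrM ler_wpM2l.
Qed.

Lemma trig_poly_rintegrable Z t : (forall i, measurable_fun setT (Z ^~ i)) ->
  trig_poly K t -> rintegrable P (fun w => t (Z w)).
Proof.
move=> mZ tt; have [M hM] := trig_poly_bounded tt.
by apply: (@rintegrable_bounded _ _ _ _ M) => //; exact: trig_poly_measurable.
Qed.

Lemma lipschitz_measurable Z g (L : R) : 0 <= L -> lipschitz_coords K L g ->
  (forall i, measurable_fun setT (Z ^~ i)) -> measurable_fun setT (fun w => g (Z w)).
Proof.
move=> L0 gL mZ.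
have A0 j : 0 < j.+1%:R :> R by rewrite ltr0n.
pose t j := sval (cid2 (trig_approx L0 (A0 j) gL)).
have tt j : trig_poly K (t j) by rewrite /t; case: cid2.
have tg j v : `|g v - t j v| <= L * \sum_(i < K) ((v i ^+ 2 + 2) / j.+1%:R).
  by rewrite /t; case: cid2.
apply: (measurable_fun_cvg (h := fun j w => t j (Z w))) => [j|w _].
  exact: trig_poly_measurable.
apply/cvgrPdist_le => e e0.
pose c := L * \sum_(i < K) (Z w i ^+ 2 + 2).
have c0 : 0 <= c.
  by rewrite mulr_ge0// sumr_ge0// => i _; rewrite addr_ge0// sqr_ge0.
near=> j; rewrite (le_trans (tg j _))// -mulr_suml mulrA -/c ler_pdivrMr//.
rewrite mulrC -ler_pdivrMr// (le_trans (ltW (truncnS_gt _)))// ler_nat ltnS.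
by near: j; exact: nbhs_infty_ge.
Unshelve. all: by end_near. Qed.

End lipschitz_functionals.

Section continuity_theorem.
Context {d d'} {T : measurableType d} {T' : measurableType d'} {R : realType}.
Variables (P : probability T R) (P' : probability T' R).
Variables (K : nat) (Z : nat -> T -> nat -> R) (Y : T' -> nat -> R) (C : R).
Hypothesis mZ : forall n i, measurable_fun setT (Z n ^~ i).
Hypothesis mY : forall i, measurable_fun setT (Y ^~ i).
Hypothesis C0 : 0 <= C.
Hypothesis Z2 : forall n i, (i < K)%N -> rintegrable P (fun w => Z n w i ^+ 2) /\
  mean P (fun w => Z n w i ^+ 2) <= C.
Hypothesis Y2 : forall i, (i < K)%N -> rintegrable P' (fun w => Y w i ^+ 2) /\
  mean P' (fun w => Y w i ^+ 2) <= C.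
Hypothesis cos_cvg : forall (th : nat -> R) (ph : R),
  mean P (fun w => cos (\sum_(i < K) th i * Z n w i + ph)) @[n --> \oo] -->
  mean P' (fun w => cos (\sum_(i < K) th i * Y w i + ph)).

Lemma trig_mean_cvg t : trig_poly K t ->
  mean P (fun w => t (Z n w)) @[n --> \oo] --> mean P' (fun w => t (Y w)).
Proof.
elim=> [th ph|g h tg ig th ih|c g tg ig]; first exact: cos_cvg.
- rewrite (meanD (trig_poly_rintegrable P' mY tg) (trig_poly_rintegrable P' mY th)).
  under eq_fun do rewrite (meanD (trig_poly_rintegrable P (mZ _) tg)
    (trig_poly_rintegrable P (mZ _) th)).
  exact: cvgD.
- rewrite (meanZ _ (trig_poly_rintegrable P' mY tg)).
  under eq_fun do rewrite (meanZ _ (trig_poly_rintegrable P (mZ _) tg)).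
  by apply: cvgM => //; exact: cvg_cst.
Qed.

Let approx_mean d0 (T0 : measurableType d0) (Q : probability T0 R)
    (W : T0 -> nat -> R) g t (M L A : R) : 0 <= L -> 0 < A ->
  (forall i, measurable_fun setT (W ^~ i)) ->
  (forall i, (i < K)%N -> rintegrable Q (fun w => W w i ^+ 2) /\
    mean Q (fun w => W w i ^+ 2) <= C) ->
  lipschitz_coords K L g -> (forall v, `|g v| <= M) ->
  trig_poly K t ->
  (forall v, `|g v - t v| <= L * \sum_(i < K) ((v i ^+ 2 + 2) / A)) ->
  `|mean Q (fun w => g (W w)) - mean Q (fun w => t (W w))| <=
  L * (K%:R * ((C + 2) / A)).
Proof.
move=> L0 A0 mW W2 gL gM tt tg.
have mg := lipschitz_measurable L0 gL mW.
have ig : rintegrable Q (fun w => g (W w)) by exact: rintegrable_bounded mg (fun w => gM _).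
have it := trig_poly_rintegrable Q mW tt.
have h n : (n <= K)%N ->
    rintegrable Q (fun w => \sum_(i < n) ((W w i ^+ 2 + 2) / A)) /\
    mean Q (fun w => \sum_(i < n) ((W w i ^+ 2 + 2) / A)) <= n%:R * ((C + 2) / A).
  elim: n => [_|n ih nK].
    have -> : (fun w => \sum_(i < 0) ((W w i ^+ 2 + 2) / A)) = (fun=> 0).
      by apply/funext => w; rewrite big_ord0.
    by rewrite mean_cst mul0r; split=> //; exact: rintegrable_cst.
  have [i1 m1] := ih (ltnW nK); have [iW mW2] := W2 n nK.
  have i3 := rintegrableD iW (rintegrable_cst Q 2).
  have i4 := rintegrableZ A^-1 i3.
  have -> : (fun w => \sum_(i < n.+1) ((W w i ^+ 2 + 2) / A)) =
      (fun w => \sum_(i < n) ((W w i ^+ 2 + 2) / A) + A^-1 * (W w n ^+ 2 + 2)).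
    by apply/funext => w; rewrite big_ord_recr/= [_ / A]mulrC.
  split; first exact: rintegrableD.
  rewrite meanD// -[n.+1%:R]natr1 mulrDl [1 * _]mul1r lerD// meanZ//.
  rewrite mulrC ler_pM2r ?invr_gt0//.
  by rewrite meanD// ?mean_cst ?lerD2r//; exact: rintegrable_cst.
have [isum msum] := h K (leqnn K).
rewrite -meanB//.
apply: (@le_trans _ _ (mean Q (fun w => L * \sum_(i < K) ((W w i ^+ 2 + 2) / A)))).
  apply: norm_mean_le => //; last exact: rintegrableZ.
  exact: (rintegrable_measurable (rintegrableB ig it)).
by rewrite meanZ// ler_wpM2l.
Qed.

(** Levy's continuity theorem for Lipschitz test functions: a Lipschitz function
    is a trigonometric polynomial up to an error controlled by the second
    moments. *)
Lemma lipschitz_mean_cvg g (L M : R) : 0 <= L -> lipschitz_coords K L g ->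
  (forall v, `|g v| <= M) ->
  mean P (fun w => g (Z n w)) @[n --> \oo] --> mean P' (fun w => g (Y w)).
Proof.
move=> L0 gL gM; apply/cvgrPdist_le => e e0.
pose c := L * (K%:R * (C + 2)).
have c0 : 0 <= c by rewrite !mulr_ge0// addr_ge0.
pose A := 3 * (c + 1) / e.
have A0 : 0 < A by rewrite divr_gt0// mulr_gt0// ltr_wpDl.
have cA : L * (K%:R * ((C + 2) / A)) <= e / 3.
  have -> : L * (K%:R * ((C + 2) / A)) = e / 3 * (c / (c + 1)).
    by rewrite /A /c; field; rewrite !gt_eqF// ltr_wpDl.
  rewrite ler_piMr ?divr_ge0 ?(ltW e0)// ler_pdivrMr ?ltr_wpDl// mul1r.
  by rewrite lerDl.
have [t tt tg] := trig_approx L0 A0 gL.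
have h1 := approx_mean L0 A0 mY Y2 gL gM tt tg.
have h2 n := approx_mean L0 A0 (mZ n) (Z2 n) gL gM tt tg.
have e3 : 0 < e / 3 by rewrite divr_gt0.
have /cvgrPdist_le/(_ _ e3) h3 := trig_mean_cvg tt.
near=> n.
have h4 : `|mean P' (fun w => t (Y w)) - mean P (fun w => t (Z n w))| <= e / 3.
  by near: n; exact: h3.
have {}h1 := le_trans h1 cA; have := le_trans (h2 n) cA.
by move: h1 h4; rewrite !ler_norml; lra.
Unshelve. all: by end_near. Qed.

End continuity_theorem.

Section lipschitz_envelope.
Context {R : realType}.
Variables (f : skorokhod R -> R) (M : R).
Hypothesis fM : forall x, `|f x| <= M.
Implicit Types (x y : skorokhod R) (k : nat).

Definition penalized k x : set R := [set z | exists y r, [/\ 0 <= r,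
  forall s, 0 <= s <= k%:R -> `|y s - x s| <= r & z = f y + k%:R * r]].

(** The Lipschitz regularization of [f] from below, for uniform convergence on
    [0, k]. *)
Definition lip_env k x : R := inf (penalized k x).

Let pen_self k x : penalized k x (f x).
Proof.
by exists x, 0; split=> // [s _|]; rewrite ?subrr ?normr0// mulr0 addr0.
Qed.

Let pen_lb k x : lbound (penalized k x) (- M).
Proof.
move=> _ [y [r [r0 _ ->]]]; rewrite ler_wpDr ?mulr_ge0//.
by have := fM y; rewrite ler_norml => /andP[].
Qed.

Lemma lip_env_le k x : lip_env k x <= f x.
Proof. by apply: ge_inf => //; exists (- M). Qed.

Lemma lip_env_bounded k x : `|lip_env k x| <= M.
Proof.
rewrite ler_norml (le_trans (lip_env_le k x)) ?andbT; last first.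
  by have := fM x; rewrite ler_norml => /andP[].
by apply: lb_le_inf => //; exists (f x).
Qed.

Lemma lip_env_lipschitz k x x' (e : R) : 0 <= e ->
  (forall s, 0 <= s <= k%:R -> `|x s - x' s| <= e) ->
  `|lip_env k x - lip_env k x'| <= k%:R * e.
Proof.
move=> e0.
have main (y y' : skorokhod R) : (forall s, 0 <= s <= k%:R -> `|y s - y' s| <= e) ->
    lip_env k y - k%:R * e <= lip_env k y'.
  move=> yy'; apply: lb_le_inf; first by exists (f y').
  move=> _ [z [r [r0 zr ->]]]; rewrite lerBlDr -addrA -mulrDr.
  apply: ge_inf; first by exists (- M).
  exists z, (r + e); split=> //; first exact: addr_ge0.
  move=> s hs; have -> : z s - y s = (z s - y' s) - (y s - y' s) by ring.
  by rewrite (le_trans (ler_normB _ _))// lerD ?zr ?yy'.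
move=> xx'; rewrite ler_norml; apply/andP; split.
  have h : lip_env k x' - k%:R * e <= lip_env k x.
    by apply: main => s hs; rewrite distrC xx'.
  by move: h; lra.
by rewrite lerBlDr -lerBlDl main.
Qed.

(** A path [y] that matters in the infimum is uniformly close to [x] on [0, k]
    once [k] is large, the penalty exceeding the oscillation [2 M] of [f]
    otherwise; then [y] lies in a small Skorokhod ball around [x], with the
    identity as time change, and continuity of [f] applies. *)
Lemma lip_env_cvg x : continuous f -> lip_env k x @[k --> \oo] --> f x.
Proof.
move=> fc; apply/cvgrPdist_le => e e0.
have : nbhs x [set y | `|f x - f y| <= e].
  by have /cvgrPdist_le/(_ _ e0) := fc x.
move=> /nbhs_skorokhodP[N [q [q0 hq]]].
near=> k.
have kN : N <= k%:R.
  apply: (le_trans (ltW (truncnS_gt N))); rewrite ler_nat.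
  by near: k; exact: nbhs_infty_ge.
have kq : 2 * M <= k%:R * (q / 2).
  rewrite -ler_pdivrMr ?divr_gt0//.
  apply: (le_trans (ltW (truncnS_gt _))); rewrite ler_nat.
  by near: k; exact: nbhs_infty_ge.
rewrite ger0_norm ?subr_ge0 ?lip_env_le// lerBlDl -lerBlDr.
apply: lb_le_inf; first by exists (f x).
move=> _ [y [r [r0 yr ->]]].
have [rq|qr] := leP r (q / 2).
  have /hq : skorokhod_ball x N q y.
    exists id, r; split.
    - exact: time_change_id.
    - by rewrite (le_lt_trans rq)// ltr_pdivrMr// ltr_pMr// ltr1n.
    - by move=> s _; rewrite subrr normr0.
    - by move=> s /andP[s0 sN]; apply: yr; rewrite s0 (le_trans sN).
  rewrite /= ler_norml => /andP[_ h].
  by rewrite ler_wpDr ?mulr_ge0//; lra.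
have h1 : k%:R * (q / 2) <= k%:R * r by rewrite ler_wpM2l// ltW.
have := fM x; have := fM y; rewrite !ler_norml => /andP[y1 y2] /andP[x1 x2].
lra.
Unshelve. all: by end_near. Qed.

End lipschitz_envelope.

Section grids.
Context {R : realType}.
Implicit Types (m K : nat) (v : nat -> R) (x : skorokhod R).

Lemma grid_path_neg m K v (t : R) : t < 0 ->
  v (minn (Num.truncn (m%:R * t)) K) = v (minn (Num.truncn (m%:R * 0 : R)) K).
Proof.
move=> t0; rewrite mulr0 truncn0.
have -> // : Num.truncn (m%:R * t) = 0%N.
apply/truncn0Pn; rewrite -ltNge (le_lt_trans _ ltr01)//.
by rewrite mulr_ge0_le0// ltW.
Qed.

(** Freezing the path after [K] steps makes it a function of finitely many
    coordinates of [v]. *)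
Definition grid_path m K v : skorokhod R :=
  Skorokhod (@cadlag_step R (fun i => v (minn i K)) m) (@grid_path_neg m K v).

Definition grid_values m x (i : nat) : R := x (i%:R / m%:R).

(** With [m * m] steps of length [1/m], the path is sampled up to time [m]. *)
Definition grid m x : skorokhod R := grid_path m (m * m) (grid_values m x).

Lemma grid_lipschitz f (M : R) k m K : (forall x, `|f x| <= M) ->
  lipschitz_coords K.+1 k%:R (fun v => lip_env f k (grid_path m K v)).
Proof.
move=> fM v v'; apply: (lip_env_lipschitz fM).
  by rewrite sumr_ge0.
move=> s _ /=.
have jK : (minn (Num.truncn (m%:R * s)) K < K.+1)%N by rewrite ltnS geq_minr.
by rewrite (bigD1 (Ordinal jK))//= lerDl sumr_ge0.
Qed.

Lemma gridE m x s : 0 <= s -> s <= m%:R ->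
  grid m x s = x ((Num.truncn (m%:R * s))%:R / m%:R).
Proof.
move=> s0 sm; rewrite /grid/= /grid_values (minn_idPl _)//.
rewrite -(@ler_nat R) (@le_trans _ _ (m%:R * s)) ?truncn_le ?mulr_ge0//.
by rewrite natrM ler_wpM2l.
Qed.

End grids.

Section random_paths.
Context {d} {T : measurableType d} {R : realType}.
Variables (P : probability T R) (X : T -> skorokhod R) (m_ : nat -> nat).
Variables (f : skorokhod R -> R) (M : R).
Hypothesis fM : forall x, `|f x| <= M.
Hypothesis mX : forall t, measurable_fun setT (fun w => X w t).

Lemma lip_env_grid_measurable k m :
  measurable_fun setT (fun w => lip_env f k (grid m (X w))).
Proof.
apply: (@lipschitz_measurable _ _ _ (m * m).+1 (fun w => grid_values m (X w))
  (fun v => lip_env f k (grid_path m (m * m) v)) k%:R) => //.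
  exact: grid_lipschitz fM.
by move=> i; exact: mX.
Qed.

(** The meshes [1 / m_ j] are a parameter because the path of partial sums of
    rank [n] is recovered exactly by its grid values when the mesh divides
    [1/n]. *)
Definition grid_approximable := forall w (k : nat) (e : R), 0 < e ->
  \forall j \near \oo, forall s, 0 <= s <= k%:R ->
    `|grid (m_ j) (X w) s - X w s| <= e.

Hypothesis gX : grid_approximable.

Lemma lip_env_grid_cvg k w :
  lip_env f k (grid (m_ j) (X w)) @[j --> \oo] --> lip_env f k (X w).
Proof.
apply/cvgrPdist_le => e e0.
have e1 : 0 < e / k.+1%:R by rewrite divr_gt0// ltr0n.
apply: filterS (@gX w k _ e1) => j hj.
rewrite distrC (le_trans (lip_env_lipschitz fM (ltW e1) hj))//.
rewrite mulrCA ler_piMr ?(ltW e0)// ler_pdivrMr ?ltr0n// mul1r ler_nat.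
exact: leqnSn.
Qed.

Lemma lip_env_measurable k : measurable_fun setT (fun w => lip_env f k (X w)).
Proof.
apply: (measurable_fun_cvg (h := fun j w => lip_env f k (grid (m_ j) (X w)))).
  by move=> j; exact: lip_env_grid_measurable.
by move=> w _; exact: lip_env_grid_cvg.
Qed.

Lemma mean_lip_env_grid_cvg k :
  mean P (fun w => lip_env f k (grid (m_ j) (X w))) @[j --> \oo] -->
  mean P (fun w => lip_env f k (X w)).
Proof.
have [] := @mean_dominated _ _ _ P M
  (fun j w => lip_env f k (grid (m_ j) (X w))) (fun w => lip_env f k (X w)) => //.
- by move=> j; exact: lip_env_grid_measurable.
- by move=> j w; exact: lip_env_bounded.
- by move=> w; exact: lip_env_grid_cvg.
Qed.

Hypothesis fc : continuous f.

Lemma continuous_path_functional :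
  measurable_fun setT (fun w => f (X w)) /\
  mean P (fun w => lip_env f k (X w)) @[k --> \oo] --> mean P (fun w => f (X w)).
Proof.
apply: (@mean_dominated _ _ _ P M (fun k w => lip_env f k (X w))).
- by move=> k; exact: lip_env_measurable.
- by move=> k w; exact: lip_env_bounded.
- by move=> w; exact: (lip_env_cvg fM).
Qed.

End random_paths.

Section weak_convergence_criterion.
Context {d d'} {T : measurableType d} {T' : measurableType d'} {R : realType}.
Variables (P : probability T R) (P' : probability T' R).
Variables (X : nat -> T -> skorokhod R) (Y : T' -> skorokhod R).
Hypothesis mX : forall n t, measurable_fun setT (fun w => X n w t).
Hypothesis mY : forall t, measurable_fun setT (fun w => Y w t).
Hypothesis gX : forall n, exists m_, grid_approximable (X n) m_.
Hypothesis gY : grid_approximable Y id.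
Hypothesis moment2 : forall m K, (0 < m)%N -> exists2 C, 0 <= C &
  (forall n i, (i < K)%N -> rintegrable P (fun w => X n w (i%:R / m%:R) ^+ 2) /\
    mean P (fun w => X n w (i%:R / m%:R) ^+ 2) <= C) /\
  (forall i, (i < K)%N -> rintegrable P' (fun w => Y w (i%:R / m%:R) ^+ 2) /\
    mean P' (fun w => Y w (i%:R / m%:R) ^+ 2) <= C).
Hypothesis fdd : forall m K (th : nat -> R) (ph : R), (0 < m)%N ->
  mean P (fun w => cos (\sum_(i < K) th i * X n w (i%:R / m%:R) + ph))
    @[n --> \oo] -->
  mean P' (fun w => cos (\sum_(i < K) th i * Y w (i%:R / m%:R) + ph)).
Hypothesis tight : forall (k : nat) (e h : R), 0 < e -> 0 < h ->
  \forall m \near \oo, \forall n \near \oo, exists A : set T,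
    [/\ measurable A, (P A <= h%:E)%E & forall w, ~ A w ->
      forall s, 0 <= s <= k%:R -> `|grid m (X n w) s - X n w s| <= e].

(** Lower semicontinuity: [f] is bounded below by [lip_env f k], which depends
    on the path only through its grid values up to [k e'] outside a small event
    and has almost the same mean as [f] under the limit law. *)
Let weak_lower f (M e : R) : continuous f -> (forall x, `|f x| <= M) -> 0 < e ->
  \forall n \near \oo, mean P' (fun w => f (Y w)) - e <= mean P (fun w => f (X n w)).
Proof.
move=> fc fM e0.
have M0 : 0 <= M by rewrite (le_trans _ (fM (skorokhod_cst 0))).
have e5 : 0 < e / 5 by rewrite divr_gt0.
have [_ /cvgrPdist_le/(_ _ e5) ck] := continuous_path_functional P' fM mY gY fc.
have [k hk] := filter_ex ck.
have /cvgrPdist_le/(_ _ e5) cm := @mean_lip_env_grid_cvg _ _ _ P' _ _ _ _ fM mY gY k.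
pose e' := e / 5 / k.+1%:R; pose h := e / 5 / (2 * M + 1).
have e'0 : 0 < e' by rewrite divr_gt0// ltr0n.
have M1 : 0 < 2 * M + 1 by rewrite ltr_wpDl// mulr_ge0.
have h0 : 0 < h by rewrite divr_gt0.
have [m [m0 hm tm]] : exists m : nat, [/\ (0 < m)%N,
    `|mean P' (fun w => lip_env f k (Y w)) -
      mean P' (fun w => lip_env f k (grid m (Y w)))| <= e / 5 &
    \forall n \near \oo, exists A : set T,
    [/\ measurable A, (P A <= h%:E)%E & forall w, ~ A w ->
      forall s, 0 <= s <= k%:R -> `|grid m (X n w) s - X n w s| <= e']].
  apply: (@filter_ex _ \oo); near=> m; split.
  - by near: m; exact: nbhs_infty_gt.
  - by near: m; exact: cm.
  - by near: m; exact: tight.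
have [C C0 [X2 Y2]] := moment2 (m * m).+1 m0.
pose g v := lip_env f k (grid_path m (m * m) v).
have gL : lipschitz_coords (m * m).+1 k%:R g by exact: grid_lipschitz fM.
have gM v : `|g v| <= M by exact: lip_env_bounded fM _ _.
have /cvgrPdist_le/(_ _ e5) cn := @lipschitz_mean_cvg _ _ _ _ _ P P' (m * m).+1
  (fun n w => grid_values m (X n w)) (fun w => grid_values m (Y w)) C
  (fun n i => mX n _) (fun i => mY _) C0 X2 Y2 (fun th ph => @fdd m (m * m).+1 th ph m0)
  g k%:R M (ler0n _ _) gL gM.
near=> n.
have hn : `|mean P' (fun w => g (grid_values m (Y w))) -
    mean P (fun w => g (grid_values m (X n w)))| <= e / 5 by near: n; exact: cn.
have [A [mA PA hA]] : exists A : set T,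
    [/\ measurable A, (P A <= h%:E)%E & forall w, ~ A w ->
      forall s, 0 <= s <= k%:R -> `|grid m (X n w) s - X n w s| <= e'].
  by near: n; exact: tm.
have [m_ gXn] := gX n.
have [mf _] := continuous_path_functional P fM (mX n) gXn fc.
have ifX : rintegrable P (fun w => f (X n w)).
  exact: rintegrable_bounded mf (fun w => fM _).
have ig : rintegrable P (fun w => g (grid_values m (X n w))).
  have mg : measurable_fun setT (fun w => g (grid_values m (X n w))).
    exact: (lip_env_grid_measurable fM (mX n)).
  exact: rintegrable_bounded mg (fun w => gM _).
have iA : rintegrable P (fun w => 2 * M * \1_A w).
  exact/rintegrableZ/rintegrable_indic.
have ic := rintegrable_cst P (k%:R * e').
have pw w : g (grid_values m (X n w)) - k%:R * e' - 2 * M * \1_A w <= f (X n w).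
  rewrite indicE; case: (boolP (w \in A)) => [_|/negP wA].
    have := gM (grid_values m (X n w)); have := fM (X n w).
    have : 0 <= k%:R * e' by rewrite mulr_ge0// ltW.
    by rewrite !ler_norml mulr1; lra.
  rewrite mulr0 subr0 (le_trans _ (lip_env_le fM k _))// lerBlDl.
  have nA : ~ A w by move=> Aw; apply: wA; exact/mem_set.
  have := lip_env_lipschitz fM (ltW e'0) (hA w nA).
  rewrite ler_norml -/(grid m (X n w)) => /andP[_].
  by rewrite lerBlDr.
have igc := rintegrableB ig ic.
have := ler_mean (rintegrableB igc iA) ifX pw.
rewrite meanB// meanB// mean_cst meanZ; last exact: rintegrable_indic.
have PA' : mean P \1_A <= h by rewrite -lee_fin mean_indic.
have h1 : 2 * M * mean P \1_A <= e / 5.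
  rewrite (@le_trans _ _ ((2 * M + 1) * h))//; last first.
    by rewrite /h mulrCA mulfV ?mulr1// gt_eqF.
  rewrite ler_pM ?mulr_ge0// ?lerDl//.
  by apply: mean_ge0 => w; rewrite indicE.
have h2 : k%:R * e' <= e / 5.
  rewrite /e' mulrCA ler_piMr ?(ltW e5)// ler_pdivrMr ?ltr0n// mul1r ler_nat.
  exact: leqnSn.
move: hk hm hn; rewrite /= !ler_norml -/(grid m _).
have -> : (fun w => lip_env f k (grid m (Y w))) = (fun w => g (grid_values m (Y w))).
  by [].
by lra.
Unshelve. all: by end_near. Qed.

(** The lower bound on the limit of [E f(X_n)] is applied to [f] and [- f].  The
    hypothesis [tight] replaces compactness in the Skorokhod space: it says that
    the grid values determine the paths up to a small uniform error, with
    probability close to 1. *)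
Lemma weak_cvg_criterion : weak_cvg P X P' Y.
Proof.
move=> f fc [M fM].
have [mfY _] := continuous_path_functional P' fM mY gY fc.
have iY : rintegrable P' (fun w => f (Y w)).
  exact: rintegrable_bounded mfY (fun w => fM _).
have iX n : rintegrable P (fun w => f (X n w)).
  have [m_ gXn] := gX n.
  have [mf _] := continuous_path_functional P fM (mX n) gXn fc.
  exact: rintegrable_bounded mf (fun w => fM _).
rewrite unlock.
under eq_fun do rewrite (EFin_mean (iX _)).
rewrite (EFin_mean iY).
apply: cvg_EFin; first exact: nearW.
apply/cvgrPdist_le => e e0.
have Nfc : continuous (fun x => - f x).
  by move=> x; exact: (@cvgN _ R^o _ _ _ _ _ (fc x)).
have NfM x : `|- f x| <= M by rewrite normrN.
near=> n.
have l1 : mean P' (fun w => f (Y w)) - e <= mean P (fun w => f (X n w)).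
  by near: n; exact: weak_lower fM e0.
have : mean P' (fun w => - f (Y w)) - e <= mean P (fun w => - f (X n w)).
  by near: n; exact: weak_lower NfM e0.
have N d0 (T0 : measurableType d0) (Q : probability T0 R) h :
    rintegrable Q h -> mean Q (fun w => - h w) = - mean Q h.
  move=> ih; rewrite -mulN1r -meanZ//; apply: eq_mean => w.
  by rewrite mulN1r.
rewrite !N// => l2; rewrite /= ler_norml; move: l1 l2; lra.
Unshelve. all: by end_near. Qed.

End weak_convergence_criterion.

(** * Grid approximation of continuous and of partial sum paths *)

Section paths.
Context {R : realType}.

(** Uniform continuity on [0, k], through a covering of this segment. *)
Lemma grid_continuous (y : skorokhod R) (k : nat) (e : R) : continuous y -> 0 < e ->
  \forall j \near \oo, forall s, 0 <= s <= k%:R -> `|grid j y s - y s| <= e.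
Proof.
move=> yc e0.
have near_cov : \forall j \near \oo, `[0, k%:R]%classic `<=` [set s | 0 <= s ->
    `|y ((Num.truncn (j%:R * s))%:R / j%:R) - y s| <= e].
  have /compact_near_coveringP := @segment_compact R 0 k%:R.
  apply => s0; rewrite /= in_itv/= => /andP[s00 _].
  have e2 : 0 < e / 2 by rewrite divr_gt0.
  have /cvgrPdist_le/(_ _ e2)/nbhs_ballP[r /= r0 hr] := yc s0.
  have r2 : 0 < r / 2 by rewrite divr_gt0.
  exists (ball s0 (r / 2), [set j : nat | (Num.truncn (r / 2)^-1 < j)%N]).
    split; first exact: nbhsx_ballx.
    by exists (Num.truncn (r / 2)^-1).+1.
  move=> [s j] /= [sr jr] s0'.
  have j0 : 0 < j%:R :> R by rewrite ltr0n (leq_ltn_trans _ jr).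
  have jr' : j%:R^-1 < r / 2.
    rewrite -[r / 2]invrK ltf_pV2 ?posrE ?invr_gt0//.
    by rewrite (lt_le_trans (truncnS_gt _))// ler_nat.
  have /andP[t1 t2] := truncn_itv (mulr_ge0 (ltW j0) s0').
  set u := _ / j%:R.
  have u1 : u <= s by rewrite /u ler_pdivrMr// [leRHS]mulrC.
  have u2 : s < u + j%:R^-1.
    by rewrite /u -[X in _ + X]mul1r -mulrDl natr1 ltr_pdivlMr// [ltLHS]mulrC.
  have h1 : `|y s0 - y s| <= e / 2.
    apply: hr; apply: lt_le_trans sr _; rewrite ler_pdivrMr// ler_pMr//.
    by rewrite ler1n.
  have h2 : `|y s0 - y u| <= e / 2.
    apply: hr; move: sr; rewrite /ball/= => sr.
    have := ltr_normlW sr; have : - (s0 - s) < r / 2.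
      by apply: ltr_normlW; rewrite normrN.
    rewrite ltr_norml; lra.
  have -> : y u - y s = (y s0 - y s) - (y s0 - y u) by ring.
  by rewrite (le_trans (ler_normB _ _))//; lra.
near=> j.
have jk : (k <= j)%N by near: j; exact: nbhs_infty_ge.
have cov : `[0, k%:R]%classic `<=` [set s | 0 <= s ->
    `|y ((Num.truncn (j%:R * s))%:R / j%:R) - y s| <= e] by near: j; exact: near_cov.
move=> s /andP[s0 sk]; rewrite gridE//; last by rewrite (le_trans sk)// ler_nat.
by apply: cov => //=; rewrite in_itv/= s0.
Unshelve. all: by end_near. Qed.

Lemma truncn_divn (x : R) j : 0 <= x -> (0 < j)%N ->
  Num.truncn ((Num.truncn (j%:R * x))%:R / j%:R : R) = Num.truncn x.
Proof.
move=> x0 j0.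
have jR : 0 < j%:R :> R by rewrite ltr0n.
have /andP[p1 p2] := truncn_itv x0.
have jx0 : 0 <= j%:R * x by rewrite mulr_ge0.
apply: truncn_def; apply/andP; split.
  rewrite ler_pdivlMr// -natrM ler_nat truncn_ge_nat// natrM mulrC.
  by rewrite ler_pM2l.
rewrite ltr_pdivrMr// (le_lt_trans (y := j%:R * x))// ?truncn_le//.
by rewrite mulrC ltr_pM2r.
Qed.

(** The partial sum paths are step functions with jumps at the multiples of
    [1/n], so the grids with mesh [1/(n j)] recover them exactly. *)
Lemma grid_partial_sum (s : nat -> R) n (k : nat) (e : R) : 0 < e ->
  \forall j \near \oo, forall t, 0 <= t <= k%:R ->
    `|grid (n * j) (partial_sum_path s n) t - partial_sum_path s n t| <= e.
Proof.
move=> e0; have [->|n0] := posnP n.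
  near=> j => t _.
  by rewrite /grid/= /grid_values/= /partial_sum_fun !mul0r subrr normr0 ltW.
near=> j => t /andP[t0 tk].
have jk : (k <= j)%N by near: j; exact: nbhs_infty_ge.
have j0 : (0 < j)%N by near: j; exact: nbhs_infty_gt.
rewrite gridE//; last first.
  by rewrite (le_trans tk)// ler_nat (leq_trans jk)// leq_pmull.
rewrite /= /partial_sum_fun.
have -> : n%:R * ((Num.truncn ((n * j)%:R * t))%:R / (n * j)%:R) =
    (Num.truncn (j%:R * (n%:R * t)))%:R / j%:R :> R.
  have -> : (n * j)%:R * t = j%:R * (n%:R * t) by rewrite natrM; ring.
  by rewrite natrM; field; rewrite !pnatr_eq0 -!lt0n n0 j0.
by rewrite truncn_divn ?mulr_ge0// subrr normr0 ltW.
Unshelve. all: by end_near. Qed.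

Lemma truncn_grid n m i : (0 < m)%N ->
  Num.truncn (n%:R * (i%:R / m%:R) : R) = (n * i %/ m)%N.
Proof.
move=> m0; have mR : 0 < m%:R :> R by rewrite ltr0n.
apply: truncn_def; rewrite mulrA -natrM ler_pdivlMr// ltr_pdivrMr// -!natrM.
by rewrite ler_nat ltr_nat leq_divM/= ltn_ceil.
Qed.

End paths.

(** * The scaled partial sums of the INAR process *)

Lemma sqrt_natV_cvg (R : realType) : (Num.sqrt n%:R)^-1 @[n --> \oo] --> (0 : R).
Proof.
apply/cvgrPdist_le => e e0; near=> n.
rewrite sub0r normrN ger0_norm ?invr_ge0 ?sqrtr_ge0//.
have n0 : 0 < n%:R :> R by rewrite ltr0n; near: n; exact: nbhs_infty_gt.
have eV0 : 0 <= e^-1 by rewrite invr_ge0 ltW.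
rewrite invf_ple ?posrE ?sqrtr_gt0// -(ger0_norm eV0) -sqrtr_sqr ler_wsqrtr//.
by near: n; exact: nbhs_infty_ger.
Unshelve. all: by end_near. Qed.

Lemma divn_natV_cvg (R : realType) (q m : nat) : (0 < m)%N ->
  ((n * q) %/ m)%:R / n%:R @[n --> \oo] --> (q%:R / m%:R : R).
Proof.
move=> m0; have mR : 0 < m%:R :> R by rewrite ltr0n.
apply/cvgrPdist_le => e e0; near=> n.
have n0 : 0 < n%:R :> R by rewrite ltr0n; near: n; exact: nbhs_infty_gt.
have en : e^-1 <= n%:R by near: n; exact: nbhs_infty_ger.
have en1 : 1 <= e * n%:R by rewrite -ler_pdivrMl// mulr1.
have h1 : ((n * q) %/ m)%:R * m%:R <= n%:R * q%:R :> R.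
  by rewrite -!natrM ler_nat leq_divM.
have h2 : n%:R * q%:R < ((n * q) %/ m)%:R * m%:R + m%:R :> R.
  by rewrite -!natrM -natrD ltr_nat addnC -mulSn ltn_ceil.
set a : R := ((n * q) %/ m)%:R in h1 h2 *.
have -> : q%:R / m%:R - a / n%:R = (n%:R * q%:R - a * m%:R) / (m%:R * n%:R).
  by field; rewrite !gt_eqF.
rewrite ger0_norm; last by rewrite divr_ge0// ?subr_ge0// mulr_ge0// ltW.
rewrite ler_pdivrMr ?mulr_gt0//.
have : m%:R <= e * (m%:R * n%:R) by rewrite mulrCA ler_peMr// ltW.
lra.
Unshelve. all: by end_near. Qed.

Section inar_paths.
Context {d} {T : measurableType d} {R : realType}.
Variables (P : probability T R) (X0 : {RV P >-> nat}).
Variables (xi : nat -> nat -> {RV P >-> nat}) (eps : nat -> {RV P >-> nat}).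
Variables (alpha lambda : R).
Hypothesis alpha01 : 0 < alpha < 1.
Hypothesis lambda0 : 0 < lambda.
Hypothesis statX : stationary_poisson_inar X0 xi eps alpha lambda.

Local Notation S := (inar_centered X0 xi eps alpha lambda).
Local Notation M := (inar_diff X0 xi eps alpha lambda).

Definition inar_path n w := partial_sum_path (S ^~ w) n.

Let alpha0 : 0 < alpha. Proof. by case/andP: alpha01. Qed.
Let alphaB0 : 0 < 1 - alpha. Proof. by rewrite subr_gt0; case/andP: alpha01. Qed.

Let mS k : measurable_fun setT (S k).
Proof. exact: (adapted_measurable (adapted_centered alpha lambda (leqnn k))). Qed.

Let mM k : measurable_fun setT (M k).
Proof. exact: (adapted_measurable (adapted_diff alpha lambda (ltnSn k))). Qed.

Lemma inar_pathE n w t (a := Num.truncn (n%:R * t)) : inar_path n w t =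
  (Num.sqrt n%:R)^-1 / (1 - alpha) * (psum M a w + alpha * (S 0 w - S a w)).
Proof.
by rewrite /= /partial_sum_fun inar_partial_sum// [_ / _ * _]mulrAC mulrA.
Qed.

Lemma inar_path_measurable n t : measurable_fun setT (fun w => inar_path n w t).
Proof.
under eq_fun do rewrite inar_pathE.
apply: measurable_funM => //; apply: measurable_funD; first exact: measurable_psum.
by apply: measurable_funM => //; exact: measurable_funB.
Qed.

Let ortho k : mean P (fun w => psum M k w ^+ 3 * M k w) = 0.
Proof.
have [C C0 hC] := inar_moments alpha01 lambda0 statX.
have := @inar_diff_ortho _ _ _ _ _ _ _ _ _ alpha01 lambda0 statX k (psum M k) (fun=> 1).
rewrite (@eq_mean _ _ _ _ _ (fun w => psum M k w ^+ 3 * M k w)); last first.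
  by move=> w; rewrite mul1r.
apply => [w w' h|//|w|]; rewrite ?normr1//.
  by apply: eq_bigr => i _; apply: (adapted_diff _ _ (ltn_ord i) h).
by apply: rintegrable_psum4 => // j; have [] := hC j.
Qed.

(** Bounds uniform in [n]: the martingale part is controlled by its fourth
    moment [O(n^2)] and the two boundary terms by theirs, through
    [y^2 <= 1 + y^4]. *)
Lemma inar_path_moment2 m K : (0 < m)%N -> exists2 C, 0 <= C &
  forall n i, (i < K)%N ->
    rintegrable P (fun w => inar_path n w (i%:R / m%:R) ^+ 2) /\
    mean P (fun w => inar_path n w (i%:R / m%:R) ^+ 2) <= C.
Proof.
move=> m0; have [C C0 hC] := inar_moments alpha01 lambda0 statX.
pose ka := 3 / (1 - alpha) ^+ 2.
have ka0 : 0 <= ka by rewrite divr_ge0// exprn_ge0// ltW.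
exists (ka * (3 + 19 * C * K%:R ^+ 2 + C + C)).
  have C0' := ltW C0.
  by rewrite mulr_ge0// !addr_ge0// !mulr_ge0// exprn_ge0.
move=> n i iK; set t := i%:R / m%:R.
pose a := Num.truncn (n%:R * t).
pose x : R := n%:R^-1.
have x0 : 0 <= x by rewrite invr_ge0.
have x1 : x <= 1.
  have [n0|n0] := posnP n; first by rewrite /x n0 invr0.
  by rewrite invf_le1 ?ltr0n// ler1n.
have r2 : (Num.sqrt n%:R)^-1 ^+ 2 = x by rewrite exprVn sqr_sqrtr.
have aK : a%:R * x <= K%:R.
  rewrite /a /t truncn_grid// /x.
  have [n0|n0] := posnP n; first by rewrite n0 invr0 mulr0.
  rewrite ler_pdivrMr ?ltr0n// -natrM ler_nat (leq_trans (leq_div _ _))// mulnC.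
  by rewrite leq_mul2r ltnW// orbT.
pose g w := ka * (3 + x ^+ 2 * psum M a w ^+ 4 + S 0 w ^+ 4 + S a w ^+ 4).
have iP4 : rintegrable P (fun w => psum M a w ^+ 4).
  by apply: rintegrable_psum4 => // j; have [] := hC j.
have [iS0 mS0 _ _] := hC 0; have [iSa mSa _ _] := hC a.
have i1 := rintegrableD (rintegrable_cst P 3) (rintegrableZ (x ^+ 2) iP4).
have i2 := rintegrableD i1 iS0; have i3 := rintegrableD i2 iSa.
have ig : rintegrable P g by exact: rintegrableZ.
have le w : inar_path n w t ^+ 2 <= g w.
  rewrite inar_pathE -/a /g /ka; move: (psum M a w) (S 0 w) (S a w) => p u v.
  have -> : ((Num.sqrt n%:R)^-1 / (1 - alpha) * (p + alpha * (u - v))) ^+ 2 =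
      x * (p + alpha * (u - v)) ^+ 2 / (1 - alpha) ^+ 2.
    by rewrite 2!exprMn r2 exprVn mulrAC.
  rewrite /ka [leRHS]mulrAC ler_wpM2r ?invr_ge0 ?exprn_ge0 ?(ltW alphaB0)//.
  have h1 : (p + alpha * (u - v)) ^+ 2 <= 3 * (p ^+ 2 + u ^+ 2 + v ^+ 2).
    have h0 (y : R) : (alpha * y) ^+ 2 <= y ^+ 2.
      rewrite exprMn ler_piMl ?sqr_ge0// expr_le1 ?(ltW alpha0)//.
      by rewrite -subr_ge0 ltW.
    have := sqr_ge0 (p - alpha * u); have := sqr_ge0 (p + alpha * v).
    have := sqr_ge0 (alpha * u + alpha * v).
    have := h0 u; have := h0 v; nra.
  rewrite (le_trans (ler_wpM2l x0 h1))// mulrCA ler_pM2l//.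
  have h2 (y : R) : y ^+ 2 * x <= 1 + y ^+ 4.
    rewrite (le_trans (ler_piMr (sqr_ge0 _) x1))//.
    by have := sqr_ge0 (y ^+ 2 - 1); have := sqr_ge0 (y ^+ 2); nra.
  have h3 : p ^+ 2 * x <= 1 + x ^+ 2 * p ^+ 4.
    by have := sqr_ge0 (p ^+ 2 * x - 1); have := sqr_ge0 (p ^+ 2 * x); nra.
  have := h2 u; have := h2 v; lra.
have iX2 : rintegrable P (fun w => inar_path n w t ^+ 2).
  apply: (rintegrable_le _ _ ig) => [|w]; last by rewrite ger0_norm ?sqr_ge0.
  exact/(measurableT_comp (exprn_measurable 2))/inar_path_measurable.
split=> //; rewrite (le_trans (ler_mean iX2 ig le))//.
rewrite /g meanZ// ler_wpM2l// meanD// meanD// meanD ?mean_cst ?meanZ//; first last.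
- exact: rintegrableZ.
- exact: rintegrable_cst.
have h4 : x ^+ 2 * mean P (fun w => psum M a w ^+ 4) <= 19 * C * K%:R ^+ 2.
  have mp : mean P (fun w => psum M a w ^+ 4) <= 19 * C * a%:R ^+ 2.
    by apply: psum_moment4 => // j; have [] := hC j.
  rewrite (le_trans (ler_wpM2l (sqr_ge0 x) mp))//.
  rewrite mulrCA ler_wpM2l ?mulr_ge0 ?(ltW C0)// -exprMn mulrC.
  by rewrite lerXn2r ?nnegrE ?mulr_ge0.
lra.
Qed.

(** A linear combination of values of the path is a weighted sum of the
    martingale differences, with weights of order [n^(-1/2)], plus boundary
    terms of the same order.  For the [n K] differences the error of the
    Lindeberg telescoping is [O(n n^(-3/2))]; the conditional variances may be
    replaced by [lambda (1 + alpha)] because their deviation is a multiple of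
    [S_k], which is almost uncorrelated with the past weighted sum. *)
Lemma inar_path_fdd_error m K (th : nat -> R) ph (s2 := lambda * (1 + alpha))
    (a := fun n i => (n * i %/ m)%N) : (0 < m)%N ->
  exists2 E, 0 <= E & \forall n \near \oo,
    `|mean P (fun w => cos (\sum_(i < K) th i * inar_path n w (i%:R / m%:R) + ph)) -
      expR (- (s2 / 2 / (1 - alpha) ^+ 2 * \sum_(i < K) \sum_(j < K)
        th i * th j * ((minn (a n i) (a n j))%:R / n%:R))) * cos ph| <=
    E * (Num.sqrt n%:R)^-1.
Proof.
move=> m0; have [C C0 hC] := inar_moments alpha01 lambda0 statX.
have [D D0 hD] := inar_centered_decorrelation alpha01 lambda0 statX.
pose Th := \sum_(i < K) `|th i|.
have Th0 : 0 <= Th by apply: sumr_ge0.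
have s20 : 0 <= s2 by rewrite mulr_ge0 ?addr_ge0 ?ltW.
pose Ta := Th / (1 - alpha).
have Ta0 : 0 <= Ta by rewrite divr_ge0 ?(ltW alphaB0).
pose D' := alpha * (1 - alpha) * D.
pose E := K%:R * ((D' / 2 + 1 + C + s2 ^+ 2) * Ta ^+ 3).
have E0 : 0 <= E.
  have C0' := ltW C0; have al0 := ltW alpha0; have alB0 := ltW alphaB0.
  have D'0 : 0 <= D' by rewrite /D' !mulr_ge0.
  rewrite /E mulr_ge0// mulr_ge0//; last by rewrite exprn_ge0.
  by rewrite addr_ge0 ?exprn_ge0// addr_ge0// addr_ge0// divr_ge0.
exists (E + Ta * (2 + C + C)).
  have C0' := ltW C0.
  by rewrite addr_ge0// mulr_ge0// !addr_ge0.
have Ta1 : 0 < Ta + 1 by lra.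
have Ti : 0 < (Ta + 1)^-1 by rewrite invr_gt0.
near=> n.
have n0 : (0 < n)%N by near: n; exact: nbhs_infty_gt.
set r := (Num.sqrt n%:R)^-1.
have r0 : 0 <= r by rewrite invr_ge0 sqrtr_ge0.
have r2 : r ^+ 2 = n%:R^-1 by rewrite exprVn sqr_sqrtr.
have beta1 : Ta * r <= 1.
  have r1 : `|0 - r| <= (Ta + 1)^-1.
    by rewrite /r; near: n; have /cvgrPdist_le := @sqrt_natV_cvg R; apply.
  have {r1} : r * (Ta + 1) <= 1.
    by rewrite -ler_pdivlMr// div1r (le_trans _ r1)// sub0r normrN ler_norm.
  lra.
pose th' i := th i * (r / (1 - alpha)).
have sth' : \sum_(i < K) `|th' i| = Ta * r.
  rewrite /Ta /Th !mulr_suml; apply: eq_bigr => i _.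
  by rewrite /th' normrM (ger0_norm (divr_ge0 r0 (ltW alphaB0))) mulrAC mulrA.
have aL i : (i < K)%N -> (a n i <= n * K)%N.
  by move=> iK; rewrite (leq_trans (leq_div _ _))// leq_mul2l ltnW// orbT.
pose b := grid_weight K th' (a n).
pose U w := wsum b M (n * K) w + ph.
pose V w := \sum_(i < K) th' i * (alpha * (S 0 w - S (a n i) w)).
have decomp w : \sum_(i < K) th i * inar_path n w (i%:R / m%:R) + ph = U w + V w.
  rewrite /U /V -(wsum_grid _ _ _ aL) addrAC -big_split; congr (_ + _).
  by apply: eq_bigr => i _; rewrite [RHS]/= -mulrDr inar_pathE truncn_grid// mulrA.
have mU : measurable_fun setT U by apply: measurable_funD => //; exact: measurable_wsum.
have mV : measurable_fun setT V.
  apply: measurable_sum => i; apply: measurable_funM => //.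
  by apply: measurable_funM => //; exact: measurable_funB.
have bbeta k : `|b k| <= Ta * r by rewrite -sth'; exact: grid_weight_le.
have part1 : `|mean P (fun w => cos (U w)) -
    expR (- (s2 / 2 * \sum_(k < n * K) b k ^+ 2)) * cos ph| <= E * r.
  have M4 k : rintegrable P (fun w => M k w ^+ 4) /\ mean P (fun w => M k w ^+ 4) <= C.
    by have [] := hC k.
  have aU k ph' : adapted X0 xi eps k (fun w => wsum b M k w + ph').
    by move=> w w' h; rewrite (adapted_wsum _ _ b (leqnn k) h).
  have := @lindeberg_cos _ _ _ P M b (Ta * r) s2 C D' mM (fun k => (M4 k).1)
    (fun k => (M4 k).2) s20 beta1 bbeta _ _ (n * K) ph.
  have -> : (n * K)%:R * ((D' / 2 + 1 + C + s2 ^+ 2) * (Ta * r) ^+ 3) = E * r.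
    have nr2 : n%:R * r ^+ 2 = 1 by rewrite r2 divff// pnatr_eq0 -lt0n.
    transitivity (E * r * (n%:R * r ^+ 2)); last by rewrite nr2 mulr1.
    have cube (u v c x y : R) : u * v * (c * (x * y) ^+ 3) =
      v * (c * x ^+ 3) * y * (u * y ^+ 2) by ring.
    by rewrite natrM cube.
  apply => [k ph'|k ph']; first exact: (inar_diff_centered alpha01 lambda0 statX).
  rewrite (inar_diff_square alpha01 lambda0 statX)//.
  rewrite normrM ger0_norm ?mulr_ge0 ?(ltW alpha0) ?(ltW alphaB0)//.
  by rewrite -[leRHS]mulrA ler_wpM2l ?mulr_ge0 ?(ltW alpha0) ?(ltW alphaB0)// hD.
have part2 : `|mean P (fun w => cos (U w + V w)) - mean P (fun w => cos (U w))| <=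
    Ta * (2 + C + C) * r.
  pose f i w := `|th' i| * (2 + S 0 w ^+ 4 + S (a n i) w ^+ 4).
  have i0 j := rintegrableD (rintegrableD (rintegrable_cst P 2)
    (let: And4 i _ _ _ := hC 0 in i)) (let: And4 i _ _ _ := hC j in i).
  have fi i : rintegrable P (f i) by exact: rintegrableZ.
  have fC i : mean P (f i) <= `|th' i| * (2 + C + C).
    have [iS0 mS0 _ _] := hC 0; have [iSa mSa _ _] := hC (a n i).
    have i2 := rintegrableD (rintegrable_cst P 2) iS0.
    rewrite meanZ// ler_wpM2l// meanD// meanD//; last exact: rintegrable_cst.
    by rewrite mean_cst !lerD.
  have mcU := measurable_cos mU.
  have icU : rintegrable P (fun w => cos (U w)).
    by apply: (@rintegrable_bounded _ _ _ _ 1) => // w; exact: cos_max.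
  have mcV : measurable_fun setT (fun w => cos (U w + V w)).
    by apply: measurable_cos; exact: measurable_funD.
  have icV : rintegrable P (fun w => cos (U w + V w)).
    by apply: (@rintegrable_bounded _ _ _ _ 1) => // w; exact: cos_max.
  rewrite -meanB// mulrAC -sth' mulr_suml (le_trans _ (mean_sum_le K fi fC))//.
  apply: norm_mean_le => [||w]; first exact: measurable_funB.
    exact: rintegrable_sum.
  rewrite (le_trans (norm_cosD_le _ _))// /V (le_trans (ler_norm_sum _ _ _))//.
  apply: ler_sum => i _; rewrite normrM ler_wpM2l//.
  rewrite normrM (ger0_norm (ltW alpha0)).
  have le4 (y : R) : `|y| <= 1 + y ^+ 4.
    have -> : y ^+ 4 = `|y| ^+ 2 ^+ 2 by rewrite -exprM -normrX ger0_norm// exprn_even_ge0.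
    have := sqr_ge0 (`|y| ^+ 2 - 1); have := sqr_ge0 (`|y| - 1); nra.
  have al1 : alpha <= 1 by rewrite -subr_ge0 ltW.
  rewrite (le_trans (ler_piMl (normr_ge0 _) al1))// (le_trans (ler_normB _ _))//.
  by have := le4 (S 0 w); have := le4 (S (a n i) w); lra.
rewrite (@eq_mean _ _ _ _ _ (fun w => cos (U w + V w))); last first.
  by move=> w; rewrite decomp.
have -> : s2 / 2 / (1 - alpha) ^+ 2 * \sum_(i < K) \sum_(j < K)
    th i * th j * ((minn (a n i) (a n j))%:R / n%:R) =
    s2 / 2 * \sum_(k < n * K) b k ^+ 2.
  rewrite grid_weight_sqr// -mulrA; congr (_ * _).
  rewrite mulr_sumr; apply: eq_bigr => i _; rewrite mulr_sumr; apply: eq_bigr => j _.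
  by rewrite /th' -r2 -exprVn; ring.
have -> : mean P (fun w => cos (U w + V w)) -
    expR (- (s2 / 2 * \sum_(k < n * K) b k ^+ 2)) * cos ph =
  (mean P (fun w => cos (U w)) -
    expR (- (s2 / 2 * \sum_(k < n * K) b k ^+ 2)) * cos ph) +
  (mean P (fun w => cos (U w + V w)) - mean P (fun w => cos (U w))) by ring.
by rewrite (le_trans (ler_normD _ _))// mulrDl lerD.
Unshelve. all: by end_near. Qed.

Let s20 : 0 <= lambda * (1 + alpha).
Proof. by rewrite mulr_ge0 ?addr_ge0 ?ltW. Qed.

Lemma inar_path_fdd m K (th : nat -> R) ph
    (c := Num.sqrt (lambda * (1 + alpha)) / (1 - alpha)) : (0 < m)%N ->
  mean P (fun w => cos (\sum_(i < K) th i * inar_path n w (i%:R / m%:R) + ph))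
    @[n --> \oo] -->
  expR (- (1 / 2 * \sum_(i < K) \sum_(j < K)
    (c * th i) * (c * th j) * ((minn i j)%:R / m%:R))) * cos ph.
Proof.
move=> m0; have [E E0 hE] := inar_path_fdd_error K th ph m0.
set A := lambda * (1 + alpha) / 2 / (1 - alpha) ^+ 2 in hE.
pose q n := \sum_(i < K) \sum_(j < K)
  th i * th j * ((minn (n * i %/ m) (n * j %/ m))%:R / n%:R) : R.
have -> : 1 / 2 * \sum_(i < K) \sum_(j < K)
      (c * th i) * (c * th j) * ((minn i j)%:R / m%:R) =
    A * \sum_(i < K) \sum_(j < K) th i * th j * ((minn i j)%:R / m%:R).
  rewrite !mulr_sumr; apply: eq_bigr => i _; rewrite !mulr_sumr; apply: eq_bigr => j _.
  have -> : A = 1 / 2 * c ^+ 2 by rewrite /A /c expr_div_n sqr_sqrtr//; ring.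
  by ring.
have qc : q n @[n --> \oo] -->
    (\sum_(i < K) \sum_(j < K) th i * th j * ((minn i j)%:R / m%:R) : R).
  apply: cvg_big => [|i _]; first exact: add_continuous.
  apply: cvg_big => [|j _]; first exact: add_continuous.
  apply: cvgMr.
  have -> : (fun n => (minn (n * i %/ m) (n * j %/ m))%:R / n%:R : R) =
      (fun n => (n * minn i j %/ m)%:R / n%:R).
    apply/funext => n; congr (_%:R / _).
    by case: (leqP i j) => ij; [apply/minn_idPl|apply/minn_idPr];
      rewrite leq_div2r// leq_mul2l ?ij ?(ltnW ij) orbT.
  exact: divn_natV_cvg.
have ec : expR (- (A * q n)) * cos ph @[n --> \oo] --> expR (- (A *
    \sum_(i < K) \sum_(j < K) th i * th j * ((minn i j)%:R / m%:R))) * cos ph.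
  apply: cvgMl; apply: continuous_cvg; first exact: continuous_expR.
  by apply: cvgN; apply: cvgMr.
have rc : E * (Num.sqrt n%:R)^-1 @[n --> \oo] --> (0 : R).
  by rewrite -(mulr0 E); apply: cvgMr; exact: sqrt_natV_cvg.
apply/cvgrPdist_le => e e0.
have e2 : 0 < e / 2 by rewrite divr_gt0.
move/cvgrPdist_le/(_ _ e2) : ec => ec; move/cvgrPdist_le/(_ _ e2) : rc => rc.
near=> n.
set l := _ * cos ph; set z := mean _ _.
have h1 : `|l - expR (- (A * q n)) * cos ph| <= e / 2 by near: n; exact: ec.
have h2 : `|z - expR (- (A * q n)) * cos ph| <= E * (Num.sqrt n%:R)^-1.
  by rewrite /z; near: n; exact: hE.
have h3 : `|0 - E * (Num.sqrt n%:R)^-1| <= e / 2 by near: n; exact: rc.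
have -> : l - z = (l - expR (- (A * q n)) * cos ph) -
  (z - expR (- (A * q n)) * cos ph) by ring.
rewrite (le_trans (ler_normB _ _))//.
have := ler_norm (- (0 - E * (Num.sqrt n%:R)^-1)); rewrite normrN; lra.
Unshelve. all: by end_near. Qed.

Lemma adapted_stopped a c k :
  adapted X0 xi eps (a + k)%N (stopped (fun j => M (a + j)%N) c k).
Proof.
move=> w w'; elim: k => [//|k ih] h /=.
have h' l : (l <= a + k)%N -> inar X0 xi eps l w = inar X0 xi eps l w'.
  by move=> lk; apply: h; rewrite addnS leqW.
rewrite (ih h'); case: ifP => // _.
by rewrite (@adapted_diff _ _ _ _ _ _ _ alpha lambda (a + k.+1) (a + k) _ w w')// addnS.
Qed.

Lemma inar_stopped_moment4 a c L C :
  (forall k, rintegrable P (fun w => M k w ^+ 4)) ->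
  (forall k, mean P (fun w => M k w ^+ 4) <= C) ->
  mean P (fun w => stopped (fun j => M (a + j)%N) c L w ^+ 4) <= 19 * C * L%:R ^+ 2.
Proof.
move=> iM4 mM4; apply: stopped_moment4 => // j.
set D := fun j => M (a + j)%N.
have := @inar_diff_ortho _ _ _ _ _ _ _ _ _ alpha01 lambda0 statX (a + j)
  (stopped D c j) (fun w => if `|stopped D c j w| < c then 1 else 0).
rewrite (@eq_mean _ _ _ _ (fun w => _ * (_ * _)) (fun w =>
    stopped D c j w ^+ 3 * stopped_incr D c j w)); last first.
  by move=> w; rewrite /stopped_incr; case: ifP; rewrite ?mul1r ?mul0r.
have ad := @adapted_stopped a c j.
apply; first exact: ad.
- by move=> w w' hw; rewrite /D (ad w w' hw).
- by move=> w; case: ifP; rewrite ?normr1 ?normr0.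
- by apply: rintegrable_stopped4 => l; rewrite /D.
Qed.

(** Doob's inequality for the fourth moment, on each of the [m k + 1] blocks of
    about [n/m] differences: a block exceeds the level [c] of order [sqrt n]
    with probability [O((n/m)^2 / n^2)], so some block does with probability
    [O(1/m)].  The boundary terms exceed it with probability [O(1/n)]. *)
Lemma inar_path_tight (k : nat) (e h : R) : 0 < e -> 0 < h ->
  \forall m \near \oo, \forall n \near \oo, exists A, [/\ measurable A,
    (P A <= h%:E)%E & forall w, ~ A w -> forall s, 0 <= s <= k%:R ->
      `|grid m (inar_path n w) s - inar_path n w s| <= e].
Proof.
move=> e0 h0; have [C C0 hC] := inar_moments alpha01 lambda0 statX.
have iS4 j : rintegrable P (fun w => S j w ^+ 4) by have [] := hC j.
have mS4 j : mean P (fun w => S j w ^+ 4) <= C by have [] := hC j.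
have iM4 j : rintegrable P (fun w => M j w ^+ 4) by have [] := hC j.
have mM4 j : mean P (fun w => M j w ^+ 4) <= C by have [] := hC j.
pose ka : R := (e * (1 - alpha) / 3) ^+ 4.
have ka0 : 0 < ka by rewrite exprn_gt0// divr_gt0// mulr_gt0.
near=> m; near=> n.
have m0 : (0 < m)%N by near: m; exact: nbhs_infty_gt.
have km : (k <= m)%N by near: m; exact: nbhs_infty_ge.
(* 172 = 19 * 9 + 1: the blocks contribute [19 C L^2] with [L <= 3 n / m], the
   boundary terms [C] *)
have mbig : k.+1%:R * 172 * C / (ka * h) <= m%:R by near: m; exact: nbhs_infty_ger.
have mn : (m <= n)%N by near: n; exact: nbhs_infty_ge.
have n0 : (0 < n)%N by exact: leq_trans mn.
have mR : 0 < m%:R :> R by rewrite ltr0n.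
have nR : 0 < n%:R :> R by rewrite ltr0n.
have sn0 : 0 < Num.sqrt n%:R :> R by rewrite sqrtr_gt0.
pose c := e * (1 - alpha) * Num.sqrt n%:R / 3.
have c0 : 0 < c by rewrite divr_gt0// !mulr_gt0.
have c4 : c ^+ 4 = ka * n%:R ^+ 2.
  rewrite -[n%:R in RHS](@sqr_sqrtr _ _ (ltW nR)) /ka /c -exprM -exprMn.
  by congr (_ ^+ 4); ring.
pose a i := (n * i %/ m)%N.
(* two more than the block length, to allow for the roundings at both ends *)
pose L := (n %/ m).+2.
pose st i w := stopped (fun j => M (a i + j)%N) c L w.
have ist i : rintegrable P (fun w => st i w ^+ 4).
  by apply: rintegrable_stopped4 => // j.
have mst i : mean P (fun w => st i w ^+ 4) <= 19 * C * L%:R ^+ 2.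
  exact: inar_stopped_moment4.
pose f1 w := \sum_(i < (m * k).+1) st i w ^+ 4.
pose f2 w := \sum_(j < (n * k).+1) S j w ^+ 4.
have if1 : rintegrable P f1 by exact: (rintegrable_sum _ (fun i : 'I__ => ist i)).
have if2 : rintegrable P f2 by exact: (rintegrable_sum _ (fun i : 'I__ => iS4 i)).
have if12 := rintegrableD if1 if2.
have f10 w : 0 <= f1 w by apply: sumr_ge0 => i _; rewrite exprn_even_ge0.
have f20 w : 0 <= f2 w by apply: sumr_ge0 => i _; rewrite exprn_even_ge0.
exists [set w | c ^+ 4 <= f1 w + f2 w]; split.
- have -> : [set w | c ^+ 4 <= f1 w + f2 w] =
      (fun w => f1 w + f2 w) @^-1` `[c ^+ 4, +oo[%classic.
    by apply/seteqP; split => w /=; rewrite in_itv/= andbT.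
  rewrite -[X in measurable X]setTI.
  exact: (rintegrable_measurable if12).
- have := @markov_mean _ _ _ P (fun w => f1 w + f2 w) _ (exprn_gt0 4 c0) if12.
  move=> /(_ (fun w => addr_ge0 (f10 w) (f20 w))) /le_trans; apply.
  rewrite lee_fin ler_pdivrMr ?exprn_gt0// meanD//.
  have hm1 : mean P f1 <= (m * k).+1%:R * (19 * C * L%:R ^+ 2).
    rewrite (le_trans (mean_sum_le _ ist mst))//.
    by rewrite sumr_const card_ord -[leLHS]mulr_natl.
  have hm2 : mean P f2 <= (n * k).+1%:R * C.
    rewrite (le_trans (mean_sum_le _ iS4 mS4))//.
    by rewrite sumr_const card_ord -[leLHS]mulr_natl.
  have L3 : m%:R * L%:R <= 3 * n%:R :> R.
    rewrite -!natrM ler_nat /L -addn2 mulnDr [leqRHS]mulSn.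
    by apply: leq_add; [rewrite mulnC leq_divM|rewrite mulnC leq_mul2l mn].
  have mk : (m * k).+1%:R <= m%:R * k.+1%:R :> R.
    by rewrite -natrM ler_nat mulnS -addn1 addnC leq_add2r.
  have nk : (n * k).+1%:R <= n%:R * k.+1%:R :> R.
    by rewrite -natrM ler_nat mulnS -addn1 addnC leq_add2r.
  rewrite c4; set u := mean P f1 in hm1 *; set v := mean P f2 in hm2 *.
  have {}mbig : k.+1%:R * 172 * C <= m%:R * (ka * h).
    by rewrite -ler_pdivrMr// mulr_gt0.
  have k10 : 0 < k.+1%:R :> R by rewrite ltr0n.
  have C0' := ltW C0.
  have hu : m%:R * u <= k.+1%:R * (19 * C) * (9 * n%:R ^+ 2).
    apply: (@le_trans _ _ (m%:R * (m%:R * k.+1%:R * (19 * C * L%:R ^+ 2)))).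
      rewrite ler_pM2l// (le_trans hm1)// ler_wpM2r//.
      by rewrite !mulr_ge0// exprn_ge0.
    have -> : m%:R * (m%:R * k.+1%:R * (19 * C * L%:R ^+ 2)) =
      k.+1%:R * (19 * C) * (m%:R * L%:R) ^+ 2 by ring.
    rewrite ler_wpM2l// ?mulr_ge0// (_ : 9 * n%:R ^+ 2 = (3 * n%:R) ^+ 2); last by ring.
    by rewrite lerXn2r// nnegrE mulr_ge0.
  have hv : m%:R * v <= k.+1%:R * C * n%:R ^+ 2.
    apply: (@le_trans _ _ (m%:R * (n%:R * k.+1%:R * C))).
      by rewrite ler_pM2l// (le_trans hm2)// ler_wpM2r.
    have -> : k.+1%:R * C * n%:R ^+ 2 = n%:R * (n%:R * k.+1%:R * C) by ring.
    by rewrite ler_wpM2r ?mulr_ge0// ler_nat.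
  rewrite -(ler_pM2l mR) mulrDr (le_trans (lerD hu hv))//.
  have -> : k.+1%:R * (19 * C) * (9 * n%:R ^+ 2) + k.+1%:R * C * n%:R ^+ 2 =
    k.+1%:R * 172 * C * n%:R ^+ 2 by ring.
  have -> : m%:R * (h * (ka * n%:R ^+ 2)) = m%:R * (ka * h) * n%:R ^+ 2 by ring.
  by rewrite ler_wpM2r// exprn_ge0.
- move=> w /negP; rewrite -ltNge => fw s /andP[s0 sk].
  pose i := Num.truncn (m%:R * s); pose b := Num.truncn (n%:R * s).
  have /andP[i1 i2] := truncn_itv (mulr_ge0 (ltW mR) s0).
  have /andP[b1 b2] := truncn_itv (mulr_ge0 (ltW nR) s0).
  have im : (i < (m * k).+1)%N.
    rewrite ltnS -(ler_nat R) (le_trans i1)// natrM ler_pM2l//.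
  have bn : (b < (n * k).+1)%N.
    rewrite ltnS -(ler_nat R) (le_trans b1)// natrM ler_pM2l//.
  have ab : (a i <= b)%N.
    rewrite /b truncn_ge_nat ?mulr_ge0// -(ler_pM2r mR).
    apply: (@le_trans _ _ (n%:R * i%:R)).
      by rewrite -!natrM ler_nat leq_divM.
    by rewrite -mulrA ler_pM2l// mulrC.
  have bL : (b - a i <= L)%N.
    rewrite leq_subLR -(leq_pmul2r m0) ltnW//.
    have bi : (b * m < n * i.+1)%N.
      rewrite -(ltr_nat R) !natrM; apply: (@le_lt_trans _ _ (n%:R * (m%:R * s))).
        by rewrite mulrCA mulrC ler_pM2l.
      by rewrite ltr_pM2l.
    rewrite (leq_trans bi)// mulnS addnC /L !addnS -addSn -addnS mulnDl.
    by rewrite leq_add// ltnW// ltn_ceil.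
  have lt4 x : x ^+ 4 < c ^+ 4 -> `|x| < c.
    have e4 (y : R) : y ^+ 4 = `|y| ^+ 4 by rewrite -normrX ger0_norm// exprn_even_ge0.
    rewrite (e4 x) !ltNge; apply: contra => cx.
    by rewrite lerXn2r// nnegrE ?(ltW c0).
  have Slt j : (j < (n * k).+1)%N -> `|S j w| < c.
    move=> jn; apply: lt4; apply: le_lt_trans fw.
    rewrite -[leLHS]add0r lerD// /f2 (bigD1 (Ordinal jn))//= lerDl sumr_ge0// => l _.
    by rewrite exprn_even_ge0.
  have stlt : `|st i w| < c.
    apply: lt4; apply: le_lt_trans fw.
    rewrite -[leLHS]addr0 lerD// /f1 (bigD1 (Ordinal im))//= lerDl sumr_ge0// => l _.
    by rewrite exprn_even_ge0.
  have Mlt : `|psum (fun j => M (a i + j)%N) (b - a i) w| < c.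
    rewrite ltNge; apply/negP => cM; move: stlt; rewrite ltNge => /negP; apply.
    by apply: stopped_reaches; exists (b - a i)%N.
  have psumB : psum (fun j => M (a i + j)%N) (b - a i) w = psum M b w - psum M (a i) w.
    by rewrite -[in psum M b w](subnKC ab) psumD addrC addKr.
  rewrite gridE//; last by rewrite (le_trans sk)// ler_nat.
  rewrite !inar_pathE truncn_grid// -/(a _) -/i -/b.
  rewrite -mulrBr normrM ger0_norm; last first.
    by rewrite divr_ge0 ?invr_ge0 ?sqrtr_ge0 ?(ltW alphaB0).
  move: Mlt; rewrite psumB.
  move: (Slt _ bn) (Slt _ (leq_ltn_trans ab bn)).
  move: (S 0 w) (S b w) (S (a i) w) (psum M b w) (psum M (a i) w) => v0 vb va pb pa.
  move=> hb ha hp.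
  apply: (@le_trans _ _ ((Num.sqrt n%:R)^-1 / (1 - alpha) * (3 * c))).
    rewrite ler_wpM2l ?divr_ge0 ?invr_ge0 ?sqrtr_ge0 ?(ltW alphaB0)//.
    have -> : pa + alpha * (v0 - va) - (pb + alpha * (v0 - vb)) =
      alpha * vb - alpha * va - (pb - pa) by ring.
    have al1 : alpha <= 1 by rewrite -subr_ge0 ltW.
    have hal y : `|y| < c -> `|alpha * y| <= c.
      by move=> yc; rewrite normrM gtr0_norm// (le_trans _ (ltW yc))// ler_piMl.
    rewrite (le_trans (ler_normB _ _))//.
    have := ler_normB (alpha * vb) (alpha * va).
    by have := hal _ hb; have := hal _ ha; lra.
  by rewrite /c le_eqVlt; apply/orP; left; apply/eqP; field; rewrite !gt_eqF.
Unshelve. all: by end_near. Qed.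

End inar_paths.

(** * The invariance principle *)

Theorem proposition3p2 (R : realType) (alpha lambda : R)
    (d : measure_display) (T : measurableType d) (P : probability T R)
    (X0 : {RV P >-> nat}) (xi : nat -> nat -> {RV P >-> nat})
    (eps : nat -> {RV P >-> nat})
    (d' : measure_display) (T' : measurableType d') (P' : probability T' R)
    (B : T' -> skorokhod R) :
  0 < alpha < 1 -> 0 < lambda ->
  stationary_poisson_inar X0 xi eps alpha lambda ->
  standard_brownian_motion P' B ->
  let X := inar X0 xi eps in
  let S (k : nat) (w : T) : R :=
    (X k w)%:R - fine ('E_P[fun w' => (X k w')%:R])%E in
  weak_cvg P (fun n w => partial_sum_path (S ^~ w) n)
    P' (fun w => skorokhod_scale
                   (Num.sqrt (lambda * (1 + alpha)) / (1 - alpha)) (B w)).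
Proof.
move=> alpha01 lambda0 statX bmB X S.
have -> : S = inar_centered X0 xi eps alpha lambda.
  apply/funext => k; apply/funext => w; rewrite /S /inar_centered; congr (_ - _).
  by rewrite unlock -(inar_mean alpha01 lambda0 statX k).
have [mB _ _ _ cB] := bmB.
apply: weak_cvg_criterion.
- exact: inar_path_measurable alpha01.
- by move=> t; exact: measurable_funM.
- by move=> n; exists (fun j => (n * j)%N) => w k e e0; exact: grid_partial_sum.
- move=> w k e e0; apply: grid_continuous => // t.
  by apply: cvgM; [exact: cvg_cst|exact: cB].
- move=> m K m0.
  have [C C0 hC] := inar_path_moment2 alpha01 lambda0 statX K m0.
  set c := _ / _.
  have iB i : rintegrable P' (fun w => B w (i%:R / m%:R) ^+ 2).
    by apply: (bm_moment2 bmB); rewrite divr_ge0.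
  pose C' := \sum_(i < K) mean P' (fun w => B w (i%:R / m%:R) ^+ 2).
  have C'0 : 0 <= C' by apply: sumr_ge0 => i _; apply: mean_ge0 => w; exact: sqr_ge0.
  exists (C + c ^+ 2 * C'); first by rewrite addr_ge0// mulr_ge0// sqr_ge0.
  split=> [n i iK|i iK].
    have [i1 i2] := hC n i iK; split=> //.
    by rewrite (le_trans i2)// lerDl mulr_ge0// sqr_ge0.
  have -> : (fun w => skorokhod_scale c (B w) (i%:R / m%:R) ^+ 2) =
      (fun w => c ^+ 2 * B w (i%:R / m%:R) ^+ 2).
    by apply/funext => w /=; rewrite exprMn.
  split; first exact: rintegrableZ.
  rewrite meanZ// -[leLHS]add0r lerD// ler_wpM2l ?sqr_ge0//.
  rewrite /C' (bigD1 (Ordinal iK))//= lerDl sumr_ge0// => j _.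
  by apply: mean_ge0 => w; exact: sqr_ge0.
- move=> m K th ph m0; set c := _ / _.
  rewrite (@eq_mean _ _ _ _ (fun w => cos (_ + ph)) (fun w =>
    cos (\sum_(i < K) (c * th i) * B w (i%:R / m%:R) + ph))); last first.
    by move=> w; congr cos; congr (_ + _); apply: eq_bigr => i _ /=; rewrite mulrCA mulrA.
  rewrite (bm_cos bmB K (fun i => c * th i) ph m0).
  exact: (inar_path_fdd alpha01 lambda0 statX).
- by move=> k e h e0 h0; exact: (inar_path_tight alpha01 lambda0 statX).
Qed.
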